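(* Let $n\ge0$ be an integer. Then for every $\delta>0$, $$C(\partial^{-n}A,\delta)=C(\partial^{-n}H^\infty,\delta).$$
   Context: $\mathbb{D}$ is the open unit disk in $\mathbb{C}$. For an integer $n\ge 0$: - $\partial^{-n}H^\infty$ is the algebra of analytic functions $f$ on $\mathbb{D}$ such that $f,f',\ldots,f^{(n)}$ are bounded on $\mathbb{D}$. - $\partial^{-n}A$ is the algebra of analytic functions $f$ on $\mathbb{D}$ such that $f,f',\ldots,f^{(n)}$ belong to the disk algebra $A$ (analytic functions on $\mathbb{D}$ extending continuously to $\overline{\mathbb{D}}$). For $\mathcal{A}$ one of these algebras, $\mathcal{A}(\ell^2)$ is the corresponding space of $\ell^2$-valued analytic functions on $\mathbb{D}$ (derivatives up to order $n$ bounded, and, for $\partial^{-n}A$, extending continuously to $\overline{\mathbb{D}}$ as functions into $\ell^2$ with its norm topology), with norm $$\|f\|_{\mathcal{A}(\ell^2)}=\sum_{j=0}^n\frac1{j!}\sup_{z\in\mathbb{D}}\|f^{(j)}(z)\|_{\ell^2}.$$ For $\delta>0$, the best possible estimate on the norm of the solution of the Bezout equation is $$C(\mathcal{A},\delta):=\sup_f\,\inf\Big\{\|g\|_{\mathcal{A}(\ell^2)} : g\in\mathcal{A}(\ell^2),\ g\cdot f:=\sum_k g_kf_k\equiv 1 \text{ on } \mathbb{D}\Big\},$$ where the supremum is over all $f=(f_1,f_2,\ldots)\in\mathcal{A}(\ell^2)$ with $\|f\|_{\mathcal{A}(\ell^2)}\le1$ and $\|f(z)\|_{\ell^2}=\big(\sum_k|f_k(z)|^2\big)^{1/2}\ge\delta$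 for all $z\in\mathbb{D}$. *)

(* Defs.v *)
(* Stdlib reals with Coquelicot. *)
From Stdlib Require Import Reals Factorial Lra.
From Stdlib Require Import FunctionalExtensionality Classical_Prop ClassicalEpsilon.
From Coquelicot Require Import Coquelicot.

Open Scope R_scope.

Definition square_summable (u : nat -> C) : Prop :=
  ex_series (fun k => Cmod (u k) ^ 2).

Record ell2 : Type := Ell2
  { coef :> nat -> C;
    coef_summable : square_summable coef }.

Definition ell2_norm (u : ell2) : R :=
  sqrt (Series (fun k => Cmod (u k) ^ 2)).

Local Ltac creal := match goal with |- ?a = ?b => change (@eq R a b) end.
Local Ltac ccplx := match goal with |- ?a = ?b => change (@eq C a b) end.

Lemma ell2_ext (u v : ell2) : (forall k, u k = v k) -> u = v.
Proof.
  destruct u as [u Hu], v as [v Hv]; simpl; intros H.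
  assert (E : u = v) by (apply functional_extensionality; exact H).
  subst v; f_equal; apply proof_irrelevance.
Qed.

Lemma Cmod_plus_sq (a b : C) : Cmod (a + b) ^ 2 <= 2 * Cmod a ^ 2 + 2 * Cmod b ^ 2.
Proof.
  pose proof (Cmod_triangle a b); pose proof (Cmod_ge_0 (a + b)).
  pose proof (pow2_ge_0 (Cmod a - Cmod b)); nra.
Qed.

Lemma square_summable_zero : square_summable (fun _ => 0%C).
Proof.
  exists 0; apply filterlim_ext with (fun _ : nat => 0).
  - intros n; induction n as [|n IH].
    + rewrite sum_O, Cmod_0; simpl; ring.
    + rewrite sum_Sn, <- IH, Cmod_0; unfold plus; simpl; ring.
  - apply filterlim_const.
Qed.

Lemma square_summable_plus (u v : nat -> C) :
  square_summable u -> square_summable v ->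
  square_summable (fun k => u k + v k)%C.
Proof.
  intros Hu Hv.
  apply (@ex_series_le R_AbsRing R_CompleteNormedModule) with
    (b := fun k => 2 * Cmod (u k) ^ 2 + 2 * Cmod (v k) ^ 2).
  - intros k; unfold norm; simpl; unfold abs; simpl.
    rewrite Rabs_pos_eq by (apply (pow2_ge_0 (Cmod (u k + v k)))).
    apply (Cmod_plus_sq (u k) (v k)).
  - apply (@ex_series_plus R_AbsRing R_NormedModule).
    + apply (@ex_series_scal_l R_AbsRing) with (c := 2); exact Hu.
    + apply (@ex_series_scal_l R_AbsRing) with (c := 2); exact Hv.
Qed.

Lemma square_summable_scal (c : C) (u : nat -> C) :
  square_summable u -> square_summable (fun k => c * u k)%C.
Proof.
  intros Hu.
  apply (@ex_series_ext R_AbsRing R_NormedModule) with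
    (a := fun k => (Cmod c ^ 2) * Cmod (u k) ^ 2).
  - intros k; creal; rewrite Cmod_mult; ring.
  - apply (@ex_series_scal_l R_AbsRing) with (c := Cmod c ^ 2); exact Hu.
Qed.

Definition ell2_zero : ell2 := Ell2 _ square_summable_zero.
Definition ell2_plus (u v : ell2) : ell2 :=
  Ell2 _ (square_summable_plus u v (coef_summable u) (coef_summable v)).
Definition ell2_scal (c : C) (u : ell2) : ell2 :=
  Ell2 _ (square_summable_scal c u (coef_summable u)).
Definition ell2_opp (u : ell2) : ell2 := ell2_scal (Copp 1) u.

Definition ell2_AbelianMonoid_mixin : AbelianMonoid.mixin_of ell2.
Proof.
  refine (AbelianMonoid.Mixin ell2 ell2_plus ell2_zero _ _ _);
    intros; apply ell2_ext; intros k; ccplx; simpl; ring.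
Defined.

Canonical ell2_AbelianMonoid := AbelianMonoid.Pack ell2 ell2_AbelianMonoid_mixin ell2.

Definition ell2_AbelianGroup_mixin : AbelianGroup.mixin_of ell2_AbelianMonoid.
Proof.
  refine (AbelianGroup.Mixin ell2_AbelianMonoid ell2_opp _).
  intros; apply ell2_ext; intros k; ccplx; simpl; ring.
Defined.

Canonical ell2_AbelianGroup :=
  AbelianGroup.Pack ell2 (AbelianGroup.Class _ _ ell2_AbelianGroup_mixin) ell2.

Definition ell2_ModuleSpace_mixin : ModuleSpace.mixin_of C_Ring ell2_AbelianGroup.
Proof.
  refine (ModuleSpace.Mixin C_Ring ell2_AbelianGroup ell2_scal _ _ _ _);
    intros; apply ell2_ext; intros k; ccplx; simpl;
    unfold mult, one, plus; simpl; ring.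
Defined.

Canonical ell2_ModuleSpace :=
  ModuleSpace.Pack C_Ring ell2 (ModuleSpace.Class _ _ _ ell2_ModuleSpace_mixin) ell2.

Lemma Series_zero (a : nat -> R) : (forall k, a k = 0) -> Series a = 0.
Proof.
  intros H; rewrite (Series_ext a (fun k => 0 * a k)) by (intros k; rewrite H; ring).
  rewrite Series_scal_l; ring.
Qed.

Lemma ell2_Series_ge_0 (u : ell2) : 0 <= Series (fun k => Cmod (u k) ^ 2).
Proof.
  rewrite <- (Series_zero (fun _ => 0)) by reflexivity.
  apply Series_le.
  - intros k; split; [lra | apply pow2_ge_0].
  - exact (coef_summable u).
Qed.

Lemma ell2_norm_ge_0 (u : ell2) : 0 <= ell2_norm u.
Proof. apply sqrt_pos. Qed.

Lemma ell2_norm_sq (u : ell2) : ell2_norm u ^ 2 = Series (fun k => Cmod (u k) ^ 2).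
Proof. apply pow2_sqrt, ell2_Series_ge_0. Qed.

Lemma ell2_coef_le (u : ell2) (k : nat) : Cmod (u k) <= ell2_norm u.
Proof.
  apply Rsqr_incr_0_var; [| apply ell2_norm_ge_0].
  rewrite !Rsqr_pow2, ell2_norm_sq.
  assert (Hs : forall n, Cmod (u n) ^ 2 <= sum_n (fun j => Cmod (u j) ^ 2) n).
  { intros [|n].
    - rewrite sum_O; lra.
    - rewrite sum_Sn; unfold plus; simpl.
      enough (0 <= sum_n (fun j => Cmod (u j) ^ 2) n) by (simpl in *; lra).
      induction n as [|n IH].
      + rewrite sum_O; apply pow2_ge_0.
      + rewrite sum_Sn; unfold plus; simpl.
        pose proof (pow2_ge_0 (Cmod (u (S n)))); simpl in *; lra. }
  apply Rle_trans with (1 := Hs k).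
  assert (L : is_lim_seq (sum_n (fun j => Cmod (u j) ^ 2))
                (Series (fun j => Cmod (u j) ^ 2)))
    by exact (Series_correct _ (coef_summable u)).
  apply (is_lim_seq_incr_compare _ _ L).
  intros n; rewrite sum_Sn; unfold plus; simpl.
  pose proof (pow2_ge_0 (Cmod (u (S n)))); simpl in *; lra.
Qed.

Lemma ell2_norm_eq_0 (u : ell2) : ell2_norm u = 0 -> u = ell2_zero.
Proof.
  intros H; apply ell2_ext; intros k; simpl; apply Cmod_eq_0.
  pose proof (ell2_coef_le u k); pose proof (Cmod_ge_0 (u k)); lra.
Qed.

Lemma ell2_norm_zero : ell2_norm ell2_zero = 0.
Proof.
  unfold ell2_norm; rewrite Series_zero; [apply sqrt_0 |].
  intros k; simpl; rewrite Cmod_0; ring.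
Qed.

Lemma ell2_norm_scal (c : C) (u : ell2) : ell2_norm (ell2_scal c u) = Cmod c * ell2_norm u.
Proof.
  unfold ell2_norm; simpl.
  rewrite (Series_ext _ (fun k => Cmod c ^ 2 * Cmod (u k) ^ 2))
    by (intros k; rewrite Cmod_mult; ring).
  rewrite Series_scal_l, sqrt_mult_alt by apply pow2_ge_0.
  rewrite sqrt_pow2 by apply Cmod_ge_0; reflexivity.
Qed.

Lemma ell2_norm_triangle (u v : ell2) :
  ell2_norm (ell2_plus u v) <= ell2_norm u + ell2_norm v.
Proof.
  destruct (Req_dec (ell2_norm u) 0) as [Hu | Hu].
  { apply ell2_norm_eq_0 in Hu; subst u.
    rewrite ell2_norm_zero, Rplus_0_l; right; f_equal.
    apply ell2_ext; intros k; ccplx; simpl; ring. }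
  destruct (Req_dec (ell2_norm v) 0) as [Hv | Hv].
  { apply ell2_norm_eq_0 in Hv; subst v.
    rewrite ell2_norm_zero, Rplus_0_r; right; f_equal.
    apply ell2_ext; intros k; ccplx; simpl; ring. }
  pose proof (ell2_norm_ge_0 u); pose proof (ell2_norm_ge_0 v).
  pose proof (ell2_norm_sq u) as Su; pose proof (ell2_norm_sq v) as Sv.
  set (a := ell2_norm u) in *; set (b := ell2_norm v) in *.
  assert (a_gt0 : 0 < a) by lra; assert (b_gt0 : 0 < b) by lra.
  apply Rsqr_incr_0_var; [| lra].
  rewrite !Rsqr_pow2, ell2_norm_sq.
  apply Rle_trans with
    (Series (fun k => (1 + b / a) * Cmod (u k) ^ 2 + (1 + a / b) * Cmod (v k) ^ 2)).
  - apply Series_le.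
    + intros k; split; [apply pow2_ge_0 | simpl coef].
      set (x := Cmod (u k)); set (y := Cmod (v k)).
      apply Rle_trans with ((x + y) ^ 2).
      * apply pow_incr; split; [apply Cmod_ge_0 | apply Cmod_triangle].
      * enough (0 <= (b * x - a * y) ^ 2 / (a * b)).
        { replace ((1 + b / a) * x ^ 2 + (1 + a / b) * y ^ 2)
            with ((x + y) ^ 2 + (b * x - a * y) ^ 2 / (a * b)) by (field; lra).
          lra. }
        apply Rmult_le_pos; [apply pow2_ge_0 |].
        left; apply Rinv_0_lt_compat, Rmult_lt_0_compat; assumption.
    + apply (@ex_series_plus R_AbsRing R_NormedModule);
        apply (@ex_series_scal_l R_AbsRing);
        [exact (coef_summable u) | exact (coef_summable v)].
  - rewrite Series_plus, !Series_scal_l, <- Su, <- Sv.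
    + right; field; lra.
    + apply (@ex_series_scal_l R_AbsRing); exact (coef_summable u).
    + apply (@ex_series_scal_l R_AbsRing); exact (coef_summable v).
Qed.

Definition ell2_ball (u : ell2) (e : R) (v : ell2) : Prop := ell2_norm (minus v u) < e.

Definition ell2_UniformSpace_mixin : UniformSpace.mixin_of ell2.
Proof.
  refine (UniformSpace.Mixin ell2 ell2_zero ell2_ball _ _ _); unfold ell2_ball.
  - intros x e.
    rewrite (minus_eq_zero (G := ell2_AbelianGroup) x).
    change (ell2_norm ell2_zero < e); rewrite ell2_norm_zero; apply cond_pos.
  - intros x y e H.
    replace (minus x y) with (ell2_scal (Copp 1) (minus y x)).
    + rewrite ell2_norm_scal, Cmod_opp, Cmod_1, Rmult_1_l; exact H.
    + apply ell2_ext; intros k; ccplx; simpl; ring.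
  - intros x y z e1 e2 H1 H2.
    replace (minus z x) with (ell2_plus (minus y x) (minus z y)).
    + pose proof (ell2_norm_triangle (minus y x) (minus z y)); lra.
    + apply ell2_ext; intros k; ccplx; simpl; ring.
Defined.

Canonical ell2_UniformSpace := UniformSpace.Pack ell2 ell2_UniformSpace_mixin ell2.

Canonical ell2_NormedModuleAux :=
  NormedModuleAux.Pack C_AbsRing ell2
    (NormedModuleAux.Class C_AbsRing ell2
      (ModuleSpace.class _ ell2_ModuleSpace) (UniformSpace.class ell2_UniformSpace)) ell2.

Definition ell2_NormedModule_mixin :
  NormedModule.mixin_of C_AbsRing ell2_NormedModuleAux.
Proof.
  refine (NormedModule.Mixin C_AbsRing ell2_NormedModuleAux ell2_norm 1 _ _ _ _ _).
  - exact ell2_norm_triangle.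
  - intros c u; right; apply ell2_norm_scal.
  - intros x y e H; exact H.
  - intros x y e H; rewrite Rmult_1_l; exact H.
  - exact ell2_norm_eq_0.
Defined.

Canonical ell2_NormedModule :=
  NormedModule.Pack C_AbsRing ell2
    (NormedModule.Class C_AbsRing ell2 _ ell2_NormedModule_mixin) ell2.

(* Functions on the disk are total on C; only their values on [disk] are ever
   used, apart from the extension to [closed_disk] in [disk_algebra]. *)
Definition disk (z : C) : Prop := Cmod z < 1.
Definition closed_disk (z : C) : Prop := Cmod z <= 1.

Definition analytic {V : NormedModule C_AbsRing} (f : C -> V) : Prop :=
  forall z, disk z -> ex_derive f z.

(* Complex derivative, for the norm of V; an arbitrary value where f is not
   differentiable. Coquelicot has such an operator only for V = C. *)
Definition deriv {V : NormedModule C_AbsRing} (f : C -> V) (z : C) : V :=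
  epsilon (inhabits zero) (fun l : V => is_derive f z l).

Definition nderiv {V : NormedModule C_AbsRing} (j : nat) (f : C -> V) : C -> V :=
  Nat.iter j deriv f.

Definition bounded_on_disk {V : NormedModule C_AbsRing} (f : C -> V) : Prop :=
  exists M : R, forall z, disk z -> norm (f z) <= M.

Definition disk_algebra {V : NormedModule C_AbsRing} (f : C -> V) : Prop :=
  analytic f /\
  exists F : C -> V, continuous_on closed_disk F /\ forall z, disk z -> F z = f z.

(* The spaces d^{-n} H^oo (V) and d^{-n} A (V); V = C gives the algebras. *)
Definition dHinf (n : nat) (V : NormedModule C_AbsRing) (f : C -> V) : Prop :=
  analytic f /\ forall j, (j <= n)%nat -> bounded_on_disk (nderiv j f).

Definition dA (n : nat) (V : NormedModule C_AbsRing) (f : C -> V) : Prop :=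
  analytic f /\ forall j, (j <= n)%nat -> disk_algebra (nderiv j f).

(* [real] sends +oo to 0: meaningful only when f is bounded on the disk, which
   holds for every derivative entering [dnorm] below when f is in one of the
   two spaces above. *)
Definition sup_norm {V : NormedModule C_AbsRing} (f : C -> V) : R :=
  real (Lub_Rbar (fun r => exists z, disk z /\ r = norm (f z))).

Definition dnorm (n : nat) {V : NormedModule C_AbsRing} (f : C -> V) : R :=
  sum_f_R0 (fun j => / INR (fact j) * sup_norm (nderiv j f)) n.

(* g . f = sum_k g_k f_k, without conjugation, identically 1 on the disk. *)
Definition bezout (g f : C -> ell2) : Prop :=
  forall z, disk z -> is_series (fun k => (g z k * f z k)%C) (1%C : C).

Definition corona_data (n : nat)
    (A : forall V : NormedModule C_AbsRing, (C -> V) -> Prop) (delta : R) (f : C -> ell2) : Prop :=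
  A ell2_NormedModule f /\ dnorm n f <= 1 /\ forall z, disk z -> delta <= norm (f z).

Definition solution_norm (n : nat)
    (A : forall V : NormedModule C_AbsRing, (C -> V) -> Prop) (f : C -> ell2) : Rbar :=
  Glb_Rbar (fun r => exists g, A ell2_NormedModule g /\ bezout g f /\ r = dnorm n g).

(* C(A, delta), the space A(l^2) being normed by [dnorm n]. It takes values in
   [-oo, +oo]: the infimum is +oo when f has no solution, and the supremum is
   -oo when there is no f at all (e.g. delta > 1). *)
Definition bezout_constant (n : nat)
    (A : forall V : NormedModule C_AbsRing, (C -> V) -> Prop) (delta : R) : Rbar :=
  Rbar_lub (fun c => exists f, corona_data n A delta f /\ c = solution_norm n A f).

(* Main.v *)
Require Import Defs.
From Stdlib Require Import Reals Factorial Cantor Lra Lia ClassicalEpsilon Classical.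
From Coquelicot Require Import Coquelicot.
Open Scope R_scope.

(* Both inequalities come from dilations f_r(z) = f(rz), which map d^{-n} H^oo
   into d^{-n} A without increasing the norm.
   If f is in d^{-n} A and g in d^{-n} H^oo solves g . f = 1, then g_r / (g_r . f)
   solves it in d^{-n} A; since g_r . f_r = 1 and f_r -> f in norm as r -> 1, the
   denominator tends to 1 in norm, so the correction costs nothing in the limit.
   If f is in d^{-n} H^oo, solve for the f_r in d^{-n} A with almost optimal norms:
   a diagonal sequence of these solutions converges coefficientwise, its limit
   solves g . f = 1, and its norm does not exceed the bound by weak lower
   semicontinuity of the l^2 norm.
   Analyticity of the derivatives is obtained from Goursat's theorem: a bounded
   complex differentiable l^2-valued function has a Taylor series on the disk
   whose coefficients are bounded in l^2. *)

(** * Bisection of rectangles *)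

(** The hypothesis [analytic] only gives a complex derivative at each point, and [deriv] merely
    chooses one; differentiability of the higher derivatives therefore has to come from an integral
    formula. One family of maps, (x, y) |-> w + x c(y) on a rectangle, yields both integral facts:
    with w = 0 and c a circle it sweeps an annulus (independence of the radius), with c a circle
    minus w it contracts the circle towards w (Cauchy's formula). The two inequalities meet
    different obstacles. Dividing g_r by h = g_r . f requires control of 1/h before r is known,
    since r is chosen in terms of it; hence bounds for reciprocals that are uniform in h. The
    solutions for f_r converge only weakly in l^2 at each point, and the equation survives because
    f_r(z) tends to f(z) in norm. Weak limits lose continuity up to the circle, so this limit is
    sought in d^{-n} H^oo. Since [dnorm] adds suprema of different derivatives, those suprema are
    made to converge one by one along the extracted sequence. *)

Record rect : Type := Rect { x_min : R; x_max : R; y_min : R; y_max : R }.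

Definition rect_ok (s : rect) : Prop := x_min s <= x_max s /\ y_min s <= y_max s.

Definition rect_incl (s s' : rect) : Prop :=
  x_min s' <= x_min s /\ x_max s <= x_max s' /\ y_min s' <= y_min s /\ y_max s <= y_max s'.

Definition rect_mem (x y : R) (s : rect) : Prop :=
  x_min s <= x <= x_max s /\ y_min s <= y <= y_max s.

Definition quarter (i j : bool) (s : rect) : rect :=
  let m := (x_min s + x_max s) / 2 in
  let p := (y_min s + y_max s) / 2 in
  Rect (if i then m else x_min s) (if i then x_max s else m)
       (if j then p else y_min s) (if j then y_max s else p).

Lemma nested_intervals (a b : nat -> R) :
  (forall n, a n <= b n) ->
  (forall n, a n <= a (S n)) -> (forall n, b (S n) <= b n) ->
  exists x, forall n, a n <= x <= b n.
Proof.
  intros Hab Ha Hb.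
  assert (Ha' : forall n k, a n <= a (n + k)%nat).
  { intros n k; induction k as [|k IH]; [rewrite Nat.add_0_r; lra |].
    rewrite Nat.add_succ_r; specialize (Ha (n + k)%nat); lra. }
  assert (Hb' : forall n k, b (n + k)%nat <= b n).
  { intros n k; induction k as [|k IH]; [rewrite Nat.add_0_r; lra |].
    rewrite Nat.add_succ_r; specialize (Hb (n + k)%nat); lra. }
  assert (Hc : forall n m, a n <= b m).
  { intros n m; pose proof (Ha' n m); pose proof (Hb' m n).
    rewrite Nat.add_comm in H0; specialize (Hab (n + m)%nat); lra. }
  destruct (ex_finite_lim_seq_incr a (b 0%nat)) as [x Hx]; auto.
  exists x; intros n; split.
  - apply (is_lim_seq_incr_compare _ _ Hx Ha).
  - apply (is_lim_seq_le a (fun _ => b n) x (b n)); auto using is_lim_seq_const.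
Qed.

(** If [s0] were bad, some quarter would be bad, and so on; the nested bad rectangles shrink to a
    point, where the local hypothesis makes a small enough one good. *)
Lemma rect_bisection (P : rect -> Prop) (s0 : rect) :
  rect_ok s0 ->
  (forall s, rect_ok s -> rect_incl s s0 ->
     (forall i j, P (quarter i j s)) -> P s) ->
  (forall x y, rect_mem x y s0 ->
     exists d, 0 < d /\ forall s, rect_ok s -> rect_incl s s0 -> rect_mem x y s ->
       x_max s - x_min s < d -> y_max s - y_min s < d -> P s) ->
  P s0.
Proof.
  intros ok0 Hq Hloc; apply NNPP; intros Hbad.
  set (bad := fun s => rect_ok s /\ rect_incl s s0 /\ ~ P s).
  (* Chooses a bad quarter; the choice is meaningful because every bad rectangle has one. *)
  set (next := fun s => epsilon (inhabits s0)
         (fun s' => bad s' /\ exists i j, s' = quarter i j s)).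
  assert (Hnext : forall s, bad s -> bad (next s) /\ exists i j, next s = quarter i j s).
  { intros s (Hok & Hi & Hn); unfold next.
    apply (epsilon_spec (inhabits s0)
      (fun s' => bad s' /\ exists i j, s' = quarter i j s)).
    apply NNPP; intros Hno; apply Hn, Hq; auto.
    intros i j; apply NNPP; intros HP; apply Hno.
    exists (quarter i j s); split; [| exists i, j; reflexivity].
    repeat split; auto; destruct Hok, Hi as (? & ? & ? & ?); destruct i, j; simpl; lra. }
  set (u := fun n => Nat.iter n next s0).
  assert (Hu : forall n, bad (u n)).
  { induction n as [|n IH].
    - repeat split; auto; try apply ok0; unfold rect_incl; simpl; lra.
    - apply (Hnext _ IH). }
  assert (Hs : forall n, exists i j, u (S n) = quarter i j (u n)).
  { intros n; apply (Hnext _ (Hu n)). }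
  assert (Hsz : forall n, x_max (u n) - x_min (u n) = (x_max s0 - x_min s0) * (/ 2) ^ n
                       /\ y_max (u n) - y_min (u n) = (y_max s0 - y_min s0) * (/ 2) ^ n).
  { induction n as [|n [IH1 IH2]]; [simpl; lra |].
    destruct (Hs n) as (i & j & E); rewrite E; clear E.
    rewrite <- tech_pow_Rmult.
    split; [destruct i | destruct j]; simpl; lra. }
  destruct (nested_intervals (fun n => x_min (u n)) (fun n => x_max (u n))) as [x Hx].
  { intros n; apply (Hu n). }
  { intros n; destruct (Hs n) as (i & j & E); rewrite E.
    destruct (Hu n) as ((? & ?) & _); destruct i; simpl; lra. }
  { intros n; destruct (Hs n) as (i & j & E); rewrite E.
    destruct (Hu n) as ((? & ?) & _); destruct i; simpl; lra. }
  destruct (nested_intervals (fun n => y_min (u n)) (fun n => y_max (u n))) as [y Hy].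
  { intros n; apply (Hu n). }
  { intros n; destruct (Hs n) as (i & j & E); rewrite E.
    destruct (Hu n) as ((? & ?) & _); destruct j; simpl; lra. }
  { intros n; destruct (Hs n) as (i & j & E); rewrite E.
    destruct (Hu n) as ((? & ?) & _); destruct j; simpl; lra. }
  destruct (Hloc x y (conj (Hx 0%nat) (Hy 0%nat))) as (d & d_gt0 & Hd).
  (* The summand 1 keeps [S0] positive for a degenerate rectangle, so that d / S0 makes sense. *)
  set (S0 := (x_max s0 - x_min s0) + (y_max s0 - y_min s0) + 1).
  destruct ok0 as [ok1 ok2].
  destruct (pow_lt_1_zero (/ 2)) with (y := d / S0) as [N HN].
  { rewrite Rabs_pos_eq; lra. }
  { apply Rdiv_lt_0_compat; unfold S0; lra. }
  specialize (HN N (le_n N)).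
  assert (p_gt0 : 0 < (/ 2) ^ N) by (apply pow_lt; lra).
  rewrite Rabs_pos_eq in HN by lra.
  assert (HN' : S0 * (/ 2) ^ N < d).
  { apply (Rmult_lt_compat_l S0) in HN; [| unfold S0; lra].
    replace (S0 * (d / S0)) with d in HN by (field; unfold S0; lra); exact HN. }
  destruct (Hu N) as (Hok & Hi & Hn); apply Hn.
  destruct (Hsz N) as [E1 E2].
  apply (Hd _ Hok Hi); [split; auto | |].
  - rewrite E1; apply Rle_lt_trans with (2 := HN').
    apply Rmult_le_compat_r; unfold S0; lra.
  - rewrite E2; apply Rle_lt_trans with (2 := HN').
    apply Rmult_le_compat_r; unfold S0; lra.
Qed.

(** * Integrals of complex functions of a real variable *)

Definition CInt (f : R -> C) (a b : R) : C :=
  (RInt (fun s => Re (f s)) a b, RInt (fun s => Im (f s)) a b).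

Definition Ccont (f : R -> C) (s : R) : Prop :=
  continuous (fun s => Re (f s)) s /\ continuous (fun s => Im (f s)) s.

Lemma ex_CInt (f : R -> C) a b :
  a <= b -> (forall s, a <= s <= b -> Ccont f s) ->
  ex_RInt (fun s => Re (f s)) a b /\ ex_RInt (fun s => Im (f s)) a b.
Proof.
  intros Hab H; split; apply (ex_RInt_continuous (V := R_CompleteNormedModule));
    rewrite Rmin_left, Rmax_right by exact Hab; intros; apply H; assumption.
Qed.

Lemma CInt_Chasles (f : R -> C) (a b c : R) :
  a <= b <= c -> (forall s, a <= s <= c -> Ccont f s) ->
  (CInt f a b + CInt f b c)%C = CInt f a c.
Proof.
  intros [Hab Hbc] H.
  destruct (ex_CInt f a b) as [? ?]; [lra | intros; apply H; lra |].
  destruct (ex_CInt f b c) as [? ?]; [lra | intros; apply H; lra |].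
  unfold CInt, Cplus; simpl; f_equal;
    apply (RInt_Chasles (V := R_CompleteNormedModule)); assumption.
Qed.

Lemma CInt_ext (f g : R -> C) (a b : R) :
  a <= b -> (forall s, a <= s <= b -> f s = g s) -> CInt f a b = CInt g a b.
Proof.
  intros Hab H; unfold CInt; f_equal; apply RInt_ext;
    rewrite Rmin_left, Rmax_right by exact Hab;
    intros s Hs; rewrite H; auto; lra.
Qed.

Lemma CInt_plus (f g : R -> C) (a b : R) :
  a <= b -> (forall s, a <= s <= b -> Ccont f s) -> (forall s, a <= s <= b -> Ccont g s) ->
  CInt (fun s => f s + g s)%C a b = (CInt f a b + CInt g a b)%C.
Proof.
  intros Hab Hf Hg.
  destruct (ex_CInt f a b Hab Hf), (ex_CInt g a b Hab Hg).
  unfold CInt, Cplus; simpl; f_equal;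
    apply (RInt_plus (V := R_CompleteNormedModule)); assumption.
Qed.

Lemma CInt_scal (k : C) (f : R -> C) (a b : R) :
  a <= b -> (forall s, a <= s <= b -> Ccont f s) ->
  CInt (fun s => k * f s)%C a b = (k * CInt f a b)%C.
Proof.
  intros Hab Hf; destruct (ex_CInt f a b Hab Hf) as [E1 E2].
  unfold CInt; apply injective_projections; simpl.
  - etransitivity.
    { apply (RInt_minus (V := R_CompleteNormedModule)
        (fun s => scal (fst k) (Re (f s))) (fun s => scal (snd k) (Im (f s))));
      apply (ex_RInt_scal (V := R_NormedModule)); assumption. }
    rewrite !(RInt_scal (V := R_CompleteNormedModule)) by assumption; reflexivity.
  - etransitivity.
    { apply (RInt_plus (V := R_CompleteNormedModule)
        (fun s => scal (fst k) (Im (f s))) (fun s => scal (snd k) (Re (f s))));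
      apply (ex_RInt_scal (V := R_NormedModule)); assumption. }
    rewrite !(RInt_scal (V := R_CompleteNormedModule)) by assumption; reflexivity.
Qed.

(** The integral is seen as one integral with values in the real normed space C: bounding the two
    components separately would lose a factor. *)
Lemma CInt_le (f : R -> C) (a b M : R) :
  a <= b -> (forall s, a <= s <= b -> Ccont f s) ->
  (forall s, a <= s <= b -> Cmod (f s) <= M) ->
  Cmod (CInt f a b) <= (b - a) * M.
Proof.
  intros Hab Hf HM; destruct (ex_CInt f a b Hab Hf) as [E1 E2].
  rewrite Cmod_norm.
  apply (norm_RInt_le_const (V := C_R_NormedModule) f a b); auto.
  - intros x Hx; rewrite <- Cmod_norm; auto.
  - apply (is_RInt_fct_extend_pair (U := R_NormedModule) (V := R_NormedModule));
      apply (RInt_correct (V := R_CompleteNormedModule)); assumption.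
Qed.

Lemma CInt_const (k : C) (a b : R) : CInt (fun _ => k) a b = (RtoC (b - a) * k)%C.
Proof.
  unfold CInt; rewrite !RInt_const; apply injective_projections; simpl;
    unfold scal, Re, Im; simpl; unfold mult; simpl; ring.
Qed.

Lemma Ccont_const (k : C) s : Ccont (fun _ => k) s.
Proof. split; apply continuous_const. Qed.

Lemma Ccont_plus (f g : R -> C) s :
  Ccont f s -> Ccont g s -> Ccont (fun s => f s + g s)%C s.
Proof.
  intros [? ?] [? ?]; split;
  [apply (continuous_plus (fun s => Re (f s)) (fun s => Re (g s)))
  |apply (continuous_plus (fun s => Im (f s)) (fun s => Im (g s)))]; assumption.
Qed.

Lemma Ccont_mult (f g : R -> C) s :
  Ccont f s -> Ccont g s -> Ccont (fun s => f s * g s)%C s.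
Proof.
  intros [? ?] [? ?]; split; simpl.
  - apply (continuous_minus (fun s => Re (f s) * Re (g s)) (fun s => Im (f s) * Im (g s)));
    apply (continuous_mult (K := R_AbsRing)); assumption.
  - apply (continuous_plus (fun s => Re (f s) * Im (g s)) (fun s => Im (f s) * Re (g s)));
    apply (continuous_mult (K := R_AbsRing)); assumption.
Qed.

Lemma Ccont_ext (f g : R -> C) s : (forall s, f s = g s) -> Ccont f s -> Ccont g s.
Proof.
  intros E [H1 H2]; split.
  - apply continuous_ext with (2 := H1); intros; rewrite E; reflexivity.
  - apply continuous_ext with (2 := H2); intros; rewrite E; reflexivity.
Qed.

Lemma Ccont_continuous (f : R -> C) s :
  Ccont f s <-> continuous (U := C_UniformSpace) f s.
Proof.
  split.
  - intros [H1 H2].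
    apply filterlim_locally; intros e.
    apply filter_imp with (2 := filter_and _ _
      (proj1 (filterlim_locally _ _) H1 e) (proj1 (filterlim_locally _ _) H2 e)).
    intros t [? ?]; split; assumption.
  - intros H; split; apply filterlim_locally; intros e;
      apply filter_imp with (2 := proj1 (filterlim_locally _ _) H e);
      intros t [? ?]; assumption.
Qed.

(** [ex_derive] uses the uniform structure of C as a valued ring, while the path lemmas use the
    product structure; [locally_C] identifies their neighbourhoods. *)
Lemma ex_derive_continuous_C {V : NormedModule C_AbsRing} (f : C -> V) (z : C) :
  ex_derive f z -> continuous (T := C_UniformSpace) f z.
Proof.
  intros H; apply ex_derive_continuous in H.
  intros P HP; specialize (H P HP).
  apply locally_C, H.
Qed.

Lemma Ccont_comp (f : C -> C) (g : R -> C) s :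
  Ccont g s -> ex_derive f (g s) -> Ccont (fun s => f (g s)) s.
Proof.
  intros Hg Hf; apply Ccont_continuous.
  apply (continuous_comp (V := C_UniformSpace) g f).
  - apply Ccont_continuous, Hg.
  - exact (ex_derive_continuous_C f _ Hf).
Qed.

Definition Cderiv (g : R -> C) (s : R) (l : C) : Prop :=
  is_derive (fun s => Re (g s)) s (Re l) /\ is_derive (fun s => Im (g s)) s (Im l).

Lemma Cderiv_cont g s l : Cderiv g s l -> Ccont g s.
Proof.
  intros [H1 H2]; split; apply (ex_derive_continuous (K := R_AbsRing) (V := R_NormedModule)); eexists; eassumption.
Qed.

Lemma CInt_derive (f f' : R -> C) (a b : R) :
  a <= b -> (forall s, a <= s <= b -> Cderiv f s (f' s)) ->
  (forall s, a <= s <= b -> Ccont f' s) ->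
  CInt f' a b = (f b - f a)%C.
Proof.
  intros Hab Hd Hc; unfold CInt; apply injective_projections;
    apply (is_RInt_unique (V := R_CompleteNormedModule));
    [apply (is_RInt_derive (V := R_CompleteNormedModule) (fun s => Re (f s)) (fun s => Re (f' s)))
    |apply (is_RInt_derive (V := R_CompleteNormedModule) (fun s => Im (f s)) (fun s => Im (f' s)))];
    rewrite Rmin_left, Rmax_right by exact Hab;
    intros; first [apply Hd | apply Hc]; assumption.
Qed.

(** This is the real part of A g + B (g - P)^2 / 2 with A = a + i b, B = c + i d, g = x + i y, P = p
    + i q. Since Im X = Re (-i X), the imaginary part is the same formula for -i A and -i B. *)
Lemma is_derive_quadratic (a b c d p q x' y' s : R) (x y : R -> R) :
  is_derive x s x' -> is_derive y s y' ->
  is_derive (fun s => a * x s - b * y s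
      + (c * ((x s - p) ^ 2 - (y s - q) ^ 2) - d * (2 * (x s - p) * (y s - q))) / 2) s
    (a * x' - b * y' + (c * ((x s - p) * x' - (y s - q) * y')
                        - d * (x' * (y s - q) + (x s - p) * y'))).
Proof.
  intros Hx Hy; auto_derive.
  - repeat split; eexists; eassumption.
  - rewrite (is_derive_unique _ _ _ Hx : Derive (fun t => x t) s = x').
    rewrite (is_derive_unique _ _ _ Hy : Derive (fun t => y t) s = y').
    field.
Qed.

Lemma Cderiv_affine_primitive (A B p : C) (g : R -> C) s l :
  Cderiv g s l ->
  Cderiv (fun s => A * g s + B * ((g s - p) * (g s - p)) / 2)%C s
         ((A + B * (g s - p)) * l)%C.
Proof.
  intros [H1 H2]; split.
  - evar_last.
    + eapply is_derive_ext;
        [| exact (is_derive_quadratic (fst A) (snd A) (fst B) (snd B) (fst p) (snd p) _ _ s _ _ H1 H2)].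
      intros t; unfold Re, Im; simpl; field.
    + unfold Re, Im; simpl; ring.
  - evar_last.
    + eapply is_derive_ext;
        [| exact (is_derive_quadratic (snd A) (- fst A) (snd B) (- fst B) (fst p) (snd p) _ _ s _ _ H1 H2)].
      intros t; unfold Re, Im; simpl; field.
    + unfold Re, Im; simpl; ring.
Qed.

(** * Goursat's theorem *)

Lemma is_derive_eps {V : NormedModule C_AbsRing} (f : C -> V) (z : C) (l : V) :
  is_derive f z l <->
  forall e, 0 < e -> exists d, 0 < d /\ forall w, Cmod (w - z) < d ->
    norm (minus (minus (f w) (f z)) (scal (w - z)%C l)) <= e * Cmod (w - z).
Proof.
  split.
  - intros [_ H] e He.
    destruct (H z (fun P HP => HP) (mkposreal e He)) as [d Hd].
    exists d; split; [apply cond_pos |].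
    intros w Hw; apply (Hd w); exact Hw.
  - intros H; split; [apply is_linear_scal_l |].
    intros y Hy e.
    apply (is_filter_lim_locally_unique (K := C_AbsRing) (V := AbsRing_NormedModule C_AbsRing)) in Hy; subst y.
    destruct (H e (cond_pos e)) as (d & Hd & H').
    exists (mkposreal d Hd); intros w Hw; apply (H' w); exact Hw.
Qed.

(** The affine part of [phi] has an exact primitive, so only the deviation from it has to be
    estimated. Around a closed path the increments of the primitive will cancel. *)
Lemma CInt_path_affine (phi : C -> C) (g g' : R -> C) (a b : R) (A B p : C) (e L : R) :
  a <= b ->
  (forall s, a <= s <= b -> Cderiv g s (g' s)) ->
  (forall s, a <= s <= b -> Ccont g' s) ->
  (forall s, a <= s <= b -> Ccont (fun s => phi (g s)) s) ->
  (forall s, a <= s <= b -> Cmod (g' s) <= L) ->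
  (forall s, a <= s <= b -> Cmod (phi (g s) - (A + B * (g s - p))) <= e) ->
  Cmod (CInt (fun s => phi (g s) * g' s)%C a b
        - ((A * g b + B * ((g b - p) * (g b - p)) / 2)
           - (A * g a + B * ((g a - p) * (g a - p)) / 2)))
  <= (b - a) * (e * L).
Proof.
  intros Hab Hg Hg' Hphi HL He.
  assert (Hgc : forall s, a <= s <= b -> Ccont (fun s => g s - p)%C s).
  { intros s Hs; apply Ccont_plus; [apply (Cderiv_cont g s _ (Hg s Hs)) | apply Ccont_const]. }
  assert (Haff : forall s, a <= s <= b -> Ccont (fun s => A + B * (g s - p))%C s).
  { intros s Hs; apply Ccont_plus; [apply Ccont_const |].
    apply Ccont_mult; [apply Ccont_const | apply Hgc, Hs]. }
  assert (Hdiff : forall s, a <= s <= b ->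
            Ccont (fun s => (phi (g s) + (-1) * (A + B * (g s - p))) * g' s)%C s).
  { intros s Hs; apply Ccont_mult; [| auto]; apply Ccont_plus; [auto |].
    apply Ccont_mult; [apply Ccont_const | auto]. }
  rewrite (CInt_ext _ (fun s => (phi (g s) + (-1) * (A + B * (g s - p))) * g' s
                                + (A + B * (g s - p)) * g' s)%C a b Hab)
    by (intros; ring).
  rewrite CInt_plus; auto; [| intros; apply Ccont_mult; auto].
  rewrite (CInt_derive (fun s => A * g s + B * ((g s - p) * (g s - p)) / 2)%C
             (fun s => (A + B * (g s - p)) * g' s)%C a b Hab);
    [| intros; apply Cderiv_affine_primitive; auto | intros; apply Ccont_mult; auto].
  match goal with |- Cmod ?x <= _ =>
    replace x with (CInt (fun s => (phi (g s) + (-1) * (A + B * (g s - p))) * g' s)%C a b) by ring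
  end.
  apply CInt_le; auto.
  intros s Hs; rewrite Cmod_mult.
  apply Rmult_le_compat; auto using Cmod_ge_0.
  replace (phi (g s) + -1 * (A + B * (g s - p)))%C
    with (phi (g s) - (A + B * (g s - p)))%C by ring; auto.
Qed.

Lemma Cderiv_lin (w k : C) (s : R) : Cderiv (fun t => w + t * k)%C s k.
Proof.
  split; unfold Re, Im; simpl; auto_derive; auto; ring.
Qed.

Lemma Cderiv_scal (w k : C) (c : R -> C) (s : R) (l : C) :
  Cderiv c s l -> Cderiv (fun t => w + k * c t)%C s (k * l)%C.
Proof.
  intros H.
  destruct (Cderiv_affine_primitive k 0 0 c s l H) as [H1 H2].
  split.
  - evar_last; [eapply is_derive_ext;
      [| eapply (is_derive_plus (fun _ => Re w)); [apply is_derive_const | exact H1]] |].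
    + intros t; unfold Re; simpl; unfold plus; simpl; field.
    + unfold Re, plus, zero; simpl; ring.
  - evar_last; [eapply is_derive_ext;
      [| eapply (is_derive_plus (fun _ => Im w)); [apply is_derive_const | exact H2]] |].
    + intros t; unfold Im; simpl; unfold plus; simpl; field.
    + unfold Im, plus, zero; simpl; ring.
Qed.

(** The sides are taken counterclockwise: right side upwards, left side downwards, top leftwards,
    bottom rightwards. *)
Definition cone_boundary (phi : C -> C) (w : C) (c c' : R -> C) (s : rect) : C :=
  (CInt (fun y => phi (w + x_max s * c y) * (x_max s * c' y)) (y_min s) (y_max s)
   - CInt (fun y => phi (w + x_min s * c y) * (x_min s * c' y)) (y_min s) (y_max s)
   - CInt (fun x => phi (w + x * c (y_max s)) * c (y_max s)) (x_min s) (x_max s)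
   + CInt (fun x => phi (w + x * c (y_min s)) * c (y_min s)) (x_min s) (x_max s))%C.

(** A move in x costs |x2 - x1| |c|, a move in y costs at most |x1| <= 1 times the variation of c,
    which is the integral of c'. One constant L bounding c and c' serves both. *)
Lemma Cmod_dist_cone (c c' : R -> C) (w : C) (s0 s : rect) (L x1 y1 x2 y2 : R) :
  0 <= x_min s0 -> x_max s0 <= 1 ->
  (forall y, y_min s0 <= y <= y_max s0 -> Cderiv c y (c' y)) ->
  (forall y, y_min s0 <= y <= y_max s0 -> Ccont c' y) ->
  (forall y, y_min s0 <= y <= y_max s0 -> Cmod (c y) <= L /\ Cmod (c' y) <= L) ->
  rect_incl s s0 -> rect_mem x1 y1 s -> rect_mem x2 y2 s ->
  Cmod ((w + x2 * c y2) - (w + x1 * c y1)) <= L * ((x_max s - x_min s) + (y_max s - y_min s)).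
Proof.
  intros X0 X1 Hc Hc' HL (? & ? & ? & ?) [? ?] [? ?].
  assert (L_ge0 : 0 <= L).
  { destruct (HL y1) as [Hl _]; [lra |]; pose proof (Cmod_ge_0 (c y1)); lra. }
  replace ((w + x2 * c y2) - (w + x1 * c y1))%C
    with ((x2 - x1) * c y2 + x1 * (c y2 - c y1))%C by ring.
  rewrite Rmult_plus_distr_l; eapply Rle_trans; [apply Cmod_triangle |].
  rewrite !Cmod_mult; apply Rplus_le_compat.
  - rewrite Rmult_comm; apply Rmult_le_compat; auto using Cmod_ge_0.
    + apply HL; lra.
    + rewrite <- RtoC_minus, Cmod_R; apply Rabs_le; lra.
  - assert (Hlip : forall u v, u <= v -> rect_mem x1 u s -> rect_mem x1 v s ->
                    Cmod (c v - c u) <= L * (y_max s - y_min s)).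
    { intros u v Huv [? ?] [? ?].
      rewrite <- (CInt_derive c c' u v Huv) by (intros; first [apply Hc | apply Hc']; lra).
      eapply Rle_trans.
      - apply CInt_le with (M := L); [exact Huv | |]; intros; first [apply Hc' | apply HL]; lra.
      - rewrite Rmult_comm; apply Rmult_le_compat_l; lra. }
    rewrite <- (Rmult_1_l (L * _)); apply Rmult_le_compat; auto using Cmod_ge_0.
    + rewrite Cmod_R; apply Rabs_le; lra.
    + destruct (Rle_dec y1 y2).
      * apply Hlip; auto; split; auto; lra.
      * replace (c y2 - c y1)%C with (- (c y1 - c y2))%C by ring.
        rewrite Cmod_opp; apply Hlip; try split; auto; lra.
Qed.

(* Goursat's theorem for the pullback of [phi dz] under [(x, y) |-> w + x c(y)]. *)
Lemma cone_goursat (phi : C -> C) (w : C) (c c' : R -> C) (s0 : rect) (L : R) :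
  rect_ok s0 -> 0 <= x_min s0 -> x_max s0 <= 1 ->
  (forall y, y_min s0 <= y <= y_max s0 -> Cderiv c y (c' y)) ->
  (forall y, y_min s0 <= y <= y_max s0 -> Ccont c' y) ->
  (forall y, y_min s0 <= y <= y_max s0 -> Cmod (c y) <= L /\ Cmod (c' y) <= L) ->
  (forall x y, rect_mem x y s0 -> ex_derive phi (w + x * c y)%C) ->
  cone_boundary phi w c c' s0 = 0.
Proof.
  intros ok0 X0 X1 Hc Hc' HL Hphi.
  assert (L_ge0 : 0 <= L).
  { destruct ok0; destruct (HL (y_min s0)) as [Hl _]; [lra |].
    pose proof (Cmod_ge_0 (c (y_min s0))); lra. }
  assert (Hhor : forall x y, rect_mem x y s0 ->
            Ccont (fun y => phi (w + x * c y)%C) y).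
  { intros x y Hxy; apply (Ccont_comp phi (fun y => w + x * c y)%C).
    - eapply Cderiv_cont, Cderiv_scal, Hc; apply Hxy.
    - apply Hphi, Hxy. }
  assert (Hver : forall x y, rect_mem x y s0 ->
            Ccont (fun x => phi (w + x * c y)%C) x).
  { intros x y Hxy; apply (Ccont_comp phi (fun x => w + x * c y)%C).
    - eapply Cderiv_cont, Cderiv_lin.
    - apply Hphi, Hxy. }
  assert (Hhor' : forall x y, rect_mem x y s0 ->
            Ccont (fun y => phi (w + x * c y) * (x * c' y))%C y).
  { intros x y Hxy; apply Ccont_mult; auto.
    apply Ccont_mult; [apply Ccont_const | apply Hc', Hxy]. }
  assert (Hver' : forall x y, rect_mem x y s0 ->
            Ccont (fun x => phi (w + x * c y) * c y)%C x).
  { intros x y Hxy; apply Ccont_mult; auto using Ccont_const. }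
  apply Cmod_eq_0.
  set (S0 := (x_max s0 - x_min s0) + (y_max s0 - y_min s0)).
  (* The square is what bisection preserves: each quarter has half the side lengths, so four
     quarters of the bound add up to the bound itself. *)
  assert (Hall : forall e, 0 < e -> Cmod (cone_boundary phi w c c' s0) <= e * S0 ^ 2).
  { intros e He.
    unfold S0.
    apply (rect_bisection (fun s => Cmod (cone_boundary phi w c c' s)
                  <= e * ((x_max s - x_min s) + (y_max s - y_min s)) ^ 2) s0 ok0).
    - intros s [ok1 ok2] (I1 & I2 & I3 & I4) Hq.
      set (m := (x_min s + x_max s) / 2) in *; set (p := (y_min s + y_max s) / 2) in *.
      assert (Em : m = (x_min s + x_max s) / 2) by reflexivity.
      assert (Ep : p = (y_min s + y_max s) / 2) by reflexivity.
      replace (cone_boundary phi w c c' s) with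
        (cone_boundary phi w c c' (quarter false false s)
         + cone_boundary phi w c c' (quarter true false s)
         + cone_boundary phi w c c' (quarter false true s)
         + cone_boundary phi w c c' (quarter true true s))%C.
      + pose proof (Hq false false) as H1; pose proof (Hq true false) as H2;
        pose proof (Hq false true) as H3; pose proof (Hq true true) as H4.
        (* Each round splits off the last quarter and moves its bound v to the right, writing r as
           (r - v) + v. *)
        repeat (eapply Rle_trans; [apply Cmod_triangle |];
                eapply Rle_trans; [apply Rplus_le_compat_l; eassumption |];
                match goal with |- _ <= ?r => idtac end;
                match goal with |- ?u + ?v <= ?r =>
                  apply Rle_trans with ((r - v) + v); [apply Rplus_le_compat_r | lra] end).
        clear H2 H3 H4 Hq; eapply Rle_trans; [exact H1 |].
        simpl; fold m p; rewrite Em, Ep; right; field.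
      + set (hor := fun x a b => CInt (fun y => phi (w + x * c y) * (x * c' y))%C a b).
        set (ver := fun y a b => CInt (fun x => phi (w + x * c y) * c y)%C a b).
        assert (Eh : forall x, x_min s <= x <= x_max s ->
                  (hor x (y_min s) p + hor x p (y_max s))%C = hor x (y_min s) (y_max s)).
        { intros x Hx; apply CInt_Chasles; [lra |].
          intros y Hy; apply Hhor'; split; lra. }
        assert (Ev : forall y, y_min s <= y <= y_max s ->
                  (ver y (x_min s) m + ver y m (x_max s))%C = ver y (x_min s) (x_max s)).
        { intros y Hy; apply CInt_Chasles; [lra |].
          intros x Hx; apply Hver'; split; lra. }
        assert (EF : forall s, cone_boundary phi w c c' s
                  = (hor (x_max s) (y_min s) (y_max s) - hor (x_min s) (y_min s) (y_max s)
                     - ver (y_max s) (x_min s) (x_max s) + ver (y_min s) (x_min s) (x_max s))%C)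
          by reflexivity.
        rewrite !EF; clearbody hor ver; simpl; fold m p.
        rewrite <- (Eh (x_min s)), <- (Eh (x_max s)), <- (Ev (y_min s)), <- (Ev (y_max s)) by lra.
        ring.
    - intros x0 y0 H0.
      destruct (Hphi x0 y0 H0) as [l Hl].
      pose proof (proj1 (is_derive_eps phi _ l) Hl) as Hl'; clear Hl.
      (* The four sides together give an error 2 S (e1 L S L) = 2 L^2 e1 S^2, which must not exceed
         e S^2; the summand 1 covers L = 0. *)
      set (e1 := e / (2 * (L * L) + 1)).
      assert (LL : 0 <= L * L) by (apply Rmult_le_pos; lra).
      assert (e1_gt0 : 0 < e1) by (apply Rdiv_lt_0_compat; lra).
      destruct (Hl' e1 e1_gt0) as (d & d_gt0 & Hd); clear Hl'.
      set (z0 := (w + x0 * c y0)%C) in *.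
      (* Two sides shorter than this give L S < d, so the whole image of [s] lies where the
         derivative estimate holds. *)
      exists (d / (2 * (L + 1))); split; [apply Rdiv_lt_0_compat; lra |].
      intros s [ok1 ok2] HI Hm Hx Hy.
      pose proof HI as (I1 & I2 & I3 & I4).
      set (S := (x_max s - x_min s) + (y_max s - y_min s)).
      assert (S_ge0 : 0 <= S) by (unfold S; lra).
      assert (HS : L * S < d).
      { apply Rle_lt_trans with ((L + 1) * S); [nra |].
        apply Rlt_le_trans with ((L + 1) * (d / (2 * (L + 1)) + d / (2 * (L + 1)))).
        - apply Rmult_lt_compat_l; unfold S; lra.
        - right; field; lra. }
      assert (Herr : forall x y, rect_mem x y s ->
                Cmod (phi (w + x * c y) - (phi z0 + l * ((w + x * c y) - z0)))%C
                <= e1 * (L * S)).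
      { intros x y Hxy.
        pose proof (Cmod_dist_cone c c' w s0 s L x0 y0 x y X0 X1 Hc Hc' HL HI Hm Hxy) as Hdist.
        eapply Rle_trans; [| apply Rmult_le_compat_l; [lra | exact Hdist]].
        eapply Rle_trans; [| apply Hd; eapply Rle_lt_trans; [exact Hdist | exact HS]].
        set (z := (w + x * c y)%C).
        change (Cmod (phi z - (phi z0 + l * (z - z0))) <= Cmod ((phi z - phi z0) - (z - z0) * l)).
        right; f_equal; ring. }
      set (Q := fun z => (phi z0 * z + l * ((z - z0) * (z - z0)) / 2)%C).
      assert (Eh : forall x, x_min s <= x <= x_max s ->
        Cmod (CInt (fun y => phi (w + x * c y) * (x * c' y))%C (y_min s) (y_max s)
              - (Q (w + x * c (y_max s)) - Q (w + x * c (y_min s))))%C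
        <= (y_max s - y_min s) * (e1 * (L * S) * L)).
      { intros x Hx'.
        apply (CInt_path_affine phi (fun y => w + x * c y)%C (fun y => x * c' y)%C);
          auto; intros y Hy'.
        - apply Cderiv_scal, Hc; lra.
        - apply Ccont_mult; [apply Ccont_const | apply Hc'; lra].
        - apply Hhor; split; lra.
        - rewrite Cmod_mult, Cmod_R, <- (Rmult_1_l L).
          apply Rmult_le_compat; auto using Rabs_pos, Cmod_ge_0.
          + apply Rabs_le; lra.
          + apply HL; lra.
        - apply Herr; split; lra. }
      assert (Ev : forall y, y_min s <= y <= y_max s ->
        Cmod (CInt (fun x => phi (w + x * c y) * c y)%C (x_min s) (x_max s)
              - (Q (w + x_max s * c y) - Q (w + x_min s * c y)))%C
        <= (x_max s - x_min s) * (e1 * (L * S) * L)).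
      { intros y Hy'.
        apply (CInt_path_affine phi (fun x => w + x * c y)%C (fun x => c y));
          auto; intros x Hx'.
        - apply Cderiv_lin.
        - apply Ccont_const.
        - apply Hver; split; lra.
        - apply HL; lra.
        - apply Herr; split; lra. }
      pose proof (Eh (x_max s) ltac:(lra)) as B1; pose proof (Eh (x_min s) ltac:(lra)) as B2.
      pose proof (Ev (y_max s) ltac:(lra)) as B3; pose proof (Ev (y_min s) ltac:(lra)) as B4.
      apply Rle_trans with (2 * S * (e1 * (L * S) * L)).
      + unfold cone_boundary; unfold S at 1.
        match type of B1 with Cmod ?a <= _ => match type of B2 with Cmod ?b <= _ =>
        match type of B3 with Cmod ?u <= _ => match type of B4 with Cmod ?v <= _ =>
          match goal with |- Cmod ?x <= _ => replace x with (a + - b + - u + v)%C by ring end;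
          pose proof (Cmod_triangle (a + - b + - u) v);
          pose proof (Cmod_triangle (a + - b) (- u)); pose proof (Cmod_triangle a (- b));
          rewrite !Cmod_opp in *
        end end end end.
        lra.
      + unfold e1; fold S.
        replace (2 * S * (e / (2 * (L * L) + 1) * (L * S) * L))
          with (e * S ^ 2 * (2 * (L * L) / (2 * (L * L) + 1))) by (field; lra).
        rewrite <- (Rmult_1_r (e * S ^ 2)) at 2.
        apply Rmult_le_compat_l.
        * apply Rmult_le_pos; [lra | apply pow2_ge_0].
        * apply (Rmult_le_reg_r (2 * (L * L) + 1)); [lra |].
          unfold Rdiv; rewrite Rmult_assoc, Rinv_l; lra. }
  apply Rle_antisym; [| apply Cmod_ge_0].
  apply Rnot_lt_le; intros Hpos.
  set (N := Cmod (cone_boundary phi w c c' s0)) in *.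
  assert (S2 : 0 <= S0 ^ 2) by apply pow2_ge_0.
  specialize (Hall (N / (2 * (S0 ^ 2 + 1)))).
  assert (H : 0 < N / (2 * (S0 ^ 2 + 1))) by (apply Rdiv_lt_0_compat; lra).
  specialize (Hall H).
  assert (N / (2 * (S0 ^ 2 + 1)) * S0 ^ 2 <= N / (2 * (S0 ^ 2 + 1)) * (S0 ^ 2 + 1)) by nra.
  assert (N / (2 * (S0 ^ 2 + 1)) * (S0 ^ 2 + 1) = N / 2) by (field; lra).
  lra.
Qed.

(** * Complex derivatives *)

Lemma plus_swap {G : AbelianGroup} (a b c : G) : plus a (plus b c) = plus b (plus a c).
Proof. rewrite plus_assoc, (plus_comm a b), <- plus_assoc; reflexivity. Qed.

Lemma plus_cancel {G : AbelianGroup} (a b : G) : plus (opp a) (plus a b) = b.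
Proof. rewrite plus_assoc, plus_opp_l, plus_zero_l; reflexivity. Qed.

(** The algebra of the product rule: p, q, r are the products at (w, w), (z, w), (z, z), s and t the
    two linear terms, and x is s with its second argument moved from w to z. *)
Lemma minus_telescope {G : AbelianGroup} (p q r s t x : G) :
  plus (plus (minus (minus p q) s) (minus (minus q r) t)) (minus s x)
  = minus (minus p r) (plus x t).
Proof.
  unfold minus; rewrite opp_plus, <- !plus_assoc; f_equal.
  rewrite (plus_swap (opp s) q), plus_cancel.
  rewrite (plus_swap (opp s) (opp r)), (plus_swap (opp s) (opp t)), (plus_cancel s).
  f_equal; apply plus_comm.
Qed.

Lemma plus_minus_r {G : AbelianGroup} (x y : G) : plus y (minus x y) = x.
Proof.
  unfold minus; rewrite (plus_swap y x), (plus_opp_r y); apply plus_zero_r.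
Qed.

Lemma norm_minus_sym {K : AbsRing} {V : NormedModule K} (x y : V) :
  norm (minus x y) = norm (minus y x).
Proof. rewrite <- norm_opp, opp_minus; reflexivity. Qed.

Lemma norm_minus_triangle {K : AbsRing} {V : NormedModule K} (x y z : V) :
  norm (minus x z) <= norm (minus x y) + norm (minus y z).
Proof. rewrite (minus_trans y); apply norm_triangle. Qed.

Lemma norm_le_minus {K : AbsRing} {V : NormedModule K} (x y : V) :
  norm x <= norm y + norm (minus x y).
Proof.
  rewrite <- (plus_minus_r x y) at 1; apply (norm_triangle y (minus x y)).
Qed.

(** A normed module only provides the inequality from left to right; applying it to 1/k gives the
    converse. *)
Lemma norm_scal_C {V : NormedModule C_AbsRing} (k : C) (x : V) :
  norm (scal k x) = Cmod k * norm x.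
Proof.
  destruct (Ceq_dec k 0) as [-> | Hk].
  - rewrite Cmod_0, Rmult_0_l, (scal_zero_l x : scal (RtoC 0) x = zero).
    apply (@norm_zero C_AbsRing V).
  - apply Rle_antisym; [apply (@norm_scal C_AbsRing V) |].
    assert (Hk' : 0 < Cmod k) by (apply Cmod_gt_0; exact Hk).
    apply (Rmult_le_reg_l (/ Cmod k)); [apply Rinv_0_lt_compat; lra |].
    rewrite <- Rmult_assoc, Rinv_l, Rmult_1_l by lra.
    replace x with (scal (/ k)%C (scal k x)) at 1.
    + rewrite <- Cmod_inv by exact Hk; apply (@norm_scal C_AbsRing V).
    + rewrite (scal_assoc (/ k)%C k x : _ = scal (/ k * k)%C x).
      rewrite Cinv_l by exact Hk; apply (scal_one x).
Qed.

Lemma is_derive_continuous_eps {V : NormedModule C_AbsRing} (f : C -> V) (z : C) (l : V) :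
  is_derive f z l ->
  forall e, 0 < e -> exists d, 0 < d /\ forall w, Cmod (w - z) < d -> norm (minus (f w) (f z)) < e.
Proof.
  intros H e He.
  destruct (proj1 (is_derive_eps f z l) H 1 Rlt_0_1) as (d & Hd & H').
  pose proof (norm_ge_0 l) as Hl.
  exists (Rmin d (e / (norm l + 1))); split.
  { apply Rmin_glb_lt; [| apply Rdiv_lt_0_compat]; lra. }
  intros w Hw.
  assert (Hw1 := Rlt_le_trans _ _ _ Hw (Rmin_l _ _)).
  assert (Hw2 := Rlt_le_trans _ _ _ Hw (Rmin_r _ _)).
  specialize (H' w Hw1).
  pose proof (norm_le_minus (minus (f w) (f z)) (scal (w - z)%C l)) as B.
  rewrite norm_scal_C in B.
  apply Rle_lt_trans with (Cmod (w - z) * (norm l + 1)); [lra |].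
  apply (Rmult_lt_compat_r (norm l + 1)) in Hw2; [| lra].
  replace (e / (norm l + 1) * (norm l + 1)) with e in Hw2 by (field; lra); exact Hw2.
Qed.

(** One notion for multiplication in C, scalars acting on V and the product on l^2, so that the
    product rule and its bounds are proved once. The constant is 1 in all these cases. *)
Record bounded_bilinear {U V W : NormedModule C_AbsRing} (B : U -> V -> W) : Prop :=
  { bil_plus_l : forall a b c, B (plus a b) c = plus (B a c) (B b c);
    bil_plus_r : forall a b c, B a (plus b c) = plus (B a b) (B a c);
    bil_scal_l : forall k a b, B (scal k a) b = scal k (B a b);
    bil_scal_r : forall k a b, B a (scal k b) = scal k (B a b);
    bil_norm : forall a b, norm (B a b) <= norm a * norm b }.

Lemma bil_minus_l {U V W : NormedModule C_AbsRing} (B : U -> V -> W) :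
  bounded_bilinear B -> forall a b c, B (minus a b) c = minus (B a c) (B b c).
Proof.
  intros H a b c; unfold minus.
  etransitivity; [apply (bil_plus_l B H) |]; f_equal.
  transitivity (scal (opp one) (B b c)); [| apply (scal_opp_one (B b c))].
  rewrite <- (bil_scal_l B H); f_equal.
  symmetry; apply (scal_opp_one b).
Qed.

Lemma bil_minus_r {U V W : NormedModule C_AbsRing} (B : U -> V -> W) :
  bounded_bilinear B -> forall a b c, B a (minus b c) = minus (B a b) (B a c).
Proof.
  intros H a b c; unfold minus.
  etransitivity; [apply (bil_plus_r B H) |]; f_equal.
  transitivity (scal (opp one) (B a c)); [| apply (scal_opp_one (B a c))].
  rewrite <- (bil_scal_r B H); f_equal.
  symmetry; apply (scal_opp_one c).
Qed.

Lemma is_derive_bilinear {U V W : NormedModule C_AbsRing} (B : U -> V -> W)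
    (u : C -> U) (v : C -> V) (z : C) (du : U) (dv : V) :
  bounded_bilinear B -> is_derive u z du -> is_derive v z dv ->
  is_derive (fun w => B (u w) (v w)) z (plus (B du (v z)) (B (u z) dv)).
Proof.
  intros HB Hu Hv; apply is_derive_eps; intros e He.
  pose proof (norm_ge_0 du) as G1; pose proof (norm_ge_0 (u z)) as G2;
  pose proof (norm_ge_0 (v z)) as G3.
  (* The remainder splits into three terms of size at most e1 |h| times |v z| + 1, |u z| and |du|; D
     is the sum of these factors. *)
  set (D := norm (v z) + 1 + norm (u z) + norm du).
  assert (HD : 0 < D) by (unfold D; lra).
  set (e1 := e / D); assert (He1 : 0 < e1) by (apply Rdiv_lt_0_compat; lra).
  destruct (proj1 (is_derive_eps _ _ _) Hu e1 He1) as (d1 & Hd1 & H1).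
  destruct (proj1 (is_derive_eps _ _ _) Hv e1 He1) as (d2 & Hd2 & H2).
  (* The 1 bounds |v w| by |v z| + 1; the e1 controls the change of [v] in the third term. *)
  destruct (is_derive_continuous_eps _ _ _ Hv (Rmin 1 e1)) as (d3 & Hd3 & H3).
  { apply Rmin_glb_lt; lra. }
  exists (Rmin d1 (Rmin d2 d3)); split; [repeat apply Rmin_glb_lt; auto |].
  intros w Hw.
  assert (W1 := Rlt_le_trans _ _ _ Hw (Rmin_l _ _)).
  assert (W' := Rlt_le_trans _ _ _ Hw (Rmin_r _ _)).
  assert (W2 := Rlt_le_trans _ _ _ W' (Rmin_l _ _)).
  assert (W3 := Rlt_le_trans _ _ _ W' (Rmin_r _ _)).
  specialize (H1 w W1); specialize (H2 w W2); specialize (H3 w W3).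
  assert (H3' := Rlt_le_trans _ _ _ H3 (Rmin_l _ _)).
  assert (H4 := Rlt_le_trans _ _ _ H3 (Rmin_r _ _)).
  set (h := (w - z)%C) in *.
  pose proof (bil_norm B HB (minus (minus (u w) (u z)) (scal h du)) (v w)) as N1.
  pose proof (bil_norm B HB (u z) (minus (minus (v w) (v z)) (scal h dv))) as N2.
  pose proof (bil_norm B HB (scal h du) (minus (v w) (v z))) as N3.
  rewrite !(bil_minus_l B HB) in N1; rewrite (bil_minus_r B HB), (bil_minus_r B HB (u z) (v w)) in N2;
  rewrite (bil_minus_r B HB) in N3.
  rewrite (bil_scal_l B HB) in N1; rewrite (bil_scal_r B HB) in N2.
  rewrite !(bil_scal_l B HB) in N3.
  assert (E : minus (minus (B (u w) (v w)) (B (u z) (v z)))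
                    (scal h (plus (B du (v z)) (B (u z) dv)))
    = plus (plus (minus (minus (B (u w) (v w)) (B (u z) (v w))) (scal h (B du (v w))))
                 (minus (minus (B (u z) (v w)) (B (u z) (v z))) (scal h (B (u z) dv))))
           (minus (scal h (B du (v w))) (scal h (B du (v z))))).
  { symmetry; etransitivity; [apply minus_telescope |].
    apply f_equal; symmetry; apply (scal_distr_l h (B du (v z)) (B (u z) dv)). }
  match goal with |- norm ?x <= _ => replace (norm x) with (norm (V := W)
    (plus (plus (minus (minus (B (u w) (v w)) (B (u z) (v w))) (scal h (B du (v w))))
                 (minus (minus (B (u z) (v w)) (B (u z) (v z))) (scal h (B (u z) dv))))
           (minus (scal h (B du (v w))) (scal h (B du (v z))))))
    by (symmetry; apply (f_equal norm); exact E) end.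
  clear E.
  eapply Rle_trans; [apply (@norm_triangle C_AbsRing W) |].
  eapply Rle_trans; [apply Rplus_le_compat_r, (@norm_triangle C_AbsRing W) |].
  rewrite norm_scal_C in N3.
  assert (Hvw : norm (v w) <= norm (v z) + 1) by (pose proof (norm_le_minus (v w) (v z)); lra).
  pose proof (Cmod_ge_0 h) as Hh.
  assert (E1 : norm (minus (minus (u w) (u z)) (scal h du)) * norm (v w)
               <= e1 * Cmod h * (norm (v z) + 1)).
  { apply Rmult_le_compat; auto using norm_ge_0. }
  assert (E2 : norm (u z) * norm (minus (minus (v w) (v z)) (scal h dv))
               <= norm (u z) * (e1 * Cmod h)).
  { apply Rmult_le_compat_l; auto. }
  assert (E3 : Cmod h * norm du * norm (minus (v w) (v z)) <= Cmod h * norm du * e1).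
  { apply Rmult_le_compat_l; [apply Rmult_le_pos; auto | lra]. }
  apply Rle_trans with (e1 * D * Cmod h).
  - eapply Rle_trans;
      [apply Rplus_le_compat; [apply Rplus_le_compat; [exact N1 | exact N2] | exact N3] |].
    unfold D; lra.
  - unfold e1; right; field; lra.
Qed.

Lemma bounded_bilinear_mult :
  bounded_bilinear (U := C_NormedModule) (V := C_NormedModule) (W := C_NormedModule) Cmult.
Proof.
  split; intros.
  - apply Cmult_plus_distr_r.
  - apply Cmult_plus_distr_l.
  - symmetry; apply Cmult_assoc.
  - change (a * (k * b) = k * (a * b))%C; ring.
  - right; apply Cmod_mult.
Qed.

Lemma bounded_bilinear_scal (V : NormedModule C_AbsRing) :
  bounded_bilinear (U := C_NormedModule) (V := V) (W := V) (fun k x => scal k x).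
Proof.
  split; intros.
  - apply (@scal_distr_r C_Ring).
  - apply (@scal_distr_l C_Ring).
  - symmetry; apply (@scal_assoc C_Ring).
  - rewrite !(@scal_assoc C_Ring); f_equal; apply Cmult_comm.
  - apply (@norm_scal C_AbsRing V a b).
Qed.

Lemma is_derive_inv_C (z : C) : z <> 0 ->
  is_derive (V := C_NormedModule) Cinv z (- (/ z * / z))%C.
Proof.
  intros Hz; apply is_derive_eps; intros e He.
  assert (Hm : 0 < Cmod z) by (apply Cmod_gt_0; exact Hz).
  set (m := Cmod z) in *.
  (* The remainder is (w - z)^2 / (w z^2). The first bound keeps |w| >= m/2, and the second then
     makes it at most e |w - z|. *)
  exists (Rmin (m / 2) (e * m ^ 3 / 2)); split.
  { apply Rmin_glb_lt; [lra |].
    apply Rdiv_lt_0_compat; [apply Rmult_lt_0_compat; [| apply pow_lt] |]; lra. }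
  intros w Hw.
  assert (Hw1 := Rlt_le_trans _ _ _ Hw (Rmin_l _ _)).
  assert (Hw2 := Rlt_le_trans _ _ _ Hw (Rmin_r _ _)).
  assert (Hmw : m / 2 <= Cmod w).
  { pose proof (Cmod_triangle w (- (w - z))) as T.
    replace (w + - (w - z))%C with z in T by ring; rewrite Cmod_opp in T; fold m in T; lra. }
  assert (Hw0 : w <> 0) by (intros ->; rewrite Cmod_0 in Hmw; lra).
  change (Cmod ((/ w - / z) - (w - z) * - (/ z * / z)) <= e * Cmod (w - z)).
  replace ((/ w - / z) - (w - z) * - (/ z * / z))%C
    with ((w - z) * (w - z) * / (w * z * z))%C by (field; auto).
  rewrite !Cmod_mult, Cmod_inv, !Cmod_mult by (repeat apply Cmult_neq_0; auto); fold m.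
  rewrite (Rmult_comm e), Rmult_assoc; apply Rmult_le_compat_l; [apply Cmod_ge_0 |].
  apply (Rmult_le_reg_r (Cmod w * m * m)); [repeat apply Rmult_lt_0_compat; lra |].
  rewrite Rmult_assoc, Rinv_l, Rmult_1_r
    by (apply Rgt_not_eq; repeat apply Rmult_lt_0_compat; lra).
  apply Rle_trans with (e * m ^ 3 / 2); [lra |].
  replace (e * m ^ 3 / 2) with (e * (m / 2 * m * m)) by field.
  apply Rmult_le_compat_l; [lra |].
  repeat apply Rmult_le_compat_r; lra.
Qed.

Lemma is_derive_comp_inv (h : C -> C) (z l : C) : h z <> 0 ->
  is_derive (V := C_NormedModule) h z l ->
  is_derive (V := C_NormedModule) (fun w => / h w)%C z (- (l * (/ h z * / h z)))%C.
Proof.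
  intros Hz Hh.
  apply is_derive_eps; intros e He.
  pose proof (Cmod_ge_0 l) as Hl.
  set (q := Cmod (/ h z * / h z)).
  assert (Hq : 0 <= q) by apply Cmod_ge_0.
  set (e1 := e / (2 * (Cmod l + 1))).
  assert (He1 : 0 < e1) by (apply Rdiv_lt_0_compat; lra).
  set (e2 := e / (2 * (q + 1))).
  assert (He2 : 0 < e2) by (apply Rdiv_lt_0_compat; lra).
  destruct (proj1 (is_derive_eps _ _ _) (is_derive_inv_C _ Hz) e1 He1) as (d1 & Hd1 & H1).
  destruct (proj1 (is_derive_eps _ _ _) Hh (Rmin e2 1)) as (d2 & Hd2 & H2).
  { apply Rmin_glb_lt; lra. }
  destruct (is_derive_continuous_eps _ _ _ Hh d1 Hd1) as (d4 & Hd4 & H4).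
  exists (Rmin d2 d4); split; [repeat apply Rmin_glb_lt; auto |].
  intros w Hw.
  assert (W2 := Rlt_le_trans _ _ _ Hw (Rmin_l _ _)).
  assert (W4 := Rlt_le_trans _ _ _ Hw (Rmin_r _ _)).
  specialize (H4 w W4); specialize (H1 _ H4); specialize (H2 w W2).
  clear Hw W2 W4.
  change (Cmod ((/ h w - / h z) - (h w - h z) * - (/ h z * / h z)) <= e1 * Cmod (h w - h z)) in H1.
  change (Cmod ((h w - h z) - (w - z) * l) <= Rmin e2 1 * Cmod (w - z)) in H2.
  change (Cmod ((/ h w - / h z) - (w - z) * - (l * (/ h z * / h z))) <= e * Cmod (w - z)).
  replace ((/ h w - / h z) - (w - z) * - (l * (/ h z * / h z)))%C with
    (((/ h w - / h z) - (h w - h z) * - (/ h z * / h z))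
     + - (((h w - h z) - (w - z) * l) * (/ h z * / h z)))%C by ring.
  eapply Rle_trans; [apply Cmod_triangle |].
  rewrite Cmod_opp, (Cmod_mult (_ - _ - _)); fold q.
  pose proof (Cmod_ge_0 (w - z)) as Hwz.
  assert (H2' : Cmod ((h w - h z) - (w - z) * l) <= e2 * Cmod (w - z)).
  { eapply Rle_trans; [exact H2 | apply Rmult_le_compat_r; [auto | apply Rmin_l]]. }
  assert (H3 : Cmod ((h w - h z) - (w - z) * l) <= 1 * Cmod (w - z)).
  { eapply Rle_trans; [exact H2 | apply Rmult_le_compat_r; [auto | apply Rmin_r]]. }
  assert (Hd : Cmod (h w - h z) <= (Cmod l + 1) * Cmod (w - z)).
  { replace (h w - h z)%C with (((h w - h z) - (w - z) * l) + (w - z) * l)%C by ring.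
    eapply Rle_trans; [apply Cmod_triangle |]; rewrite (Cmod_mult (w - z)); lra. }
  assert (A1 : e1 * Cmod (h w - h z) <= e / 2 * Cmod (w - z)).
  { eapply Rle_trans; [apply Rmult_le_compat_l; [lra | exact Hd] |].
    right; unfold e1; field; lra. }
  assert (A2 : Cmod ((h w - h z) - (w - z) * l) * q <= e / 2 * Cmod (w - z)).
  { apply Rle_trans with (e2 * Cmod (w - z) * (q + 1)).
    - apply Rmult_le_compat; try lra; apply Cmod_ge_0.
    - right; unfold e2; field; lra. }
  lra.
Qed.

(** * Cauchy's formula and Taylor series *)

Lemma is_series_eps {V : NormedModule C_AbsRing} (a : nat -> V) (l : V) :
  is_series a l <->
  forall e, 0 < e -> exists N, forall n, (N <= n)%nat -> norm (minus (sum_n a n) l) < e.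
Proof.
  pose proof (filterlim_locally_ball_norm (K := C_AbsRing) (F := eventually) (sum_n a) l) as E.
  split.
  - intros H e He; apply (proj1 E H (mkposreal e He)).
  - intros H; apply E; intros e; apply (H e (cond_pos e)).
Qed.

Lemma is_series_C_unique (a : nat -> C) (l l' : C) :
  is_series (V := C_NormedModule) a l -> is_series (V := C_NormedModule) a l' -> l = l'.
Proof. apply (filterlim_locally_unique (V := C_NormedModule)). Qed.

Lemma Rle_of_le_eps (x y : R) : (forall e, 0 < e -> x <= y + e) -> x <= y.
Proof.
  intros H; apply Rnot_lt_le; intros Hxy; specialize (H ((x - y) / 2)); lra.
Qed.

Lemma Ceq_of_le_eps (x y : C) : (forall e, 0 < e -> Cmod (x - y) <= e) -> x = y.
Proof.
  intros H; apply Ceq_minus, Cmod_eq_0.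
  apply Rle_antisym; [| apply Cmod_ge_0].
  apply Rle_of_le_eps; intros e He; specialize (H e He); lra.
Qed.

Lemma bernoulli (h : R) (n : nat) : 0 <= h <= 1 -> 1 - INR n * h <= (1 - h) ^ n.
Proof.
  intros Hh; induction n as [|n IH]; [simpl; lra |].
  rewrite S_INR, <- tech_pow_Rmult.
  pose proof (pos_INR n).
  assert ((1 - h) * (1 - INR n * h) <= (1 - h) * (1 - h) ^ n)
    by (apply Rmult_le_compat_l; lra).
  assert (0 <= INR n * (h * h)) by (apply Rmult_le_pos; nra).
  lra.
Qed.

(** Lets r tend to 1 in a Cauchy estimate. With r = 1 - h, Bernoulli bounds the loss by A n h, and h
    = e / D makes it at most e while keeping h < 1. *)
Lemma le_of_pow_scaled (A M : R) (n : nat) :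
  0 <= A -> (forall r, 0 < r < 1 -> A * r ^ n <= M) -> A <= M.
Proof.
  intros HA H; apply Rle_of_le_eps; intros e He.
  pose proof (pos_INR n) as Hn.
  set (D := A * INR n + 2 * e + 1).
  assert (HAn : 0 <= A * INR n) by (apply Rmult_le_pos; auto).
  assert (HD : 0 < D) by (unfold D; lra).
  set (h := e / D).
  assert (Hh : 0 < h) by (apply Rdiv_lt_0_compat; auto).
  assert (HhD : h * D = e) by (unfold h; field; lra).
  assert (Hh1 : h < 1).
  { apply (Rmult_lt_reg_r D); auto; rewrite HhD; unfold D; lra. }
  specialize (H (1 - h) ltac:(lra)).
  pose proof (bernoulli h n ltac:(lra)) as B.
  apply (Rmult_le_compat_l A) in B; auto.
  assert (A * INR n * h <= e).
  { rewrite <- HhD, Rmult_comm; apply Rmult_le_compat_l; unfold D; lra. }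
  lra.
Qed.

Definition cis (y : R) : C := (cos y, sin y).

Lemma Cmod_cis y : Cmod (cis y) = 1.
Proof.
  transitivity (sqrt 1); [unfold Cmod, cis; f_equal | apply sqrt_1].
  rewrite <- (sin2_cos2 y); unfold Rsqr; simpl; ring.
Qed.

Lemma Cderiv_cis y : Cderiv cis y (Ci * cis y)%C.
Proof.
  split; unfold Re, Im, cis; simpl; auto_derive; auto; ring.
Qed.

Lemma cis_2PI : cis (2 * PI) = cis 0.
Proof. unfold cis; rewrite cos_2PI, sin_2PI, cos_0, sin_0; reflexivity. Qed.

Definition circle (r : R) (y : R) : C := (RtoC r * cis y)%C.

Lemma Cmod_circle r y : 0 <= r -> Cmod (circle r y) = r.
Proof.
  intros Hr; unfold circle; rewrite Cmod_mult, Cmod_cis, Cmod_R, Rabs_pos_eq by exact Hr; ring.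
Qed.

Lemma circle_neq_0 r y : 0 < r -> circle r y <> 0.
Proof. intros Hr E; pose proof (Cmod_circle r y ltac:(lra)); rewrite E, Cmod_0 in H; lra. Qed.

Lemma Cderiv_circle_shift (w : C) r y :
  Cderiv (fun y => circle r y - w)%C y (Ci * circle r y)%C.
Proof.
  pose proof (Cderiv_scal (- w)%C (RtoC r) cis y _ (Cderiv_cis y)) as [H1 H2].
  split; [eapply is_derive_ext; [| evar_last; [exact H1 |]]
         |eapply is_derive_ext; [| evar_last; [exact H2 |]]];
  unfold circle, Re, Im; intros; simpl; ring.
Qed.

Lemma Ccont_circle r y : Ccont (circle r) y.
Proof.
  apply Ccont_ext with (fun y => circle r y - 0)%C; [intros; ring |].
  eapply Cderiv_cont, Cderiv_circle_shift.
Qed.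

Lemma ex_derive_mult_C (f g : C -> C) (z : C) :
  ex_derive (V := C_NormedModule) f z -> ex_derive (V := C_NormedModule) g z ->
  ex_derive (V := C_NormedModule) (fun z => f z * g z)%C z.
Proof.
  intros [l Hl] [k Hk]; eexists.
  exact (is_derive_bilinear Cmult f g z l k bounded_bilinear_mult Hl Hk).
Qed.

Lemma ex_derive_const_C (k z : C) : ex_derive (V := C_NormedModule) (fun _ => k) z.
Proof. apply (ex_derive_const (K := C_AbsRing) (V := C_NormedModule) k). Qed.

Lemma ex_derive_pow_C (f : C -> C) (n : nat) (z : C) :
  ex_derive (V := C_NormedModule) f z ->
  ex_derive (V := C_NormedModule) (fun z => f z ^ n)%C z.
Proof.
  intros Hf; induction n as [|n IH].
  - apply (ex_derive_const_C 1).
  - apply (ex_derive_mult_C f (fun z => f z ^ n)%C); auto.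
Qed.

Lemma ex_derive_inv_shift (w z : C) : z <> w ->
  ex_derive (V := C_NormedModule) (fun z => / (z - w))%C z.
Proof.
  intros Hz.
  assert (H : is_derive (V := C_NormedModule) (fun z => z - w)%C z (RtoC 1)).
  { apply is_derive_eps; intros e He; exists 1; split; [lra |]; intros u _.
    change (Cmod (((u - w) - (z - w)) - (u - z) * 1) <= e * Cmod (u - z)).
    replace (((u - w) - (z - w)) - (u - z) * 1)%C with (RtoC 0) by ring; rewrite Cmod_0.
    apply Rmult_le_pos; [lra | apply Cmod_ge_0]. }
  eexists; apply (is_derive_comp_inv (fun z => z - w)%C); [| exact H].
  intros E; apply Hz, Ceq_minus, E.
Qed.

Lemma ex_derive_inv_C (z : C) : z <> 0 -> ex_derive (V := C_NormedModule) Cinv z.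
Proof. intros Hz; eexists; apply is_derive_inv_C, Hz. Qed.

Lemma PI2_gt_0 : 0 < 2 * PI.
Proof. pose proof PI_RGT_0; lra. Qed.

(** This is the integral of f(z) z^(-n-1) dz over |z| = r divided by 2 pi i: on the circle dz = i z
    dy cancels i and one power of z. *)
Definition taylor (f : C -> C) (r : R) (n : nat) : C :=
  (/ RtoC (2 * PI) * CInt (fun y => f (circle r y) * (/ circle r y) ^ n) 0 (2 * PI))%C.

Lemma Ccont_taylor (f : C -> C) (r : R) (n : nat) y :
  analytic (V := C_NormedModule) f -> 0 < r < 1 ->
  Ccont (fun y => f (circle r y) * (/ circle r y) ^ n)%C y.
Proof.
  intros Hf Hr.
  apply (Ccont_comp (fun z => f z * (/ z) ^ n)%C (circle r)); [apply Ccont_circle |].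
  apply (ex_derive_mult_C f (fun z => (/ z) ^ n)%C).
  - apply Hf; unfold disk; rewrite Cmod_circle; lra.
  - apply (ex_derive_pow_C Cinv), ex_derive_inv_C, circle_neq_0; lra.
Qed.

Lemma Cinv_2PI : (RtoC (2 * PI) * / RtoC (2 * PI))%C = 1.
Proof.
  apply Cinv_r; intros E; apply RtoC_inj in E; pose proof PI2_gt_0; lra.
Qed.

(** Goursat for f(z) z^(-n-1) on the annulus, swept by x |-> x c(y) with x in [r1/r2, 1]. The sides
    y = 0 and y = 2 pi have the same image and cancel. *)
Lemma taylor_radius (f : C -> C) (r1 r2 : R) (n : nat) :
  analytic (V := C_NormedModule) f -> 0 < r1 <= r2 -> r2 < 1 ->
  taylor f r1 n = taylor f r2 n.
Proof.
  intros Hf Hr1 Hr2; unfold taylor; f_equal.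
  pose proof PI2_gt_0 as HPI.
  set (phi := fun z => (f z * (/ z) ^ S n)%C).
  set (c := circle r2); set (c' := fun y => (Ci * circle r2 y)%C).
  set (s0 := Rect (r1 / r2) 1 0 (2 * PI)).
  assert (Hq : 0 < r1 / r2 <= 1).
  { split; [apply Rdiv_lt_0_compat; lra |].
    apply (Rmult_le_reg_r r2); [lra |]; unfold Rdiv; rewrite Rmult_assoc, Rinv_l; lra. }
  assert (Hxc : forall x y, (RtoC x * c y)%C = circle (x * r2) y).
  { intros x y; unfold c, circle; rewrite RtoC_mult; ring. }
  assert (Hdisk : forall x, 0 < x <= 1 -> 0 < x * r2 < 1).
  { intros x Hx; split; [apply Rmult_lt_0_compat; lra |].
    apply Rle_lt_trans with (1 * r2); [apply Rmult_le_compat_r |]; lra. }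
  assert (Hg : cone_boundary phi 0 c c' s0 = 0).
  { apply (cone_goursat phi 0 c c' s0 1).
    - split; simpl; lra.
    - simpl; lra.
    - simpl; lra.
    - intros y _; pose proof (Cderiv_circle_shift 0 r2 y) as [H1 H2].
      split; [eapply is_derive_ext; [| exact H1] | eapply is_derive_ext; [| exact H2]];
        intros; unfold c, Re, Im; simpl; ring.
    - intros y _; apply Ccont_mult; [apply Ccont_const | apply Ccont_circle].
    - intros y _; unfold c, c'; rewrite Cmod_mult, Cmod_circle by lra.
      replace (Cmod Ci) with 1; [lra |].
      transitivity (sqrt 1); [symmetry; apply sqrt_1 | unfold Cmod, Ci; f_equal; simpl; ring].
    - intros x y [Hx _]; simpl in Hx.
      replace (0 + RtoC x * c y)%C with (circle (x * r2) y) by (rewrite <- Hxc; ring).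
      pose proof (Hdisk x ltac:(lra)).
      apply (ex_derive_mult_C f (fun z => (/ z) ^ S n)%C).
      + apply Hf; unfold disk; rewrite Cmod_circle; lra.
      + apply (ex_derive_pow_C Cinv), ex_derive_inv_C, circle_neq_0; lra. }
  assert (Hhor : forall x, 0 < x <= 1 ->
     CInt (fun y => phi (0 + RtoC x * c y) * (RtoC x * c' y))%C 0 (2 * PI)
     = (Ci * CInt (fun y => f (circle (x * r2) y) * (/ circle (x * r2) y) ^ n) 0 (2 * PI))%C).
  { intros x Hx; pose proof (Hdisk x Hx).
    rewrite <- CInt_scal; [| lra | intros; apply Ccont_taylor; auto].
    apply CInt_ext; [lra |]; intros y _.
    replace (RtoC x * c' y)%C with (Ci * circle (x * r2) y)%C
      by (rewrite <- Hxc; unfold c, c'; ring).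
    replace (0 + RtoC x * c y)%C with (circle (x * r2) y) by (rewrite <- Hxc; ring).
    unfold phi; rewrite Cpow_S; field; apply circle_neq_0; lra. }
  unfold cone_boundary in Hg; simpl x_max in Hg; simpl x_min in Hg; simpl y_min in Hg;
    simpl y_max in Hg.
  rewrite !Hhor in Hg by lra.
  replace (c (2 * PI)) with (c 0) in Hg by (unfold c, circle; rewrite cis_2PI; reflexivity).
  replace (r1 / r2 * r2) with r1 in Hg by (field; lra).
  rewrite Rmult_1_l in Hg.
  match type of Hg with (_ * ?A - _ * ?B - ?D + ?D)%C = _ =>
    assert (E : (Ci * (A - B))%C = 0) by (rewrite <- Hg; ring);
    change (B = A); symmetry; apply Ceq_minus
  end.
  match goal with |- ?X = _ => replace X with (/ Ci * (Ci * X))%C by (field; apply Ci_nz) end.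
  rewrite E; ring.
Qed.

(** The Cauchy integral of f(z) / (z - w), again with dz = i z dy carried out. *)
Definition cauchy (f : C -> C) (r : R) (w : C) : C :=
  (/ RtoC (2 * PI) * CInt (fun y => f (circle r y) * (circle r y * / (circle r y - w))) 0 (2 * PI))%C.

Lemma circle_shift_neq_0 (r y : R) (w : C) : Cmod w < r ->
  (circle r y - w)%C <> 0 /\ r - Cmod w <= Cmod (circle r y - w).
Proof.
  intros Hw; pose proof (Cmod_ge_0 w).
  assert (H1 : r - Cmod w <= Cmod (circle r y - w)).
  { pose proof (Cmod_triangle (circle r y - w) w) as T.
    replace (circle r y - w + w)%C with (circle r y) in T by ring.
    rewrite Cmod_circle in T; lra. }
  split; auto; intros E; rewrite E, Cmod_0 in H1; lra.
Qed.

Lemma Ccont_kernel (r : R) (w : C) y : Cmod w < r ->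
  Ccont (fun y => circle r y * / (circle r y - w))%C y.
Proof.
  intros Hw; apply Ccont_mult; [apply Ccont_circle |].
  apply (Ccont_comp (fun z => / (z - w))%C (circle r)); [apply Ccont_circle |].
  apply ex_derive_inv_shift; intros E.
  apply (proj1 (circle_shift_neq_0 r y w Hw)); rewrite E; ring.
Qed.

Lemma Ccont_analytic_circle (f : C -> C) (r : R) y :
  analytic (V := C_NormedModule) f -> 0 < r < 1 -> Ccont (fun y => f (circle r y)) y.
Proof.
  intros Hf Hr; apply (Ccont_comp f (circle r)); [apply Ccont_circle |].
  apply Hf; unfold disk; rewrite Cmod_circle; lra.
Qed.

Lemma Ccont_pow (f : R -> C) n y : Ccont f y -> Ccont (fun y => f y ^ n)%C y.
Proof.
  intros Hf; induction n as [|n IH]; [apply (Ccont_const 1) |].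
  apply (Ccont_mult f (fun y => f y ^ n)%C); auto.
Qed.

Lemma Ccont_inv_circle r y : 0 < r -> Ccont (fun y => / circle r y)%C y.
Proof.
  intros Hr; apply (Ccont_comp Cinv (circle r)); [apply Ccont_circle |].
  apply ex_derive_inv_C, circle_neq_0, Hr.
Qed.

(** With q = w/z the kernel is 1/(1 - q), and q^n = q^n/(1 - q) - q^(n+1)/(1 - q); each Taylor term
    is thus a difference of consecutive integrals and the sum telescopes with an exact remainder. *)
Lemma cauchy_taylor_sum (f : C -> C) (r : R) (w : C) (N : nat) :
  analytic (V := C_NormedModule) f -> 0 < r < 1 -> Cmod w < r ->
  (sum_n (fun n => taylor f r n * w ^ n) N : C)%C
  = (cauchy f r w - / RtoC (2 * PI)
     * CInt (fun y => (f (circle r y) * (circle r y * / (circle r y - w)))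
                      * (w * / circle r y) ^ S N) 0 (2 * PI))%C.
Proof.
  intros Hf Hr Hw; pose proof PI2_gt_0 as HPI.
  set (k := fun y => (f (circle r y) * (circle r y * / (circle r y - w)))%C).
  assert (Hk : forall y, Ccont k y).
  { intros y; apply Ccont_mult; [apply Ccont_analytic_circle; auto | apply Ccont_kernel, Hw]. }
  assert (Hkq : forall n y, Ccont (fun y => k y * (w * / circle r y) ^ n)%C y).
  { intros n y; apply Ccont_mult; [apply Hk |].
    apply (Ccont_pow (fun y => w * / circle r y)%C), Ccont_mult;
      [apply Ccont_const | apply Ccont_inv_circle; lra]. }
  assert (Hstep : forall n, (taylor f r n * w ^ n)%C
     = (/ RtoC (2 * PI) * CInt (fun y => k y * (w * / circle r y) ^ n) 0 (2 * PI)
        - / RtoC (2 * PI) * CInt (fun y => k y * (w * / circle r y) ^ S n) 0 (2 * PI))%C).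
  { intros n; unfold taylor.
    match goal with |- (?p * ?A * ?q)%C = (?p * ?B - ?p * ?D)%C =>
      assert (E : B = (q * A + D)%C); [| rewrite E; ring] end.
    rewrite <- CInt_scal; [| lra | intros; apply Ccont_taylor; auto].
    rewrite <- CInt_plus; [| lra | intros; apply Ccont_mult;
                              [apply Ccont_const | apply Ccont_taylor; auto] | auto].
    apply CInt_ext; [lra |]; intros y _; unfold k.
    rewrite Cpow_S, Cpow_mult_l.
    field; split; [apply circle_neq_0; lra | apply circle_shift_neq_0, Hw]. }
  assert (H0 : CInt (fun y => k y * (w * / circle r y) ^ 0)%C 0 (2 * PI) = CInt k 0 (2 * PI)).
  { apply CInt_ext; [lra |]; intros y _; simpl; ring. }
  unfold cauchy; fold k; rewrite <- H0; clear H0.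
  set (J := fun n => CInt (fun y => k y * (w * / circle r y) ^ n)%C 0 (2 * PI)) in *.
  change (forall n, (taylor f r n * w ^ n)%C
     = (/ RtoC (2 * PI) * J n - / RtoC (2 * PI) * J (S n))%C) in Hstep.
  change ((sum_n (fun n => taylor f r n * w ^ n) N : C)%C
     = (/ RtoC (2 * PI) * J 0%nat - / RtoC (2 * PI) * J (S N))%C).
  clearbody J.
  induction N as [|N IH].
  - rewrite sum_O; apply Hstep.
  - rewrite sum_Sn, IH, Hstep.
    match goal with |- plus ?a ?b = _ => change (plus a b) with (a + b)%C end; ring.
Qed.

Lemma pow_small (q M e : R) : 0 <= q < 1 -> 0 < e ->
  exists N, forall n, (N <= n)%nat -> M * q ^ n < e.
Proof.
  intros Hq He.
  destruct (pow_lt_1_zero q) with (y := e / (Rabs M + 1)) as [N HN].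
  { rewrite Rabs_pos_eq; lra. }
  { apply Rdiv_lt_0_compat; auto; pose proof (Rabs_pos M); lra. }
  exists N; intros n Hn; specialize (HN n Hn).
  assert (Hp : 0 <= q ^ n) by (apply pow_le; lra).
  rewrite Rabs_pos_eq in HN by exact Hp.
  pose proof (Rabs_pos M); pose proof (Rle_abs M).
  apply (Rmult_lt_compat_l (Rabs M + 1)) in HN; [| lra].
  replace ((Rabs M + 1) * (e / (Rabs M + 1))) with e in HN by (field; lra).
  apply Rle_lt_trans with (2 := HN); apply Rmult_le_compat_r; lra.
Qed.

Lemma Cmod_Inv_2PI : Cmod (/ RtoC (2 * PI)) = / (2 * PI).
Proof.
  pose proof PI2_gt_0; rewrite Cmod_inv, Cmod_R, Rabs_pos_eq; auto; try lra.
  intros E; apply RtoC_inj in E; lra.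
Qed.

Lemma mean_le (k : R -> C) (M : R) :
  (forall y, Ccont k y) -> (forall y, Cmod (k y) <= M) ->
  Cmod (/ RtoC (2 * PI) * CInt k 0 (2 * PI)) <= M.
Proof.
  intros Hk HM; pose proof PI2_gt_0.
  rewrite Cmod_mult, Cmod_Inv_2PI.
  apply (Rmult_le_reg_l (2 * PI)); auto.
  rewrite <- Rmult_assoc, Rinv_r, Rmult_1_l by lra.
  replace (2 * PI * M) with ((2 * PI - 0) * M) by ring.
  apply CInt_le; auto; lra.
Qed.

Lemma cauchy_is_series (f : C -> C) (r M : R) (w : C) :
  analytic (V := C_NormedModule) f -> (forall z, disk z -> Cmod (f z) <= M) ->
  0 < r < 1 -> Cmod w < r ->
  is_series (V := C_NormedModule) (fun n => taylor f r n * w ^ n)%C (cauchy f r w).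
Proof.
  intros Hf HM Hr Hw; apply is_series_eps; intros e He.
  pose proof (Cmod_ge_0 w) as Hw0.
  set (q := Cmod w / r).
  assert (Hq : 0 <= q < 1).
  { split; [apply Rmult_le_pos; [auto | left; apply Rinv_0_lt_compat; lra] |].
    apply (Rmult_lt_reg_r r); [lra |]; unfold q, Rdiv; rewrite Rmult_assoc, Rinv_l; lra. }
  (* Bounds |f(z) z / (z - w)| on the circle; the remainder after index n is at most B q^(n+1). *)
  set (B := M * (r * / (r - Cmod w))).
  destruct (pow_small q B e Hq He) as [N HN].
  exists N; intros n Hn.
  match goal with |- norm ?x < _ => change (norm x) with
    (Cmod (sum_n (fun n => taylor f r n * w ^ n)%C n - cauchy f r w)) end.
  rewrite cauchy_taylor_sum by auto.
  match goal with |- Cmod (?a - ?b - ?a) < _ => replace (a - b - a)%C with (- b)%C by ring end.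
  rewrite Cmod_opp.
  apply Rle_lt_trans with (B * q ^ S n); [| apply HN; lia].
  apply mean_le.
  - intros y; apply Ccont_mult;
      [apply Ccont_mult; [apply Ccont_analytic_circle; auto | apply Ccont_kernel, Hw] |].
    apply (Ccont_pow (fun y => w * / circle r y)%C), Ccont_mult;
      [apply Ccont_const | apply Ccont_inv_circle; lra].
  - intros y; destruct (circle_shift_neq_0 r y w Hw) as [H0 H1].
    rewrite Cmod_mult, Cmod_pow, !Cmod_mult, !Cmod_inv, Cmod_circle
      by first [lra | exact H0 | apply circle_neq_0; lra].
    assert (P1 : 0 <= / Cmod (circle r y - w)) by (left; apply Rinv_0_lt_compat; lra).
    apply Rmult_le_compat_r; [apply (pow_le q); lra |].
    apply Rmult_le_compat; auto using Cmod_ge_0.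
    + apply Rmult_le_pos; lra.
    + apply HM; unfold disk; rewrite Cmod_circle; lra.
    + apply Rmult_le_compat_l; [lra |]; apply Rinv_le_contravar; lra.
Qed.

(* The n-th coefficient on the circle of radius r is r^{-n} times a constant; being
   independent of r, it vanishes for n > 0. *)
Lemma taylor_const_1 (r : R) (n : nat) : 0 < r < 1 ->
  taylor (fun _ => RtoC 1) r n = match n with O => RtoC 1 | _ => RtoC 0 end.
Proof.
  intros Hr; pose proof PI2_gt_0 as HPI.
  assert (Ha : analytic (V := C_NormedModule) (fun _ => RtoC 1)).
  { intros z _; apply ex_derive_const_C. }
  destruct n as [|n].
  - unfold taylor; rewrite (CInt_ext _ (fun _ => RtoC 1)); [| lra | intros; simpl; ring].
    rewrite CInt_const, Rminus_0_r, Cmult_1_r, Cmult_comm; apply Cinv_2PI.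
  - set (J := (/ RtoC (2 * PI) * CInt (fun y => (/ cis y) ^ S n) 0 (2 * PI))%C).
    assert (Hc : forall y, Ccont (fun y => (/ cis y) ^ S n)%C y).
    { intros y; apply (Ccont_pow (fun y => / cis y)%C).
      apply Ccont_ext with (fun y => / circle 1 y)%C.
      - intros; unfold circle; rewrite Cmult_1_l; reflexivity.
      - apply Ccont_inv_circle; lra. }
    assert (HJ : forall r, 0 < r < 1 -> taylor (fun _ => RtoC 1) r (S n) = ((/ RtoC r) ^ S n * J)%C).
    { intros s Hs; unfold J, taylor.
      replace ((/ RtoC s) ^ S n * (/ RtoC (2 * PI) * CInt (fun y => (/ cis y) ^ S n) 0 (2 * PI)))%C
        with (/ RtoC (2 * PI) * ((/ RtoC s) ^ S n * CInt (fun y => (/ cis y) ^ S n) 0 (2 * PI)))%C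
        by ring.
      rewrite <- (CInt_scal ((/ RtoC s) ^ S n)%C (fun y => (/ cis y) ^ S n)%C)
        by (auto; lra).
      apply f_equal.
      apply CInt_ext; [lra |]; intros y _.
      rewrite Cmult_1_l, <- Cpow_mult_l; f_equal; unfold circle; field.
      split; [intros E; pose proof (Cmod_cis y) as Hy; rewrite E, Cmod_0 in Hy; lra |].
      intros E; apply RtoC_inj in E; lra. }
    (* Halving the radius multiplies the coefficient by 2^(n+1); independence of the radius leaves
       (2^(n+1) - 1) T J = 0. *)
    pose proof (taylor_radius _ (r / 2) r (S n) Ha ltac:(lra) ltac:(lra)) as E.
    rewrite !HJ in E by lra.
    rewrite HJ by lra.
    replace (/ RtoC (r / 2))%C with (2 * / RtoC r)%C in E.
    2:{ rewrite <- !RtoC_inv, <- RtoC_mult by lra; f_equal; field; lra. }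
    rewrite Cpow_mult_l in E; set (T := ((/ RtoC r) ^ S n)%C) in *.
    assert (H2 : ((RtoC (2 ^ S n) - 1) * (T * J))%C = 0).
    { rewrite RtoC_pow.
      replace ((RtoC 2 ^ S n - 1) * (T * J))%C with (RtoC 2 ^ S n * T * J - T * J)%C by ring.
      rewrite E; ring. }
    apply NNPP; intros H3; apply (fun H => Cmult_neq_0 _ _ H H3) in H2; auto.
    rewrite <- RtoC_minus; intros H4; apply RtoC_inj in H4.
    assert (1 < 2 ^ S n) by (apply Rlt_pow_R1; [lra | lia]); lra.
Qed.

(** The value of the integral is read off its Taylor expansion, all of whose coefficients are known
    by [taylor_const_1]. *)
Lemma cauchy_const_1 (r : R) (w : C) : 0 < r < 1 -> Cmod w < r ->
  cauchy (fun _ => RtoC 1) r w = 1.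
Proof.
  intros Hr Hw.
  assert (Ha : analytic (V := C_NormedModule) (fun _ => RtoC 1)).
  { intros z _; apply ex_derive_const_C. }
  apply (is_series_C_unique (fun n => taylor (fun _ => RtoC 1) r n * w ^ n)%C).
  - apply cauchy_is_series with (M := 1); auto.
    intros; rewrite Cmod_1; lra.
  - apply is_series_eps; intros e He; exists 0%nat; intros n _.
    match goal with |- norm (minus ?x _) < _ => replace x with (RtoC 1) end.
    + match goal with |- norm ?x < _ => change (norm x) with (Cmod (1 - 1)%C) end.
      replace (1 - 1)%C with (RtoC 0) by ring; rewrite Cmod_0; exact He.
    + induction n as [|n IH].
      * rewrite sum_O, taylor_const_1 by auto; simpl; ring.
      * rewrite sum_Sn, <- IH, taylor_const_1 by auto.
        match goal with |- _ = plus ?a ?b => change (plus a b) with (a + b)%C end; ring.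
Qed.

(* Shrinking the circle to w along w + t (circle - w) shows that [cauchy f r w] is
   [f w] times the same integral for f = 1. *)
Lemma cauchy_formula (f : C -> C) (r : R) (w : C) :
  analytic (V := C_NormedModule) f -> 0 < r < 1 -> Cmod w < r ->
  cauchy f r w = f w.
Proof.
  intros Hf Hr Hw; pose proof PI2_gt_0 as HPI; pose proof (Cmod_ge_0 w) as Hw0.
  set (phi := fun z => (f z * / (z - w))%C).
  set (c := fun y => (circle r y - w)%C); set (c' := fun y => (Ci * circle r y)%C).
  assert (Hc0 : forall y, c y <> 0) by (intros y; apply circle_shift_neq_0, Hw).
  assert (Hcirc : forall y, Cmod (circle r y) = r) by (intros; apply Cmod_circle; lra).
  assert (Hin : forall x y, 0 <= x <= 1 -> disk (w + RtoC x * c y)%C).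
  { intros x y Hx; unfold disk, c.
    replace (w + RtoC x * (circle r y - w))%C
      with (RtoC (1 - x) * w + RtoC x * circle r y)%C by (rewrite RtoC_minus; ring).
    eapply Rle_lt_trans; [apply Cmod_triangle |].
    rewrite !Cmod_mult, !Cmod_R, Hcirc, !Rabs_pos_eq by lra; nra. }
  assert (Hker : forall y, Ccont (fun y => circle r y * / c y)%C y).
  { intros y; apply Ccont_kernel, Hw. }
  set (G := fun x => (/ RtoC (2 * PI) * CInt (fun y => f (w + RtoC x * c y) * (circle r y * / c y))
                       0 (2 * PI))%C).
  assert (Hfc : forall x y, 0 <= x <= 1 -> Ccont (fun y => f (w + RtoC x * c y)%C) y).
  { intros x y Hx; apply (Ccont_comp f (fun y => w + RtoC x * c y)%C); [| apply Hf, Hin, Hx].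
    eapply Cderiv_cont, Cderiv_scal, Cderiv_circle_shift. }
  (* The rectangle stops at x = t > 0 because [phi] has a pole at the apex w. *)
  assert (HG : forall t, 0 < t <= 1 -> G t = G 1).
  { intros t Ht.
    set (s0 := Rect t 1 0 (2 * PI)).
    assert (Hg : cone_boundary phi w c c' s0 = 0).
    { apply (cone_goursat phi w c c' s0 2); simpl; try lra.
      - split; simpl; lra.
      - intros y _; apply Cderiv_circle_shift.
      - intros y _; apply Ccont_mult; [apply Ccont_const | apply Ccont_circle].
      - intros y _; unfold c, c'; split.
        + replace (circle r y - w)%C with (circle r y + - w)%C by ring.
          eapply Rle_trans; [apply Cmod_triangle |].
          rewrite Cmod_opp, Hcirc; lra.
        + rewrite Cmod_mult, Hcirc.
          replace (Cmod Ci) with 1; [lra |].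
          transitivity (sqrt 1); [symmetry; apply sqrt_1 | unfold Cmod, Ci; f_equal; simpl; ring].
      - intros x y [Hx _]; simpl in Hx.
        apply (ex_derive_mult_C f (fun z => / (z - w))%C).
        + apply Hf, Hin; lra.
        + apply ex_derive_inv_shift; intros E.
          assert (E' : (RtoC x * c y)%C = 0).
          { replace (RtoC x * c y)%C with ((w + RtoC x * c y) - w)%C by ring; rewrite E; ring. }
          revert E'; apply Cmult_neq_0; [intros E'; apply RtoC_inj in E'; lra | apply Hc0]. }
    assert (Hhor : forall x, 0 < x <= 1 ->
       CInt (fun y => phi (w + RtoC x * c y) * (RtoC x * c' y))%C 0 (2 * PI)
       = (Ci * CInt (fun y => f (w + RtoC x * c y) * (circle r y * / c y)) 0 (2 * PI))%C).
    { intros x Hx.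
      rewrite <- CInt_scal; [| lra | intros; apply Ccont_mult; [apply Hfc; lra | apply Hker]].
      apply CInt_ext; [lra |]; intros y _; unfold phi, c'.
      replace (w + RtoC x * c y - w)%C with (RtoC x * c y)%C by ring.
      field; split; [apply Hc0 |]; intros E; apply RtoC_inj in E; lra. }
    unfold cone_boundary in Hg; simpl x_max in Hg; simpl x_min in Hg; simpl y_min in Hg;
      simpl y_max in Hg.
    rewrite !Hhor in Hg by lra.
    replace (c (2 * PI)) with (c 0) in Hg by (unfold c, circle; rewrite cis_2PI; reflexivity).
    unfold G; f_equal.
    match type of Hg with (_ * ?A - _ * ?B - ?D + ?D)%C = _ =>
      assert (E : (Ci * (A - B))%C = 0) by (rewrite <- Hg; ring);
      change (B = A); symmetry; apply Ceq_minus
    end.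
    match goal with |- ?X = _ => replace X with (/ Ci * (Ci * X))%C by (field; apply Ci_nz) end.
    rewrite E; ring. }
  assert (HG1 : G 1 = cauchy f r w).
  { unfold G, cauchy; f_equal; apply CInt_ext; [lra |]; intros y _; unfold c.
    replace (w + 1 * (circle r y - w))%C with (circle r y) by ring; reflexivity. }
  rewrite <- HG1.
  assert (H1 : f w = (/ RtoC (2 * PI) * CInt (fun y => f w * (circle r y * / c y)) 0 (2 * PI))%C).
  { rewrite CInt_scal by (auto; lra).
    transitivity (f w * cauchy (fun _ => RtoC 1) r w)%C.
    - rewrite cauchy_const_1 by auto; ring.
    - unfold cauchy.
      rewrite (CInt_ext (fun y => 1 * (circle r y * / (circle r y - w)))%C
                 (fun y => circle r y * / c y)%C); [| lra | intros; unfold c; ring].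
      ring. }
  apply Ceq_of_le_eps; intros e He.
  destruct (Hf w) as [l Hl]; [unfold disk; lra |].
  set (q := r - Cmod w).
  (* On the circle |z / (z - w)| <= 1/q, so a variation e q of f near w changes the mean by at most
     e. Below, t <= d/4 suffices because |c| <= 2. *)
  destruct (is_derive_continuous_eps f w l Hl (e * q)) as (d & Hd & Hcont).
  { apply Rmult_lt_0_compat; unfold q; lra. }
  set (t := Rmin 1 (d / 4)).
  assert (Ht : 0 < t <= 1) by (unfold t; split; [apply Rmin_glb_lt; lra | apply Rmin_l]).
  assert (Ht2 : t <= d / 4) by apply Rmin_r.
  rewrite <- (HG t Ht), H1.
  match goal with |- Cmod ?x <= _ => replace x with
    (/ RtoC (2 * PI) * CInt (fun y => (f (w + RtoC t * c y) + (-1) * f w) * (circle r y * / c y))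
        0 (2 * PI))%C end.
  - apply mean_le.
    + intros y; apply Ccont_mult; [| apply Hker].
      apply Ccont_plus; [apply Hfc; lra | apply Ccont_const].
    + intros y; rewrite !Cmod_mult, Hcirc, Cmod_inv by apply Hc0.
      assert (Hcy : q <= Cmod (c y)) by apply circle_shift_neq_0, Hw.
      assert (Hq : 0 < q) by (unfold q; lra).
      assert (Hcy2 : Cmod (c y) <= 2).
      { unfold c; replace (circle r y - w)%C with (circle r y + - w)%C by ring.
        eapply Rle_trans; [apply Cmod_triangle |]; rewrite Cmod_opp, Hcirc; lra. }
      assert (Hlt : Cmod (w + RtoC t * c y - w) < d).
      { replace (w + RtoC t * c y - w)%C with (RtoC t * c y)%C by ring.
        rewrite Cmod_mult, Cmod_R, Rabs_pos_eq by lra.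
        apply Rle_lt_trans with (d / 4 * 2); [| lra].
        apply Rmult_le_compat; lra. }
      specialize (Hcont _ Hlt).
      change (Cmod (f (w + RtoC t * c y) - f w)%C < e * q) in Hcont.
      replace (f (w + RtoC t * c y) + -1 * f w)%C with (f (w + RtoC t * c y) - f w)%C by ring.
      apply Rle_trans with (e * q * (1 * / q)).
      * apply Rmult_le_compat; try lra; [apply Cmod_ge_0 | |].
        -- apply Rmult_le_pos; [lra | left; apply Rinv_0_lt_compat; lra].
        -- apply Rmult_le_compat; try lra; [left; apply Rinv_0_lt_compat; lra |].
           apply Rinv_le_contravar; lra.
      * right; field; lra.
  - unfold G.
    rewrite (CInt_ext _ (fun y => f (w + RtoC t * c y) * (circle r y * / c y)
                                  + (-1) * (f w * (circle r y * / c y)))%C);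
      [| lra | intros; ring].
    rewrite CInt_plus; [| lra | intros; apply Ccont_mult; [apply Hfc; lra | apply Hker]
                        | intros; apply Ccont_mult; [apply Ccont_const |];
                          apply Ccont_mult; [apply Ccont_const | apply Hker]].
    rewrite (CInt_scal (-1)); [ring | lra |].
    intros; apply Ccont_mult; [apply Ccont_const | apply Hker].
Qed.

(** On the circle of radius s the estimate is M / s^n; the coefficient does not depend on s, so s
    may tend to 1. The result is uniform in n, as the l^2 bound on coefficients will require. *)
Lemma taylor_le (f : C -> C) (r M : R) (n : nat) :
  analytic (V := C_NormedModule) f -> (forall z, disk z -> Cmod (f z) <= M) ->
  0 < r < 1 -> Cmod (taylor f r n) <= M.
Proof.
  intros Hf HM Hr.
  apply (le_of_pow_scaled _ M n); [apply Cmod_ge_0 |]; intros s Hs.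
  replace (taylor f r n) with (taylor f s n).
  - assert (Hsn : 0 < s ^ n) by (apply pow_lt; lra).
    apply (Rmult_le_reg_r (/ s ^ n)); [apply Rinv_0_lt_compat, Hsn |].
    rewrite Rmult_assoc, Rinv_r, Rmult_1_r by lra.
    apply mean_le; [intros; apply Ccont_taylor; auto |].
    intros y; rewrite Cmod_mult, Cmod_pow, Cmod_inv, Cmod_circle, pow_inv
      by first [lra | apply circle_neq_0; lra].
    apply Rmult_le_compat_r; [left; apply Rinv_0_lt_compat, Hsn |].
    apply HM; unfold disk; rewrite Cmod_circle; lra.
  - destruct (Rle_dec s r); [| symmetry]; apply taylor_radius; auto; lra.
Qed.

(** The radius 1/2 is a fixed reference for the coefficients; the expansion at w is obtained on a
    circle enclosing w and transported by [taylor_radius]. *)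
Lemma taylor_is_series (f : C -> C) (M : R) (w : C) :
  analytic (V := C_NormedModule) f -> (forall z, disk z -> Cmod (f z) <= M) -> disk w ->
  is_series (V := C_NormedModule) (fun n => taylor f (/ 2) n * w ^ n)%C (f w).
Proof.
  intros Hf HM Hw; unfold disk in Hw; pose proof (Cmod_ge_0 w).
  set (r := (Cmod w + 1) / 2); assert (Hr : 0 < r < 1) by (unfold r; lra).
  assert (Hwr : Cmod w < r) by (unfold r; lra).
  rewrite <- (cauchy_formula f r w) by auto.
  apply (is_series_ext (fun n => taylor f r n * w ^ n)%C).
  - intros n; apply (f_equal (fun a => a * w ^ n)%C).
    destruct (Rle_dec r (/ 2)); [| symmetry]; apply taylor_radius; auto; lra.
  - apply (cauchy_is_series f r M); auto.
Qed.

Lemma taylor_sum (f : nat -> C -> C) (k : nat -> C) (r : R) (n K : nat) :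
  (forall j, analytic (V := C_NormedModule) (f j)) -> 0 < r < 1 ->
  taylor (fun z => sum_n (fun j => k j * f j z)%C K) r n
  = sum_n (fun j => k j * taylor (f j) r n)%C K.
Proof.
  intros Hf Hr; pose proof PI2_gt_0.
  assert (Hc : forall j y, Ccont (fun y => f j (circle r y) * (/ circle r y) ^ n)%C y).
  { intros; apply Ccont_taylor; auto. }
  assert (Hterm : forall j, taylor (fun z => k j * f j z)%C r n = (k j * taylor (f j) r n)%C).
  { intros j; unfold taylor.
    rewrite (CInt_ext _ (fun y => k j * (f j (circle r y) * (/ circle r y) ^ n))%C)
      by (try lra; intros; ring).
    rewrite CInt_scal by (auto; lra); ring. }
  (* Continuity of the partial sums is carried along in the induction since splitting the integral
     uses it. *)
  assert (Hsum : forall K, (forall y, Ccont (fun y =>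
             (sum_n (fun j => k j * f j (circle r y))%C K : C) * (/ circle r y) ^ n)%C y)
     /\ taylor (fun z => sum_n (fun j => k j * f j z)%C K) r n
        = sum_n (fun j => k j * taylor (f j) r n)%C K); [| apply Hsum].
  clear K; induction K as [|K [IH1 IH2]].
  - split.
    + intros y; apply Ccont_ext with
        (fun y => k 0%nat * (f 0%nat (circle r y) * (/ circle r y) ^ n))%C.
      * intros s; rewrite sum_O; ring.
      * apply Ccont_mult; [apply Ccont_const | apply Hc].
    + rewrite sum_O, <- Hterm; unfold taylor; f_equal; apply CInt_ext; [lra |].
      intros; rewrite sum_O; reflexivity.
  - assert (E : forall y, ((sum_n (fun j => k j * f j (circle r y))%C (S K) : C) * (/ circle r y) ^ n)%C
       = ((sum_n (fun j => k j * f j (circle r y))%C K : C) * (/ circle r y) ^ n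
          + k (S K) * (f (S K) (circle r y) * (/ circle r y) ^ n))%C).
    { intros y; rewrite sum_Sn.
      match goal with |- context [plus ?a ?b] => change (plus a b) with (a + b)%C end; ring. }
    split.
    + intros y; apply Ccont_ext with (1 := fun s => eq_sym (E s)).
      apply Ccont_plus; [apply IH1 | apply Ccont_mult; [apply Ccont_const | apply Hc]].
    + rewrite sum_Sn, <- IH2, <- Hterm; unfold taylor.
      rewrite (CInt_ext _ _ 0 (2 * PI) ltac:(lra) (fun y _ => E y)).
      rewrite CInt_plus; [| lra | auto | intros; apply Ccont_mult; [apply Ccont_const | apply Hc]].
      rewrite (CInt_ext (fun y => k (S K) * f (S K) (circle r y) * (/ circle r y) ^ n)%C
                 (fun y => k (S K) * (f (S K) (circle r y) * (/ circle r y) ^ n))%C)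
        by (try lra; intros; ring).
      match goal with |- _ = plus ?a ?b => change (plus a b) with (a + b)%C end; ring.
Qed.

(** * Power series with coefficients in l^2 *)

Local Ltac ccplx_ring :=
  match goal with |- ?a = ?b => change (@eq C a b) end;
  unfold minus, plus, opp, scal, mult; simpl; unfold mult; simpl; ring.

Lemma sum_n_R_S (f : nat -> R) N : sum_n f (S N) = sum_n f N + f (S N).
Proof. exact (sum_Sn (G := R_AbelianMonoid) f N). Qed.

Lemma sum_n_C_S (f : nat -> C) N : (sum_n f (S N) : C) = ((sum_n f N : C) + f (S N))%C.
Proof. exact (sum_Sn (G := C_AbelianMonoid) f N). Qed.

Lemma sum_n_R_ge_0 (f : nat -> R) N : (forall n, 0 <= f n) -> 0 <= sum_n f N.
Proof.
  intros H; induction N as [|N IH]; [rewrite sum_O; auto |].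
  rewrite sum_n_R_S; specialize (H (S N)); lra.
Qed.

Lemma sum_n_le_Series (f : nat -> R) N :
  (forall n, 0 <= f n) -> ex_series f -> sum_n f N <= Series f.
Proof.
  intros H Hf; apply (is_lim_seq_incr_compare (sum_n f)); [exact (Series_correct f Hf) |].
  intros n; rewrite sum_n_R_S; specialize (H (S n)); lra.
Qed.

Lemma ex_series_bounded (f : nat -> R) (B : R) :
  (forall n, 0 <= f n) -> (forall N, sum_n f N <= B) -> ex_series f /\ Series f <= B.
Proof.
  intros H HB.
  destruct (ex_finite_lim_seq_incr (sum_n f) B) as [l Hl]; auto.
  { intros n; rewrite sum_n_R_S; specialize (H (S n)); lra. }
  split; [exists l; exact Hl |].
  rewrite (is_series_unique f l Hl).
  apply (is_lim_seq_le (sum_n f) (fun _ => B) l B); auto using is_lim_seq_const.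
Qed.

(** Inductive step: s^2 <= X Y and the arithmetic-geometric mean inequality give 2 s p q <= X q^2 +
    Y p^2. *)
Lemma cauchy_schwarz_R (x y : nat -> R) N :
  sum_n (fun n => x n * y n) N ^ 2 <= sum_n (fun n => x n ^ 2) N * sum_n (fun n => y n ^ 2) N.
Proof.
  induction N as [|N IH].
  - rewrite !sum_O; right; ring.
  - rewrite !sum_n_R_S.
    pose proof (sum_n_R_ge_0 (fun n => x n ^ 2) N (fun n => pow2_ge_0 _)) as HX.
    pose proof (sum_n_R_ge_0 (fun n => y n ^ 2) N (fun n => pow2_ge_0 _)) as HY.
    set (s := sum_n (fun n => x n * y n) N) in *.
    set (X := sum_n (fun n => x n ^ 2) N) in *; set (Y := sum_n (fun n => y n ^ 2) N) in *.
    set (p := x (S N)); set (q := y (S N)).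
    assert (Hpq : 2 * (s * (p * q)) <= X * q ^ 2 + Y * p ^ 2).
    { assert (0 <= X * q ^ 2 + Y * p ^ 2).
      { pose proof (pow2_ge_0 p); pose proof (pow2_ge_0 q); nra. }
      destruct (Rle_dec (2 * (s * (p * q))) 0); [lra |].
      apply Rsqr_incr_0_var; [| assumption]; unfold Rsqr.
      apply Rle_trans with (4 * (X * Y) * (p * q) ^ 2).
      - replace (2 * (s * (p * q)) * (2 * (s * (p * q)))) with (4 * s ^ 2 * (p * q) ^ 2) by ring.
        apply Rmult_le_compat_r; [apply pow2_ge_0 | lra].
      - pose proof (pow2_ge_0 (X * q ^ 2 - Y * p ^ 2)); lra. }
    lra.
Qed.

Lemma Cmod_sum_n_le (a : nat -> C) (b : nat -> R) N :
  (forall n, Cmod (a n) <= b n) -> Cmod (sum_n a N) <= sum_n b N.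
Proof.
  intros H; induction N as [|N IH]; [rewrite !sum_O; auto |].
  rewrite sum_n_C_S, sum_n_R_S; eapply Rle_trans; [apply Cmod_triangle |].
  apply Rplus_le_compat; auto.
Qed.

Lemma cauchy_schwarz_C (x y : nat -> C) N :
  Cmod (sum_n (fun n => x n * y n)%C N) ^ 2
  <= sum_n (fun n => Cmod (x n) ^ 2) N * sum_n (fun n => Cmod (y n) ^ 2) N.
Proof.
  eapply Rle_trans; [| apply cauchy_schwarz_R].
  apply pow_incr; split; [apply Cmod_ge_0 |].
  apply Cmod_sum_n_le; intros n; rewrite Cmod_mult; lra.
Qed.

Lemma ell2_partial_le (u : ell2) N : sum_n (fun k => Cmod (u k) ^ 2) N <= ell2_norm u ^ 2.
Proof.
  rewrite ell2_norm_sq; apply sum_n_le_Series; [intros; apply pow2_ge_0 | apply coef_summable].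
Qed.

Lemma ell2_of_bounded (a : nat -> C) (B : R) :
  0 <= B -> (forall N, sum_n (fun k => Cmod (a k) ^ 2) N <= B ^ 2) ->
  exists u : ell2, (forall k, u k = a k) /\ ell2_norm u <= B.
Proof.
  intros HB H.
  destruct (ex_series_bounded (fun k => Cmod (a k) ^ 2) (B ^ 2)) as [Hs HS]; auto.
  { intros; apply pow2_ge_0. }
  exists (Ell2 a Hs); split; [reflexivity |].
  rewrite <- (sqrt_pow2 B) by exact HB; apply sqrt_le_1_alt, HS.
Qed.

Definition Clim (u : nat -> C) (l : C) : Prop :=
  forall e, 0 < e -> exists N, forall n, (N <= n)%nat -> Cmod (u n - l) < e.

Lemma Clim_Cmod (u : nat -> C) (l : C) : Clim u l -> is_lim_seq (fun n => Cmod (u n)) (Cmod l).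
Proof.
  intros H; apply is_lim_seq_spec; intros e.
  destruct (H e (cond_pos e)) as [N HN]; exists N; intros n Hn; specialize (HN n Hn).
  apply Rle_lt_trans with (2 := HN).
  pose proof (Cmod_triangle (u n - l) l) as T1.
  pose proof (Cmod_triangle (- (u n - l)) (u n)) as T2.
  rewrite Cmod_opp in T2.
  replace (u n - l + l)%C with (u n) in T1 by ring.
  replace (- (u n - l) + u n)%C with l in T2 by ring.
  apply Rabs_le; lra.
Qed.

Lemma is_lim_seq_sum_n (f : nat -> nat -> R) (l : nat -> R) K :
  (forall k, is_lim_seq (fun n => f n k) (l k)) ->
  is_lim_seq (fun n => sum_n (f n) K) (sum_n l K).
Proof.
  intros H; induction K as [|K IH].
  - apply is_lim_seq_ext with (fun n => f n 0%nat); [intros; rewrite sum_O; reflexivity |].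
    rewrite sum_O; apply H.
  - apply is_lim_seq_ext with (fun n => sum_n (f n) K + f n (S K)).
    + intros; rewrite sum_n_R_S; reflexivity.
    + rewrite sum_n_R_S; apply is_lim_seq_plus'; auto.
Qed.

(** Fatou's lemma for counting measure: every finite sum of squares passes to the limit. The bound
    is asked only eventually and up to e, because B will be a limit of sup norms. *)
Lemma ell2_fatou (v : nat -> ell2) (a : nat -> C) (B : R) :
  0 <= B ->
  (forall e, 0 < e -> exists N, forall n, (N <= n)%nat -> ell2_norm (v n) <= B + e) ->
  (forall k, Clim (fun n => v n k) (a k)) ->
  exists u : ell2, (forall k, u k = a k) /\ ell2_norm u <= B.
Proof.
  intros HB Hv Ha; apply ell2_of_bounded; auto; intros K.
  assert (Hlim : is_lim_seq (fun n => sum_n (fun k => Cmod (v n k) ^ 2) K)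
                            (sum_n (fun k => Cmod (a k) ^ 2) K)).
  { apply (is_lim_seq_sum_n (fun n k => Cmod (v n k) ^ 2) (fun k => Cmod (a k) ^ 2)).
    intros k; apply is_lim_seq_ext with (fun n => Cmod (v n k) * Cmod (v n k)).
    - intros; ring.
    - replace (Cmod (a k) ^ 2) with (Cmod (a k) * Cmod (a k)) by ring.
      apply is_lim_seq_mult'; apply Clim_Cmod, Ha. }
  apply Rle_of_le_eps; intros e He.
  (* For d <= 1, (B + d)^2 <= B^2 + (2 B + 1) d. *)
  set (d := Rmin 1 (e / (2 * B + 1))).
  assert (Hd : 0 < d) by (apply Rmin_glb_lt; [| apply Rdiv_lt_0_compat]; lra).
  assert (Hd1 : d <= 1) by apply Rmin_l.
  assert (Hd2 : d <= e / (2 * B + 1)) by apply Rmin_r.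
  apply Rle_trans with ((B + d) ^ 2).
  - apply (is_lim_seq_le_loc (fun n => sum_n (fun k => Cmod (v n k) ^ 2) K) (fun _ => (B + d) ^ 2)
             (sum_n (fun k => Cmod (a k) ^ 2) K) ((B + d) ^ 2)); auto using is_lim_seq_const.
    destruct (Hv d Hd) as [N HN]; exists N; intros n Hn.
    eapply Rle_trans; [apply ell2_partial_le |].
    apply pow_incr; split; [apply ell2_norm_ge_0 | apply HN, Hn].
  - apply (Rmult_le_compat_r (2 * B + 1)) in Hd2; [| lra].
    replace (e / (2 * B + 1) * (2 * B + 1)) with e in Hd2 by (field; lra).
    nra.
Qed.

Lemma is_series_Clim (a : nat -> C) (l : C) :
  is_series (V := C_NormedModule) a l <-> Clim (fun n => sum_n a n) l.
Proof. apply (is_series_eps (V := C_NormedModule) a l). Qed.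

Lemma ell2_sum_coef (B : nat -> ell2) N k :
  coef (sum_n B N) k = sum_n (fun n => B n k) N.
Proof.
  induction N as [|N IH]; [rewrite !sum_O; reflexivity |].
  rewrite sum_n_C_S, <- IH, sum_Sn; reflexivity.
Qed.

(** The coordinatewise sums already identify the limit; the partial sums are bounded by the triangle
    inequality, and [ell2_fatou] turns this into membership and a norm bound. *)
Lemma ell2_series_norm (B : nat -> ell2) (b : nat -> R) (a : nat -> C) :
  (forall n, ell2_norm (B n) <= b n) -> ex_series b ->
  (forall k, is_series (V := C_NormedModule) (fun n => B n k) (a k)) ->
  exists u : ell2, (forall k, u k = a k) /\ ell2_norm u <= Series b.
Proof.
  intros Hb Hs Ha.
  assert (Hb0 : forall n, 0 <= b n).
  { intros n; eapply Rle_trans; [apply ell2_norm_ge_0 | apply Hb]. }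
  assert (HN : forall N, ell2_norm (sum_n B N) <= sum_n b N).
  { induction N as [|N IH]; [rewrite !sum_O; auto |].
    rewrite sum_n_R_S, sum_Sn; eapply Rle_trans; [apply ell2_norm_triangle |].
    apply Rplus_le_compat; auto. }
  apply (ell2_fatou (fun N => sum_n B N)).
  - apply Rle_trans with (sum_n b 0); [rewrite sum_O; auto | apply sum_n_le_Series; auto].
  - intros e He; exists 0%nat; intros n _.
    eapply Rle_trans; [apply HN |].
    pose proof (sum_n_le_Series b n Hb0 Hs); lra.
  - intros k e He; destruct (proj1 (is_series_Clim _ _) (Ha k) e He) as [N HN'].
    exists N; intros n Hn; rewrite ell2_sum_coef; apply HN', Hn.
Qed.

Lemma ex_series_C_of_le (a : nat -> C) (b : nat -> R) :
  (forall n, Cmod (a n) <= b n) -> ex_series b ->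
  exists l, is_series (V := C_NormedModule) a l.
Proof. intros H Hb; apply (ex_series_le (V := C_CompleteNormedModule) a b H Hb). Qed.

(** * Termwise differentiation of l^2-valued power series *)

(** Convergence is coordinatewise, which determines f on the disk and is what weak limits deliver;
    control in norm is kept apart, in [radius_ge_1]. *)
Definition pser (A : nat -> ell2) (f : C -> ell2) : Prop :=
  forall z, disk z -> forall k,
    is_series (V := C_NormedModule) (fun n => A n k * z ^ n)%C (f z k).

Definition radius_ge_1 (A : nat -> ell2) : Prop :=
  Rbar_le 1 (CV_radius (fun n => ell2_norm (A n))).

Definition coef_shift (A : nat -> ell2) (n : nat) : ell2 :=
  ell2_scal (RtoC (INR (S n))) (A (S n)).

(** Links the vector-valued formal derivative to the real series of norms, so that
    [CV_radius_derive] gives its radius of convergence. *)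
Lemma ell2_norm_coef_shift A n :
  ell2_norm (coef_shift A n) = PS_derive (fun n => ell2_norm (A n)) n.
Proof.
  unfold coef_shift, PS_derive; rewrite ell2_norm_scal, Cmod_R, Rabs_pos_eq; auto.
  apply pos_INR.
Qed.

Lemma radius_ge_1_shift A : radius_ge_1 A -> radius_ge_1 (coef_shift A).
Proof.
  unfold radius_ge_1; intros H.
  rewrite (CV_radius_ext _ _ (ell2_norm_coef_shift A)), CV_radius_derive; exact H.
Qed.

Lemma radius_ge_1_ex_series (a : nat -> R) (r : R) :
  Rbar_le 1 (CV_radius a) -> (forall n, 0 <= a n) -> 0 <= r < 1 ->
  ex_series (fun n => a n * r ^ n).
Proof.
  intros H Ha Hr.
  apply ex_series_ext with (fun n => Rabs (a n * r ^ n)).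
  { intros n; apply Rabs_pos_eq, Rmult_le_pos; auto; apply pow_le; lra. }
  apply CV_disk_inside, Rbar_lt_le_trans with (2 := H); simpl.
  rewrite Rabs_pos_eq; lra.
Qed.

Lemma radius_ge_1_of_bounded A M : (forall n, ell2_norm (A n) <= M) -> radius_ge_1 A.
Proof.
  intros H; apply (CV_radius_bounded (fun n => ell2_norm (A n))).
  exists M; intros n; rewrite pow1, Rmult_1_r, Rabs_pos_eq; auto using ell2_norm_ge_0.
Qed.

Lemma ell2_scal_pow_norm A n (z : C) r : Cmod z <= r ->
  ell2_norm (ell2_scal (z ^ n)%C (A n)) <= ell2_norm (A n) * r ^ n.
Proof.
  intros Hz; rewrite ell2_norm_scal, Cmod_pow, Rmult_comm.
  apply Rmult_le_compat_l; [apply ell2_norm_ge_0 |].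
  apply pow_incr; split; [apply Cmod_ge_0 | exact Hz].
Qed.

Lemma pser_exists A : radius_ge_1 A -> exists f, pser A f.
Proof.
  intros HA.
  assert (H : forall z, exists u : ell2, disk z ->
    forall k, is_series (V := C_NormedModule) (fun n => A n k * z ^ n)%C (u k)).
  { intros z; destruct (classic (disk z)) as [Hz | Hz]; [| exists ell2_zero; tauto].
    pose proof (Cmod_ge_0 z).
    pose proof (radius_ge_1_ex_series _ (Cmod z) HA (fun n => ell2_norm_ge_0 (A n))
                  ltac:(unfold disk in Hz; lra)) as Hs.
    assert (Hk : forall k, exists l, is_series (V := C_NormedModule) (fun n => A n k * z ^ n)%C l).
    { intros k; apply ex_series_C_of_le with (2 := Hs).
      intros n; rewrite Cmod_mult, Cmod_pow.
      apply Rmult_le_compat_r; [apply pow_le; auto | apply ell2_coef_le]. }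
    set (a := fun k => epsilon (inhabits (RtoC 0))
               (fun l => is_series (V := C_NormedModule) (fun n => A n k * z ^ n)%C l)).
    assert (Ha : forall k, is_series (V := C_NormedModule) (fun n => A n k * z ^ n)%C (a k)).
    { intros k; unfold a; apply epsilon_spec, Hk. }
    destruct (ell2_series_norm (fun n => ell2_scal (z ^ n)%C (A n)) _ a
                (fun n => ell2_scal_pow_norm A n z (Cmod z) (Rle_refl _)) Hs) as (u & Hu & _).
    { intros k; apply is_series_ext with (2 := Ha k); intros n; apply Cmult_comm. }
    exists u; intros _ k; rewrite Hu; apply Ha. }
  exists (fun z => epsilon (inhabits ell2_zero) (fun u => disk z ->
    forall k, is_series (V := C_NormedModule) (fun n => A n k * z ^ n)%C (coef u k))).
  intros z Hz; exact (epsilon_spec _ _ (H z) Hz).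
Qed.

(** The second-order Taylor remainder of the n-th power. At n = 0 the truncated predecessor is
    harmless because the factor [INR 0] vanishes. *)
Definition pow_remainder (z w : C) (n : nat) : C :=
  (w ^ n - z ^ n - (w - z) * (RtoC (INR n) * z ^ Nat.pred n))%C.

Lemma pow_remainder_S z w n :
  pow_remainder z w (S (S n))
  = (w * pow_remainder z w (S n) + (w - z) * (w - z) * (RtoC (INR (S n)) * z ^ n))%C.
Proof.
  unfold pow_remainder; simpl Nat.pred.
  rewrite !S_INR, !RtoC_plus, !Cpow_S; ring.
Qed.

(** The weight (n+1)(n+2) r^n is that of the second formal derivative, so the remainders of a power
    series add up to |w - z|^2 times a convergent series. *)
Lemma pow_remainder_le z w r n : Cmod z <= r -> Cmod w <= r ->
  Cmod (pow_remainder z w (S (S n)))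
  <= Cmod (w - z) ^ 2 * (INR (S n) * INR (S (S n)) * r ^ n).
Proof.
  intros Hz Hw; pose proof (Cmod_ge_0 z); pose proof (Cmod_ge_0 w).
  set (h := Cmod (w - z)).
  assert (Hh2 : 0 <= h ^ 2) by apply pow2_ge_0.
  induction n as [|n IH].
  - rewrite pow_remainder_S.
    replace (pow_remainder z w 1) with (RtoC 0) by (unfold pow_remainder; simpl; ring).
    rewrite Cmult_0_r, Cplus_0_l, !Cmod_mult; fold h.
    replace (Cmod (RtoC (INR 1))) with 1 by (simpl; rewrite Cmod_1; reflexivity).
    replace (Cmod (z ^ 0)%C) with 1 by (simpl; rewrite Cmod_1; reflexivity).
    simpl; nra.
  - rewrite pow_remainder_S; eapply Rle_trans; [apply Cmod_triangle |].
    rewrite !Cmod_mult, Cmod_R, Cmod_pow, (Rabs_pos_eq (INR _)) by apply pos_INR; fold h.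
    apply Rle_trans with (r * (h ^ 2 * (INR (S n) * INR (S (S n)) * r ^ n))
                          + h * h * (INR (S (S n)) * r ^ S n)).
    + apply Rplus_le_compat.
      * apply Rmult_le_compat; auto using Cmod_ge_0.
      * apply Rmult_le_compat_l; [nra |].
        apply Rmult_le_compat_l; [apply pos_INR | apply pow_incr; auto].
    + pose proof (pos_INR n) as Hn.
      assert (Hr : 0 <= r ^ S n) by (apply pow_le; lra).
      assert (E1 : INR (S n) = INR n + 1) by apply S_INR.
      assert (E2 : INR (S (S n)) = INR n + 2) by (rewrite S_INR; lra).
      assert (E3 : INR (S (S (S n))) = INR n + 3) by (rewrite S_INR; lra).
      rewrite E1, E2, E3.
      replace (r * (h ^ 2 * ((INR n + 1) * (INR n + 2) * r ^ n)) + h * h * ((INR n + 2) * r ^ S n))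
        with (h ^ 2 * r ^ S n * ((INR n + 2) * (INR n + 2))) by (simpl; ring).
      replace (h ^ 2 * ((INR n + 2) * (INR n + 3) * r ^ S n))
        with (h ^ 2 * r ^ S n * ((INR n + 2) * (INR n + 3))) by ring.
      apply Rmult_le_compat_l; [apply Rmult_le_pos; auto | nra].
Qed.

Lemma is_series_C_S (a : nat -> C) (l : C) : a 0%nat = 0 ->
  is_series (V := C_NormedModule) a l <-> is_series (V := C_NormedModule) (fun n => a (S n)) l.
Proof.
  intros H0; split; intros H.
  - apply (is_series_incr_1 (V := C_NormedModule)).
    assert (E : @plus C_AbelianMonoid l (a 0%nat) = l).
    { change ((l + a 0%nat)%C = l); rewrite H0; ring. }
    rewrite <- E in H; exact H.
  - apply (is_series_decr_1 (V := C_NormedModule)).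
    assert (E : (l + - a 0%nat)%C = l) by (rewrite H0; ring).
    rewrite <- E in H; exact H.
Qed.

Lemma pser_derive A f f' z :
  radius_ge_1 A -> pser A f -> pser (coef_shift A) f' -> disk z ->
  is_derive (V := ell2_NormedModule) f z (f' z).
Proof.
  intros HA Hf Hf' Hz; apply is_derive_eps; intros e He.
  pose proof (Cmod_ge_0 z) as Hz0; unfold disk in Hz.
  set (r := (Cmod z + 1) / 2); assert (Hr : 0 <= r < 1) by (unfold r; lra).
  pose proof (radius_ge_1_ex_series _ r (radius_ge_1_shift _ (radius_ge_1_shift _ HA))
                (fun n => ell2_norm_ge_0 _) Hr) as Hs.
  set (b := fun n => ell2_norm (coef_shift (coef_shift A) n) * r ^ n) in Hs.
  assert (Hb0 : forall n, 0 <= b n).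
  { intros n; apply Rmult_le_pos; [apply ell2_norm_ge_0 | apply pow_le; lra]. }
  assert (HS : 0 <= Series b).
  { apply Rle_trans with (sum_n b 0); [rewrite sum_O; auto | apply sum_n_le_Series; auto]. }
  (* The first bound keeps w in the disk of radius r, the second makes h^2 times the sum of [b] at
     most e h. *)
  exists (Rmin ((1 - Cmod z) / 2) (e / (Series b + 1))); split.
  { apply Rmin_glb_lt; [| apply Rdiv_lt_0_compat]; lra. }
  intros w Hw.
  assert (Hw1 := Rlt_le_trans _ _ _ Hw (Rmin_l _ _)).
  assert (Hw2 := Rlt_le_trans _ _ _ Hw (Rmin_r _ _)).
  assert (Hwr : Cmod w <= r).
  { replace w with (z + (w - z))%C by ring; eapply Rle_trans; [apply Cmod_triangle |].
    unfold r; lra. }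
  assert (Hwd : disk w) by (unfold disk; lra).
  set (h := Cmod (w - z)) in *.
  assert (Hh0 : 0 <= h) by apply Cmod_ge_0.
  destruct (ell2_series_norm
              (fun n => ell2_scal (pow_remainder z w (S (S n))) (A (S (S n))))
              (fun n => h ^ 2 * b n)
              (fun k => f w k - f z k - (w - z) * f' z k)%C) as (u & Hu & Hun).
  - intros n; rewrite ell2_norm_scal; unfold b.
    rewrite ell2_norm_coef_shift; unfold PS_derive.
    rewrite ell2_norm_coef_shift; unfold PS_derive.
    apply Rle_trans with (h ^ 2 * (INR (S n) * INR (S (S n)) * r ^ n) * ell2_norm (A (S (S n)))).
    + apply Rmult_le_compat_r; [apply ell2_norm_ge_0 |].
      apply pow_remainder_le; auto; unfold r; lra.
    + right; ring.
  - exact (ex_series_scal_l (K := R_AbsRing) (h ^ 2) b Hs).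
  - intros k.
    (* The remainders of the powers 0 and 1 vanish, so the series may start at index 2, where the
       bound applies. *)
    apply (is_series_C_S (fun n => coef (ell2_scal (pow_remainder z w (S n)) (A (S n))) k)).
    { simpl; unfold pow_remainder; simpl; ring. }
    apply (is_series_C_S (fun n => coef (ell2_scal (pow_remainder z w n) (A n)) k)).
    { simpl; unfold pow_remainder; simpl; ring. }
    assert (H1 : is_series (V := C_NormedModule)
                   (fun n => A n k * (RtoC (INR n) * z ^ Nat.pred n))%C (f' z k)).
    { apply is_series_C_S; [simpl; ring |].
      apply is_series_ext with (2 := Hf' z Hz k).
      intros n; simpl coef; ccplx_ring. }
    pose proof (is_series_scal (V := C_NormedModule) (w - z)%C _ _ H1) as H2.
    pose proof (is_series_minus (V := C_NormedModule) _ _ _ _ (Hf w Hwd k) (Hf z Hz k)) as H3.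
    pose proof (is_series_minus (V := C_NormedModule) _ _ _ _ H3 H2) as H4.
    apply is_series_ext with (2 := H4).
    intros n; simpl; unfold pow_remainder; ccplx_ring.
  - match goal with |- norm ?x <= _ => replace x with u end.
    + eapply Rle_trans; [exact Hun |].
      rewrite Series_scal_l.
      apply (Rmult_lt_compat_r (Series b + 1)) in Hw2; [| lra].
      replace (e / (Series b + 1) * (Series b + 1)) with e in Hw2 by (field; lra).
      nra.
    + apply ell2_ext; intros k; rewrite Hu; simpl; ccplx_ring.
Qed.

(** * Uniqueness and locality of derivatives; expansion of bounded functions *)

(** This identifies the value chosen by [deriv]. The two linear approximations are compared at a
    small real increment t and divided by t. *)
Lemma is_derive_C_unique {V : NormedModule C_AbsRing} (f : C -> V) (z : C) (l l' : V) :
  is_derive f z l -> is_derive f z l' -> l = l'.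
Proof.
  intros H H'.
  assert (E : norm (minus l l') = 0).
  { apply Rle_antisym; [| apply norm_ge_0].
    apply Rle_of_le_eps; intros e He.
    destruct (proj1 (is_derive_eps _ _ _) H (e / 2)) as (d & Hd & H1); [lra |].
    destruct (proj1 (is_derive_eps _ _ _) H' (e / 2)) as (d' & Hd' & H1'); [lra |].
    set (t := Rmin d d' / 2).
    assert (Ht : 0 < t) by (unfold t; pose proof (Rmin_glb_lt _ _ _ Hd Hd'); lra).
    assert (Ht1 : t < d) by (unfold t in *; pose proof (Rmin_l d d'); lra).
    assert (Ht2 : t < d') by (unfold t in *; pose proof (Rmin_r d d'); lra).
    assert (Em : Cmod (z + RtoC t - z) = t).
    { replace (z + RtoC t - z)%C with (RtoC t) by ring; rewrite Cmod_R, Rabs_pos_eq; lra. }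
    specialize (H1 (z + RtoC t)%C); specialize (H1' (z + RtoC t)%C).
    rewrite Em in H1, H1'; specialize (H1 Ht1); specialize (H1' Ht2).
    set (h := (z + RtoC t - z)%C) in *.
    set (D := minus (f (z + RtoC t)%C) (f z)) in *.
    pose proof (norm_minus_triangle (scal h l) D (scal h l')) as T.
    rewrite (norm_minus_sym (scal h l) D) in T.
    assert (N : norm (minus (scal h l) (scal h l')) = t * norm (minus l l')).
    { rewrite <- Em, <- norm_scal_C; f_equal.
      symmetry; apply (scal_minus_distr_l h l l'). }
    apply (Rmult_le_reg_l t); auto; rewrite <- N.
    eapply Rle_trans; [exact T |].
    apply Rle_trans with (e / 2 * t + e / 2 * t); [| lra].
    apply Rplus_le_compat; [exact H1 | exact H1']. }
  apply norm_eq_zero in E.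
  rewrite <- (plus_minus_r l l'); rewrite E; apply plus_zero_r.
Qed.

Lemma deriv_correct {V : NormedModule C_AbsRing} (f : C -> V) (z : C) :
  ex_derive f z -> is_derive f z (deriv f z).
Proof. intros H; exact (epsilon_spec (inhabits zero) (fun l : V => is_derive f z l) H). Qed.

Lemma deriv_eq {V : NormedModule C_AbsRing} (f : C -> V) (z : C) (l : V) :
  is_derive f z l -> deriv f z = l.
Proof.
  intros H; apply (is_derive_C_unique f z); [| exact H].
  apply deriv_correct; exists l; exact H.
Qed.

(** The disk is open, so values outside it do not affect a derivative at a point of the disk. *)
Lemma is_derive_ext_disk {V : NormedModule C_AbsRing} (f g : C -> V) (z : C) (l : V) :
  (forall w, disk w -> f w = g w) -> disk z -> is_derive f z l -> is_derive g z l.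
Proof.
  intros E Hz H; apply is_derive_eps; intros e He.
  destruct (proj1 (is_derive_eps _ _ _) H e He) as (d & Hd & H1).
  unfold disk in Hz.
  exists (Rmin d (1 - Cmod z)); split; [apply Rmin_glb_lt; lra |].
  intros w Hw.
  assert (Hw1 := Rlt_le_trans _ _ _ Hw (Rmin_l _ _)).
  assert (Hw2 := Rlt_le_trans _ _ _ Hw (Rmin_r _ _)).
  rewrite <- (E w), <- (E z); auto.
  unfold disk; replace w with ((w - z) + z)%C by ring.
  eapply Rle_lt_trans; [apply Cmod_triangle |]; lra.
Qed.

Lemma analytic_ext {V : NormedModule C_AbsRing} (f g : C -> V) :
  (forall w, disk w -> f w = g w) -> analytic f -> analytic g.
Proof.
  intros E H z Hz; destruct (H z Hz) as [l Hl]; exists l.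
  apply (is_derive_ext_disk f g); auto.
Qed.

Lemma deriv_ext {V : NormedModule C_AbsRing} (f g : C -> V) :
  analytic f -> (forall w, disk w -> f w = g w) -> forall z, disk z -> deriv f z = deriv g z.
Proof.
  intros Hf E z Hz; symmetry; apply deriv_eq.
  apply (is_derive_ext_disk f g); auto; apply deriv_correct, Hf, Hz.
Qed.

Lemma pser_deriv A f : radius_ge_1 A -> pser A f ->
  analytic (V := ell2_NormedModule) f
  /\ pser (coef_shift A) (deriv (V := ell2_NormedModule) f).
Proof.
  intros HA Hf.
  destruct (pser_exists _ (radius_ge_1_shift A HA)) as [f' Hf'].
  assert (H : forall z, disk z -> is_derive (V := ell2_NormedModule) f z (f' z)).
  { intros z Hz; apply (pser_derive A); auto. }
  split.
  - intros z Hz; exists (f' z); auto.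
  - intros z Hz; rewrite (deriv_eq (V := ell2_NormedModule) f z (f' z)) by auto.
    apply Hf', Hz.
Qed.

Lemma pser_nderiv A f j : radius_ge_1 A -> pser A f ->
  pser (Nat.iter j coef_shift A) (nderiv (V := ell2_NormedModule) j f)
  /\ radius_ge_1 (Nat.iter j coef_shift A).
Proof.
  intros HA Hf; induction j as [|j [IH1 IH2]]; [split; assumption |].
  split; [apply pser_deriv; assumption | apply radius_ge_1_shift, IH2].
Qed.

Lemma is_derive_coef (f : C -> ell2) (k : nat) (z : C) (l : ell2) :
  is_derive (V := ell2_NormedModule) f z l ->
  is_derive (V := C_NormedModule) (fun z => f z k) z (l k).
Proof.
  intros H; apply is_derive_eps; intros e He.
  destruct (proj1 (is_derive_eps _ _ _) H e He) as (d & Hd & H1).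
  exists d; split; auto; intros w Hw; eapply Rle_trans; [| apply H1, Hw].
  match goal with |- _ <= norm ?x => pose proof (ell2_coef_le x k) as B end.
  eapply Rle_trans; [| exact B]; right; apply (f_equal Cmod); simpl; ccplx_ring.
Qed.

Lemma analytic_sum_n (f : nat -> C -> C) (c : nat -> C) (K : nat) :
  (forall j, analytic (V := C_NormedModule) (f j)) ->
  analytic (V := C_NormedModule) (fun z => sum_n (fun j => c j * f j z)%C K).
Proof.
  intros Hf z Hz.
  apply (ex_derive_sum_n (K := C_AbsRing) (V := C_NormedModule) (fun j z => c j * f j z)%C).
  intros k _; apply (ex_derive_mult_C (fun _ => c k) (f k)); [apply ex_derive_const_C | apply Hf, Hz].
Qed.

(* The n-th coefficients a_k of the coordinates satisfy sum |a_k|^2 <= M^2 on every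
   finite range: apply the scalar bound to sum (conj a_k) f_k. *)
Lemma bounded_analytic_pser (f : C -> ell2) (M : R) :
  analytic (V := ell2_NormedModule) f -> (forall z, disk z -> ell2_norm (f z) <= M) ->
  exists A, (forall n, ell2_norm (A n) <= M) /\ pser A f.
Proof.
  intros Hf HM.
  assert (HM0 : 0 <= M).
  { eapply Rle_trans; [apply ell2_norm_ge_0 | apply (HM 0)].
    unfold disk; rewrite Cmod_0; lra. }
  assert (Hk : forall k, analytic (V := C_NormedModule) (fun z => f z k)).
  { intros k z Hz; destruct (Hf z Hz) as [l Hl]; exists (l k); apply is_derive_coef, Hl. }
  assert (HMk : forall k z, disk z -> Cmod (f z k) <= M).
  { intros k z Hz; eapply Rle_trans; [apply ell2_coef_le | auto]. }
  set (a := fun n k => taylor (fun z => f z k) (/ 2) n).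
  assert (HA : forall n, exists u : ell2, (forall k, u k = a n k) /\ ell2_norm u <= M).
  { intros n; apply ell2_of_bounded; auto; intros K.
    set (T := sum_n (fun k => Cmod (a n k) ^ 2) K).
    assert (HT : 0 <= T) by (apply sum_n_R_ge_0; intros; apply pow2_ge_0).
    set (c := fun k => Cconj (a n k)).
    assert (HF : forall z, disk z ->
              Cmod (sum_n (fun k => c k * f z k)%C K) <= sqrt T * M).
    { intros z Hz; apply Rsqr_incr_0_var; [| apply Rmult_le_pos; auto using sqrt_pos].
      rewrite !Rsqr_pow2; eapply Rle_trans; [apply cauchy_schwarz_C |].
      rewrite Rpow_mult_distr, pow2_sqrt by exact HT.
      apply Rmult_le_compat.
      - apply sum_n_R_ge_0; intros; apply pow2_ge_0.
      - apply sum_n_R_ge_0; intros; apply pow2_ge_0.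
      - right; apply sum_n_ext; intros k; unfold c; rewrite Cmod_conj; reflexivity.
      - eapply Rle_trans; [apply ell2_partial_le |].
        apply pow_incr; split; [apply ell2_norm_ge_0 | auto]. }
    (* Since c_k is the conjugate of a_k, the left-hand side equals T; hence T <= sqrt T M, and
       dividing by sqrt T gives T <= M^2. *)
    assert (HB : Cmod (sum_n (fun k => c k * taylor (fun z => f z k) (/ 2) n)%C K) <= sqrt T * M).
    { pose proof (taylor_sum (fun k z => f z k) c (/ 2) n K Hk ltac:(lra)) as E.
      eapply Rle_trans; [right; apply (f_equal Cmod); symmetry; exact E |].
      apply taylor_le; [exact (analytic_sum_n (fun k z => f z k) c K Hk) | exact HF | lra]. }
    assert (E : (sum_n (fun k => c k * taylor (fun z => f z k) (/ 2) n)%C K : C) = RtoC T).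
    { unfold T; clear; induction K as [|K IH].
      - rewrite !sum_O; unfold c; rewrite Cmult_comm, Cmod2_conj; reflexivity.
      - rewrite sum_n_C_S, IH, sum_n_R_S, RtoC_plus; f_equal.
        unfold c; rewrite Cmult_comm, Cmod2_conj; reflexivity. }
    rewrite E, Cmod_R, Rabs_pos_eq in HB by exact HT.
    pose proof (sqrt_pos T) as Hs; pose proof (sqrt_sqrt T HT) as Hss.
    set (s := sqrt T) in *.
    assert (s <= M).
    { destruct (Rle_lt_or_eq_dec 0 s Hs) as [H0 | H0]; [| lra].
      apply (Rmult_le_reg_l s); auto; lra. }
    rewrite <- Hss; simpl; rewrite Rmult_1_r; apply Rmult_le_compat; lra. }
  exists (fun n => epsilon (inhabits ell2_zero) (fun u => (forall k, coef u k = a n k) /\ ell2_norm u <= M)).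
  assert (HE := fun n => epsilon_spec (inhabits ell2_zero) _ (HA n)).
  split.
  - intros n; apply (HE n).
  - intros z Hz k.
    apply is_series_ext with (fun n => a n k * z ^ n)%C.
    + intros n; rewrite (proj1 (HE n) k); reflexivity.
    + apply (taylor_is_series (fun z => f z k) M); auto.
Qed.

(** * Continuity on the closed disk and derivatives of dilations *)

Lemma continuous_on_eps {V : NormedModule C_AbsRing} (D : C -> Prop) (F : C -> V) :
  continuous_on D F <->
  forall z, D z -> forall e, 0 < e ->
    exists d, 0 < d /\ forall w, D w -> Cmod (w - z) < d -> norm (minus (F w) (F z)) < e.
Proof.
  split.
  - intros H z Hz e He.
    pose proof (proj1 (filterlim_locally_ball_norm (F := within D (locally z)) F (F z)) (H z Hz)
                  (mkposreal e He)) as HB.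
    unfold within in HB; apply locally_C in HB; destruct HB as [d Hd].
    exists d; split; [apply cond_pos |]; intros w Hw Hwz; apply (Hd w Hwz Hw).
  - intros H z Hz.
    apply (filterlim_locally_ball_norm (F := within D (locally z)) F (F z)); intros e.
    destruct (H z Hz e (cond_pos e)) as (d & Hd & H1).
    unfold within; apply locally_C.
    exists (mkposreal d Hd); intros w Hwz Hw; apply (H1 w Hw Hwz).
Qed.

(** The scalar c makes the form stable under differentiation: c f(rz) becomes (c r) f'(rz), which is
    what the iteration uses. *)
Lemma is_derive_dilation {V : NormedModule C_AbsRing} (f : C -> V) (c : C) (r : R) (z : C) (l : V) :
  is_derive f (RtoC r * z)%C l ->
  is_derive (fun z => scal c (f (RtoC r * z)%C)) z (scal (c * RtoC r)%C l).
Proof.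
  intros H; apply is_derive_eps; intros e He.
  pose proof (Cmod_ge_0 c) as Hc; pose proof (Rabs_pos r) as Hr.
  assert (HD : 0 < Cmod c * Rabs r + 1) by (pose proof (Rmult_le_pos _ _ Hc Hr); lra).
  destruct (proj1 (is_derive_eps _ _ _) H (e / (Cmod c * Rabs r + 1))) as (d & Hd & H1).
  { apply Rdiv_lt_0_compat; lra. }
  exists (d / (Rabs r + 1)); split; [apply Rdiv_lt_0_compat; lra |].
  intros w Hw; pose proof (Cmod_ge_0 (w - z)) as Hwz.
  assert (E : (RtoC r * w - RtoC r * z)%C = (RtoC r * (w - z))%C) by ring.
  assert (Hm : Cmod (RtoC r * w - RtoC r * z) = Rabs r * Cmod (w - z)).
  { rewrite E, Cmod_mult, Cmod_R; reflexivity. }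
  specialize (H1 (RtoC r * w)%C).
  rewrite Hm in H1.
  assert (Hlt : Rabs r * Cmod (w - z) < d).
  { apply (Rmult_lt_compat_l (Rabs r + 1)) in Hw; [| lra].
    replace ((Rabs r + 1) * (d / (Rabs r + 1))) with d in Hw by (field; lra); nra. }
  specialize (H1 Hlt).
  apply (Rmult_le_compat_l (Cmod c)) in H1; auto.
  rewrite <- norm_scal_C in H1.
  eapply Rle_trans; [| eapply Rle_trans; [exact H1 |]].
  - right; apply (f_equal norm); symmetry.
    set (p := f (RtoC r * w)%C); set (q := f (RtoC r * z)%C).
    etransitivity;
      [apply (scal_minus_distr_l c (minus p q) (scal (RtoC r * w - RtoC r * z)%C l)) |].
    apply f_equal2; [apply (scal_minus_distr_l c p q) |].
    etransitivity; [apply (scal_assoc c (RtoC r * w - RtoC r * z)%C l) |].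
    etransitivity; [| symmetry; apply (scal_assoc (w - z)%C (c * RtoC r)%C l)].
    apply (f_equal (fun k => scal k l)).
    change (c * (RtoC r * w - RtoC r * z) = (w - z) * (c * RtoC r))%C; ring.
  - apply Rle_trans with (e * Cmod (w - z) * (Cmod c * Rabs r / (Cmod c * Rabs r + 1))).
    + right; field; lra.
    + rewrite <- (Rmult_1_r (e * Cmod (w - z))) at 2.
      apply Rmult_le_compat_l; [apply Rmult_le_pos; lra |].
      apply (Rmult_le_reg_r (Cmod c * Rabs r + 1)); auto.
      unfold Rdiv; rewrite Rmult_assoc, Rinv_l; lra.
Qed.

Definition dilation {V : Type} (r : R) (f : C -> V) (z : C) : V := f (RtoC r * z)%C.

Lemma disk_dilation (r : R) (z : C) : 0 <= r < 1 -> closed_disk z -> disk (RtoC r * z)%C.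
Proof.
  unfold disk, closed_disk; intros Hr Hz.
  rewrite Cmod_mult, Cmod_R, Rabs_pos_eq by lra; pose proof (Cmod_ge_0 z); nra.
Qed.

Lemma disk_closed_disk z : disk z -> closed_disk z.
Proof. unfold disk, closed_disk; lra. Qed.

(** Analyticity is proved along with the formula: [deriv_ext] may replace an iterate by its formula
    only once that iterate is known to be analytic. *)
Lemma nderiv_dilation {V : NormedModule C_AbsRing} (f : C -> V) (r : R) (j : nat) :
  0 <= r < 1 -> (forall i, (i <= j)%nat -> analytic (nderiv i f)) ->
  (forall z, disk z -> nderiv j (dilation r f) z = scal (RtoC r ^ j)%C (nderiv j f (RtoC r * z)%C))
  /\ analytic (nderiv j (dilation r f)).
Proof.
  intros Hr.
  assert (Hd : forall (g : C -> V) c, analytic g -> forall z, disk z ->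
            is_derive (fun z => scal c (g (RtoC r * z)%C)) z (scal (c * RtoC r)%C (deriv g (RtoC r * z)%C))).
  { intros g c Hg z Hz; apply is_derive_dilation, deriv_correct, Hg.
    apply disk_dilation; auto using disk_closed_disk. }
  induction j as [|j IH]; intros Ha.
  - assert (E : forall z, disk z -> nderiv 0 (dilation r f) z = scal (RtoC r ^ 0)%C (f (RtoC r * z)%C)).
    { intros z _; symmetry; apply (scal_one (f (RtoC r * z)%C)). }
    split; [exact E |].
    intros z Hz; eexists.
    apply (is_derive_ext_disk (fun z => scal (RtoC r ^ 0)%C (f (RtoC r * z)%C))); auto.
    + intros w Hw; symmetry; apply E, Hw.
    + apply (Hd f); auto; apply (Ha 0%nat); lia.
  - destruct IH as [IH1 IH2]; [intros; apply Ha; lia |].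
    assert (E : forall z, disk z -> nderiv (S j) (dilation r f) z
              = scal (RtoC r ^ S j)%C (nderiv (S j) f (RtoC r * z)%C)).
    { intros z Hz; change (nderiv (S j) (dilation r f)) with (deriv (nderiv j (dilation r f))).
      rewrite (deriv_ext _ _ IH2 IH1 z Hz).
      rewrite Cpow_S, Cmult_comm; apply deriv_eq, Hd; auto; apply Ha; lia. }
    split; [exact E |].
    intros z Hz; eexists.
    apply (is_derive_ext_disk (fun z => scal (RtoC r ^ S j)%C (nderiv (S j) f (RtoC r * z)%C))); auto.
    intros w Hw; symmetry; apply E, Hw.
Qed.

(** * Functions with n derivatives in the disk algebra *)

Lemma disk_algebra_eps {V : NormedModule C_AbsRing} (f : C -> V) :
  disk_algebra f <-> analytic f /\ exists F : C -> V,
    (forall z, closed_disk z -> forall e, 0 < e ->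
      exists d, 0 < d /\ forall w, closed_disk w -> Cmod (w - z) < d ->
        norm (minus (F w) (F z)) < e)
    /\ forall z, disk z -> F z = f z.
Proof.
  split; intros [Ha [F [HF E]]]; (split; [exact Ha |]); exists F; (split; [| exact E]);
    apply continuous_on_eps; exact HF.
Qed.

(** A common bound M for the function and its first n derivatives is carried along. The derivative
    is any witness u' rather than [deriv u], so that product and quotient rules can supply their
    explicit formulas. *)
Fixpoint Cn {V : NormedModule C_AbsRing} (n : nat) (u : C -> V) (M : R) : Prop :=
  disk_algebra u /\ (forall z, disk z -> norm (u z) <= M) /\
  match n with
  | O => True
  | S m => exists u', (forall z, disk z -> is_derive u z (u' z)) /\ Cn m u' M
  end.

Lemma Cn_disk_algebra {V : NormedModule C_AbsRing} n (u : C -> V) M : Cn n u M -> disk_algebra u.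
Proof. destruct n; intros H; apply H. Qed.

Lemma Cn_bound {V : NormedModule C_AbsRing} n (u : C -> V) M :
  Cn n u M -> forall z, disk z -> norm (u z) <= M.
Proof. destruct n; intros H; apply H. Qed.

Lemma disk_algebra_ext {V : NormedModule C_AbsRing} (f g : C -> V) :
  (forall w, disk w -> f w = g w) -> disk_algebra f -> disk_algebra g.
Proof.
  intros E [Ha [F [HF EF]]]; split; [apply (analytic_ext f g E Ha) |].
  exists F; split; [exact HF |]; intros z Hz; rewrite <- E; auto.
Qed.

Lemma Cn_ext {V : NormedModule C_AbsRing} n (f g : C -> V) M :
  (forall w, disk w -> f w = g w) -> Cn n f M -> Cn n g M.
Proof.
  intros E; destruct n as [|n]; intros (H1 & H2 & H3).
  - split; [apply (disk_algebra_ext f g E H1) |]; split; auto.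
    intros z Hz; rewrite <- E; auto.
  - split; [apply (disk_algebra_ext f g E H1) |]; split.
    + intros z Hz; rewrite <- E; auto.
    + destruct H3 as [u' [Hu' H3]]; exists u'; split; auto.
      intros z Hz; apply (is_derive_ext_disk f g); auto.
Qed.

Lemma Cn_mono {V : NormedModule C_AbsRing} n (f : C -> V) M M' :
  M <= M' -> Cn n f M -> Cn n f M'.
Proof.
  intros HM; revert f; induction n as [|n IH]; intros f (H1 & H2 & H3).
  - split; auto; split; auto; intros z Hz; specialize (H2 z Hz); lra.
  - split; auto; split.
    + intros z Hz; specialize (H2 z Hz); lra.
    + destruct H3 as [u' [Hu' H3]]; exists u'; auto.
Qed.

Lemma Cn_pred {V : NormedModule C_AbsRing} n (f : C -> V) M : Cn (S n) f M -> Cn n f M.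
Proof.
  revert f; induction n as [|n IH]; intros f (H1 & H2 & u' & Hu' & H3).
  - split; auto.
  - split; auto; split; auto; exists u'; auto.
Qed.

Lemma disk_0 : disk 0.
Proof. unfold disk; rewrite Cmod_0; lra. Qed.

Lemma Cn_ge_0 {V : NormedModule C_AbsRing} n (f : C -> V) M : Cn n f M -> 0 <= M.
Proof.
  intros H; eapply Rle_trans; [apply (norm_ge_0 (f 0)) | apply (Cn_bound n f M H 0 disk_0)].
Qed.

Lemma minus_plus_plus {G : AbelianGroup} (a b c d : G) :
  plus (minus a c) (minus b d) = minus (plus a b) (plus c d).
Proof.
  unfold minus; rewrite opp_plus, <- !plus_assoc; f_equal.
  apply (plus_swap (opp c) b (opp d)).
Qed.

Lemma norm_minus_plus {V : NormedModule C_AbsRing} (a b c d : V) :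
  norm (minus (plus a b) (plus c d)) <= norm (minus a c) + norm (minus b d).
Proof.
  replace (minus (plus a b) (plus c d)) with (plus (minus a c) (minus b d)).
  - apply (norm_triangle (minus a c) (minus b d)).
  - apply (minus_plus_plus a b c d).
Qed.

Lemma disk_algebra_plus {V : NormedModule C_AbsRing} (u v : C -> V) :
  disk_algebra u -> disk_algebra v -> disk_algebra (fun z => plus (u z) (v z)).
Proof.
  intros Hu Hv; apply disk_algebra_eps in Hu; apply disk_algebra_eps in Hv.
  destruct Hu as (Hua & F & HF & EF), Hv as (Hva & G & HG & EG).
  apply disk_algebra_eps; split.
  - intros z Hz; destruct (Hua z Hz) as [l Hl], (Hva z Hz) as [k Hk].
    exists (plus l k); apply (is_derive_plus (K := C_AbsRing) u v z l k Hl Hk).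
  - exists (fun z => plus (F z) (G z)); split.
    + intros z Hz e He.
      destruct (HF z Hz (e / 2)) as (d1 & Hd1 & H1); [lra |].
      destruct (HG z Hz (e / 2)) as (d2 & Hd2 & H2); [lra |].
      exists (Rmin d1 d2); split; [apply Rmin_glb_lt; auto |]; intros w Hw Hwz.
      specialize (H1 w Hw (Rlt_le_trans _ _ _ Hwz (Rmin_l _ _))).
      specialize (H2 w Hw (Rlt_le_trans _ _ _ Hwz (Rmin_r _ _))).
      eapply Rle_lt_trans; [apply norm_minus_plus | lra].
    + intros z Hz; rewrite EF, EG by exact Hz; reflexivity.
Qed.

Lemma norm_minus_bil {U V W : NormedModule C_AbsRing} (B : U -> V -> W) (a a' : U) (b b' : V) :
  bounded_bilinear B ->
  norm (minus (B a b) (B a' b')) <= norm (minus a a') * norm b + norm a' * norm (minus b b').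
Proof.
  intros HB; eapply Rle_trans; [apply (norm_minus_triangle _ (B a' b)) |].
  apply Rplus_le_compat.
  - rewrite <- (bil_minus_l B HB); apply (bil_norm B HB).
  - rewrite <- (bil_minus_r B HB); apply (bil_norm B HB).
Qed.

Lemma disk_algebra_bil {U V W : NormedModule C_AbsRing} (B : U -> V -> W)
    (u : C -> U) (v : C -> V) :
  bounded_bilinear B -> disk_algebra u -> disk_algebra v -> disk_algebra (fun z => B (u z) (v z)).
Proof.
  intros HB Hu Hv; apply disk_algebra_eps in Hu; apply disk_algebra_eps in Hv.
  destruct Hu as (Hua & F & HF & EF), Hv as (Hva & G & HG & EG).
  apply disk_algebra_eps; split.
  - intros z Hz; destruct (Hua z Hz) as [l Hl], (Hva z Hz) as [k Hk].
    eexists; apply (is_derive_bilinear B u v z l k HB Hl Hk).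
  - exists (fun z => B (F z) (G z)); split.
    + intros z Hz e He.
      pose proof (norm_ge_0 (F z)) as HFz; pose proof (norm_ge_0 (G z)) as HGz.
      set (D := norm (F z) + norm (G z) + 1).
      assert (He' : 0 < e / (2 * D)) by (apply Rdiv_lt_0_compat; unfold D; lra).
      destruct (HF z Hz (e / (2 * D)) He') as (d1 & Hd1 & H1).
      destruct (HG z Hz (Rmin 1 (e / (2 * D)))) as (d2 & Hd2 & H2).
      { apply Rmin_glb_lt; lra. }
      exists (Rmin d1 d2); split; [apply Rmin_glb_lt; auto |]; intros w Hw Hwz.
      specialize (H1 w Hw (Rlt_le_trans _ _ _ Hwz (Rmin_l _ _))).
      specialize (H2 w Hw (Rlt_le_trans _ _ _ Hwz (Rmin_r _ _))).
      assert (H2a := Rlt_le_trans _ _ _ H2 (Rmin_l _ _)).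
      assert (H2b := Rlt_le_trans _ _ _ H2 (Rmin_r _ _)).
      pose proof (norm_le_minus (G w) (G z)) as HGw.
      eapply Rle_lt_trans; [apply (norm_minus_bil B _ _ _ _ HB) |].
      pose proof (norm_ge_0 (minus (F w) (F z))); pose proof (norm_ge_0 (G w)).
      apply Rle_lt_trans with (e / (2 * D) * (norm (G z) + 1) + norm (F z) * (e / (2 * D))).
      * apply Rplus_le_compat; [apply Rmult_le_compat; lra | apply Rmult_le_compat_l; lra].
      * replace e with (e / (2 * D) * D + e / 2) at 3 by (field; unfold D; lra).
        replace (e / (2 * D) * (norm (G z) + 1) + norm (F z) * (e / (2 * D)))
          with (e / (2 * D) * D) by (unfold D; ring).
        lra.
    + intros z Hz; rewrite EF, EG by exact Hz; reflexivity.
Qed.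

Lemma Cn_plus {V : NormedModule C_AbsRing} n (u v : C -> V) M N :
  Cn n u M -> Cn n v N -> Cn n (fun z => plus (u z) (v z)) (M + N).
Proof.
  revert u v; induction n as [|n IH]; intros u v (U1 & U2 & U3) (V1 & V2 & V3);
    (split; [apply disk_algebra_plus; auto |]); split.
  1, 3: intros z Hz; eapply Rle_trans; [apply (norm_triangle (u z) (v z)) |];
    apply Rplus_le_compat; auto.
  - exact I.
  - destruct U3 as (u' & Hu' & U3), V3 as (v' & Hv' & V3).
    exists (fun z => plus (u' z) (v' z)); split; [| apply IH; auto].
    intros z Hz; apply (is_derive_plus (K := C_AbsRing) u v z (u' z) (v' z)); auto.
Qed.

(** Each differentiation replaces one product by two, hence 2^n. The crude constant is harmless: it
    will always multiply a quantity that can be made small. *)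
Lemma Cn_bil {U V W : NormedModule C_AbsRing} (B : U -> V -> W) n (u : C -> U) (v : C -> V) M N :
  bounded_bilinear B -> Cn n u M -> Cn n v N ->
  Cn n (fun z => B (u z) (v z)) (2 ^ n * (M * N)).
Proof.
  intros HB; revert u v; induction n as [|n IH]; intros u v Hu Hv;
    pose proof (Cn_ge_0 _ _ _ Hu) as HM; pose proof (Cn_ge_0 _ _ _ Hv) as HN;
    assert (HMN : 0 <= M * N) by (apply Rmult_le_pos; auto);
    (split; [apply disk_algebra_bil; eauto using Cn_disk_algebra |]); split.
  1, 3: intros z Hz; eapply Rle_trans; [apply (bil_norm B HB) |];
    apply Rle_trans with (M * N);
    [apply Rmult_le_compat; auto using norm_ge_0; eapply Cn_bound; eauto |
     rewrite <- (Rmult_1_l (M * N)) at 1; apply Rmult_le_compat_r; auto; apply pow_R1_Rle; lra].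
  - exact I.
  - pose proof (Cn_pred _ _ _ Hu) as Hu0; pose proof (Cn_pred _ _ _ Hv) as Hv0.
    destruct Hu as (_ & _ & u' & Hu' & U3), Hv as (_ & _ & v' & Hv' & V3).
    exists (fun z => plus (B (u' z) (v z)) (B (u z) (v' z))); split.
    + intros z Hz; apply is_derive_bilinear; auto.
    + replace (2 ^ S n * (M * N)) with (2 ^ n * (M * N) + 2 ^ n * (M * N)) by (simpl; ring).
      apply (Cn_plus n (fun z => B (u' z) (v z)) (fun z => B (u z) (v' z))); apply IH; auto.
Qed.

(** Absorbs the sign in (1/h)' = - h' / h^2, so that [Cn_bil] applies to it directly. *)
Lemma bounded_bilinear_opp_mult :
  bounded_bilinear (U := C_NormedModule) (V := C_NormedModule) (W := C_NormedModule)
    (fun a b => - (a * b))%C.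
Proof.
  split; intros.
  - change (- ((a + b) * c) = - (a * c) + - (b * c))%C; ring.
  - change (- (a * (b + c)) = - (a * b) + - (a * c))%C; ring.
  - change (- ((k * a) * b) = k * - (a * b))%C; ring.
  - change (- (a * (k * b)) = k * - (a * b))%C; ring.
  - right; change (Cmod (- (a * b)) = Cmod a * Cmod b); rewrite Cmod_opp; apply Cmod_mult.
Qed.

Lemma Cmod_triangle_minus (x y : C) : Cmod x <= Cmod y + Cmod (x - y).
Proof. exact (norm_le_minus (V := C_NormedModule) x y). Qed.

Lemma neq_0_of_half (x : C) : / 2 <= Cmod x -> x <> 0.
Proof. intros H E; rewrite E, Cmod_0 in H; lra. Qed.

Lemma Cmod_inv_half (x : C) : / 2 <= Cmod x -> Cmod (/ x) <= 2.
Proof.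
  intros H; rewrite Cmod_inv by (apply neq_0_of_half, H).
  replace 2 with (/ / 2) by field; apply Rinv_le_contravar; lra.
Qed.

Lemma disk_algebra_inv (h : C -> C) :
  disk_algebra (V := C_NormedModule) h -> (forall z, disk z -> / 2 <= Cmod (h z)) ->
  disk_algebra (V := C_NormedModule) (fun z => / h z)%C.
Proof.
  intros Hh Hlow; apply disk_algebra_eps in Hh; destruct Hh as (Ha & H & HH & EH).
  (* The lower bound passes to the closed disk along r z with r < 1; the chosen r gives |r z - z| <=
     d/2. *)
  assert (HHlow : forall z, closed_disk z -> / 2 <= Cmod (H z)).
  { intros z Hz; apply Rle_of_le_eps; intros e He.
    destruct (HH z Hz e He) as (d & Hd & H1).
    set (r := 1 - Rmin 1 (d / 2)).
    assert (Hm : 0 < Rmin 1 (d / 2)) by (apply Rmin_glb_lt; lra).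
    assert (Hm1 : Rmin 1 (d / 2) <= 1) by apply Rmin_l.
    assert (Hm2 : Rmin 1 (d / 2) <= d / 2) by apply Rmin_r.
    assert (Hrz : disk (RtoC r * z)%C) by (apply disk_dilation; auto; unfold r; lra).
    specialize (H1 (RtoC r * z)%C (disk_closed_disk _ Hrz)).
    assert (Hdist : Cmod (RtoC r * z - z) < d).
    { replace (RtoC r * z - z)%C with (- (RtoC (Rmin 1 (d / 2)) * z))%C
        by (unfold r; rewrite RtoC_minus; ring).
      rewrite Cmod_opp, Cmod_mult, Cmod_R, Rabs_pos_eq by lra.
      unfold closed_disk in Hz; pose proof (Cmod_ge_0 z); nra. }
    specialize (H1 Hdist).
    pose proof (Hlow _ Hrz) as Hl; rewrite <- EH in Hl by exact Hrz.
    pose proof (Cmod_triangle_minus (H (RtoC r * z)%C) (H z)) as T.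
    change (Cmod (H (RtoC r * z) - H z)%C < e) in H1; lra. }
  apply disk_algebra_eps; split.
  - intros z Hz; destruct (Ha z Hz) as [l Hl]; eexists.
    apply (is_derive_comp_inv h z l); auto; apply neq_0_of_half; auto.
  - exists (fun z => / H z)%C; split.
    + intros z Hz e He.
      destruct (is_derive_continuous_eps _ _ _
                  (is_derive_inv_C (H z) (neq_0_of_half _ (HHlow z Hz))) e He) as (d1 & Hd1 & H1).
      destruct (HH z Hz d1 Hd1) as (d & Hd & H2).
      exists d; split; [exact Hd |].
      intros w Hw Hwz; apply H1, H2; auto.
    + intros z Hz; rewrite EH by exact Hz; reflexivity.
Qed.

(** The bound M' comes before h: it depends on n and M alone. Induction on n uses (1/h)' = - h' /
    h^2, where 1/h is taken at the lower order. *)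
Lemma Cn_inv n M : 0 <= M -> exists M', forall h : C -> C,
  Cn (V := C_NormedModule) n h M -> (forall z, disk z -> / 2 <= Cmod (h z)) ->
  Cn (V := C_NormedModule) n (fun z => / h z)%C M'.
Proof.
  intros HM; induction n as [|n [M' IH]].
  - exists 2; intros h (H1 & _ & _) Hlow.
    split; [apply disk_algebra_inv; auto |]; split; auto.
    intros z Hz; apply Cmod_inv_half; auto.
  - set (M2 := 2 ^ n * (M * (2 ^ n * (M' * M')))).
    exists (Rmax 2 M2); intros h Hh Hlow.
    pose proof (Cn_pred _ _ _ Hh) as Hh0; destruct Hh as (H1 & _ & h' & Hh' & H3).
    split; [apply disk_algebra_inv; auto |]; split.
    + intros z Hz; eapply Rle_trans; [apply Cmod_inv_half; auto | apply Rmax_l].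
    + exists (fun z => - (h' z * (/ h z * / h z)))%C; split.
      * intros z Hz; apply is_derive_comp_inv; auto; apply neq_0_of_half; auto.
      * apply Cn_mono with M2; [apply Rmax_r |].
        apply (Cn_bil (fun a b => - (a * b))%C n h' (fun z => / h z * / h z)%C
                 _ _ bounded_bilinear_opp_mult H3).
        apply (Cn_bil Cmult n (fun z => / h z)%C (fun z => / h z)%C _ _ bounded_bilinear_mult);
          apply IH; auto.
Qed.

(** [nderiv] adds derivatives on the outside while [Cn] peels them off on the inside; this
    reconciles the two recursions. *)
Lemma nderiv_S_r {V : NormedModule C_AbsRing} j (f : C -> V) :
  nderiv (S j) f = nderiv j (deriv f).
Proof. apply Nat.iter_succ_r. Qed.

Lemma Cn_nderiv {V : NormedModule C_AbsRing} n (u : C -> V) M j :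
  Cn n u M -> (j <= n)%nat ->
  disk_algebra (nderiv j u) /\ forall z, disk z -> norm (nderiv j u z) <= M.
Proof.
  revert n u; induction j as [|j IH]; intros n u Hu Hj.
  - split; [apply (Cn_disk_algebra _ _ _ Hu) | apply (Cn_bound _ _ _ Hu)].
  - destruct n as [|n]; [lia |].
    destruct Hu as (_ & _ & u' & Hu' & Hn).
    rewrite nderiv_S_r; apply (IH n); [| lia].
    apply Cn_ext with (2 := Hn); intros z Hz; symmetry; apply deriv_eq; auto.
Qed.

Lemma Cn_of_nderiv {V : NormedModule C_AbsRing} n (u : C -> V) M :
  (forall j, (j <= n)%nat -> disk_algebra (nderiv j u)
                             /\ forall z, disk z -> norm (nderiv j u z) <= M) ->
  Cn n u M.
Proof.
  revert u; induction n as [|n IH]; intros u H.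
  - destruct (H 0%nat (le_n _)) as [H1 H2]; split; auto.
  - destruct (H 0%nat ltac:(lia)) as [H1 H2]; split; [exact H1 |]; split; [exact H2 |].
    exists (deriv u); split.
    + intros z Hz; apply deriv_correct, H1, Hz.
    + apply IH; intros j Hj; rewrite <- nderiv_S_r; apply H; lia.
Qed.

(** * The bilinear product on l^2 and compactness *)

Lemma Clim_dist_le (u : nat -> C) (l c : C) (B : R) N :
  Clim u l -> (forall n, (N <= n)%nat -> Cmod (u n - c) <= B) -> Cmod (l - c) <= B.
Proof.
  intros H HB; apply Rle_of_le_eps; intros e He.
  destruct (H e He) as [N' HN'].
  specialize (HN' (Nat.max N N') (Nat.le_max_r _ _)); specialize (HB (Nat.max N N') (Nat.le_max_l _ _)).
  replace (l - c)%C with (- (u (Nat.max N N') - l) + (u (Nat.max N N') - c))%C by ring.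
  eapply Rle_trans; [apply Cmod_triangle |]; rewrite Cmod_opp; lra.
Qed.

Lemma Clim_plus (u v : nat -> C) (l k : C) :
  Clim u l -> Clim v k -> Clim (fun n => u n + v n)%C (l + k)%C.
Proof.
  intros Hu Hv e He.
  destruct (Hu (e / 2)) as [N1 H1]; [lra |]; destruct (Hv (e / 2)) as [N2 H2]; [lra |].
  exists (Nat.max N1 N2); intros n Hn.
  specialize (H1 n ltac:(lia)); specialize (H2 n ltac:(lia)).
  replace (u n + v n - (l + k))%C with ((u n - l) + (v n - k))%C by ring.
  eapply Rle_lt_trans; [apply Cmod_triangle | lra].
Qed.

Lemma Clim_scal_r (u : nat -> C) (l k : C) : Clim u l -> Clim (fun n => u n * k)%C (l * k)%C.
Proof.
  intros Hu e He; pose proof (Cmod_ge_0 k).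
  destruct (Hu (e / (Cmod k + 1))) as [N HN]; [apply Rdiv_lt_0_compat; lra |].
  exists N; intros n Hn; specialize (HN n Hn).
  replace (u n * k - l * k)%C with ((u n - l) * k)%C by ring; rewrite Cmod_mult.
  apply (Rmult_lt_compat_r (Cmod k + 1)) in HN; [| lra].
  replace (e / (Cmod k + 1) * (Cmod k + 1)) with e in HN by (field; lra).
  pose proof (Cmod_ge_0 (u n - l)); lra.
Qed.

Lemma Clim_sum_n (u : nat -> nat -> C) (l : nat -> C) K :
  (forall k, Clim (fun n => u n k) (l k)) ->
  Clim (fun n => sum_n (u n) K) (sum_n l K).
Proof.
  intros H; induction K as [|K IH].
  - intros e He; destruct (H 0%nat e He) as [N HN]; exists N; intros n Hn.
    rewrite !sum_O; auto.
  - intros e He; destruct (Clim_plus _ _ _ _ IH (H (S K)) e He) as [N HN].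
    exists N; intros n Hn; rewrite !sum_n_C_S; auto.
Qed.

Lemma is_series_tail_le (a : nat -> C) (b : nat -> R) (l : C) K :
  is_series (V := C_NormedModule) a l -> (forall n, Cmod (a n) <= b n) -> ex_series b ->
  Cmod (l - (sum_n a K : C)) <= Series b - sum_n b K.
Proof.
  intros Ha Hab Hb; apply is_series_Clim in Ha.
  assert (Hb0 : forall n, 0 <= b n).
  { intros n; eapply Rle_trans; [apply Cmod_ge_0 | apply Hab]. }
  assert (H : forall p, Cmod ((sum_n a (K + p) : C) - (sum_n a K : C)) <= sum_n b (K + p) - sum_n b K).
  { induction p as [|p IH].
    - rewrite Nat.add_0_r.
      replace ((sum_n a K : C) - (sum_n a K : C))%C with (RtoC 0) by ring; rewrite Cmod_0; lra.
    - rewrite Nat.add_succ_r, sum_n_C_S, sum_n_R_S.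
      match goal with |- Cmod (?x + ?y - ?z) <= _ =>
        replace (x + y - z)%C with ((x - z) + y)%C by ring end.
      eapply Rle_trans; [apply Cmod_triangle |]; specialize (Hab (S (K + p))); lra. }
  apply (Clim_dist_le _ _ _ _ K Ha); intros n Hn.
  replace n with (K + (n - K))%nat by lia.
  eapply Rle_trans; [apply H |].
  pose proof (sum_n_le_Series b (K + (n - K)) Hb0 Hb); lra.
Qed.

Lemma Series_tail_small (b : nat -> R) (e : R) :
  ex_series b -> 0 < e -> exists K, Series b - sum_n b K < e.
Proof.
  intros Hb He; pose proof (Series_correct b Hb) as H.
  change (is_lim_seq (sum_n b) (Series b)) in H.
  apply is_lim_seq_spec in H; destruct (H (mkposreal e He)) as [N HN].
  exists N; specialize (HN N (le_n N)); simpl in HN; apply Rabs_def2 in HN; lra.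
Qed.

(** Dominated convergence for series: finite parts converge, and the tails are uniformly small by
    the common majorant b. *)
Lemma Clim_series (x : nat -> nat -> C) (y : nat -> C) (b : nat -> R) (s : nat -> C) (t : C) :
  (forall m n, Cmod (x m n) <= b n) -> (forall n, Cmod (y n) <= b n) -> ex_series b ->
  (forall n, Clim (fun m => x m n) (y n)) ->
  (forall m, is_series (V := C_NormedModule) (x m) (s m)) ->
  is_series (V := C_NormedModule) y t -> Clim s t.
Proof.
  intros Hx Hy Hb Hl Hs Ht e He.
  destruct (Series_tail_small b (e / 3) Hb) as [K HK]; [lra |].
  destruct (Clim_sum_n x y K Hl (e / 3)) as [N HN]; [lra |].
  exists N; intros m Hm; specialize (HN m Hm).
  pose proof (is_series_tail_le _ b _ K (Hs m) (Hx m) Hb) as H1.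
  pose proof (is_series_tail_le _ b _ K Ht Hy Hb) as H2.
  set (p := (sum_n (x m) K : C)) in *; set (q := (sum_n y K : C)) in *.
  replace (s m - t)%C with ((s m - p) + (p - q) + - (t - q))%C by ring.
  eapply Rle_lt_trans; [apply Cmod_triangle |].
  eapply Rle_lt_trans; [apply Rplus_le_compat_r, Cmod_triangle |].
  rewrite Cmod_opp; lra.
Qed.

(** Bilinear rather than sesquilinear, so that the product of two analytic functions is analytic and
    [bezout] is dot = 1. *)
Definition dot (u v : ell2) : C :=
  epsilon (inhabits (RtoC 0)) (fun l => is_series (V := C_NormedModule) (fun k => u k * v k)%C l).

Lemma dot_correct (u v : ell2) : is_series (V := C_NormedModule) (fun k => u k * v k)%C (dot u v).
Proof.
  apply (epsilon_spec (inhabits (RtoC 0))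
    (fun l => is_series (V := C_NormedModule) (fun k => u k * v k)%C l)).
  apply ex_series_C_of_le with (b := fun k => Cmod (u k) ^ 2 + Cmod (v k) ^ 2).
  - intros k; rewrite Cmod_mult.
    pose proof (pow2_ge_0 (Cmod (u k) - Cmod (v k))).
    pose proof (pow2_ge_0 (Cmod (u k))); pose proof (pow2_ge_0 (Cmod (v k))); lra.
  - apply (ex_series_plus (V := R_NormedModule) (fun k => Cmod (u k) ^ 2) (fun k => Cmod (v k) ^ 2));
      apply coef_summable.
Qed.

Lemma dot_unique (u v : ell2) (l : C) :
  is_series (V := C_NormedModule) (fun k => u k * v k)%C l -> dot u v = l.
Proof. intros H; apply (is_series_C_unique _ _ _ (dot_correct u v) H). Qed.

Lemma dot_le (u v : ell2) : Cmod (dot u v) <= ell2_norm u * ell2_norm v.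
Proof.
  replace (dot u v) with (dot u v - 0)%C by ring.
  apply (Clim_dist_le _ _ _ _ 0 (proj1 (is_series_Clim _ _) (dot_correct u v))); intros n _.
  assert (Z : forall c : C, (c - 0)%C = c) by (intros; ring); rewrite Z.
  pose proof (ell2_norm_ge_0 u); pose proof (ell2_norm_ge_0 v).
  apply Rsqr_incr_0_var; [| apply Rmult_le_pos; auto].
  rewrite !Rsqr_pow2; eapply Rle_trans; [apply cauchy_schwarz_C |].
  rewrite Rpow_mult_distr; apply Rmult_le_compat;
    try (apply sum_n_R_ge_0; intros; apply pow2_ge_0); apply ell2_partial_le.
Qed.

Lemma bounded_bilinear_dot :
  bounded_bilinear (U := ell2_NormedModule) (V := ell2_NormedModule) (W := C_NormedModule) dot.
Proof.
  split; intros.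
  - apply dot_unique.
    eapply is_series_ext; [| exact (is_series_plus (V := C_NormedModule) _ _ _ _
                                     (dot_correct a c) (dot_correct b c))].
    intros n; simpl; ccplx_ring.
  - apply dot_unique.
    eapply is_series_ext; [| exact (is_series_plus (V := C_NormedModule) _ _ _ _
                                     (dot_correct a b) (dot_correct a c))].
    intros n; simpl; ccplx_ring.
  - apply dot_unique.
    eapply is_series_ext; [| exact (is_series_scal (V := C_NormedModule) k _ _ (dot_correct a b))].
    intros n; simpl; ccplx_ring.
  - apply dot_unique.
    eapply is_series_ext; [| exact (is_series_scal (V := C_NormedModule) k _ _ (dot_correct a b))].
    intros n; simpl; ccplx_ring.
  - apply dot_le.
Qed.

(** The truncation index depends on u alone, so it serves a whole bounded sequence of w at once. *)
Lemma dot_approx (u : ell2) (e : R) : 0 < e ->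
  exists K, forall w : ell2, Cmod (dot w u - (sum_n (fun k => w k * u k)%C K : C)) <= ell2_norm w * e.
Proof.
  intros He.
  destruct (Series_tail_small (fun k => Cmod (u k) ^ 2) (e ^ 2) (coef_summable u)) as [K HK].
  { apply pow_lt, He. }
  exists K; intros w.
  (* The tail of u after index K: Cauchy-Schwarz for w and y bounds the tail of the product by the
     tail of the norm of u. *)
  set (y := fun k => if Nat.leb k K then RtoC 0 else u k).
  assert (Hlow : forall n, (n <= K)%nat ->
    (sum_n (fun k => Cmod (y k) ^ 2) n : R) = 0 /\ (sum_n (fun k => w k * y k)%C n : C) = 0).
  { induction n as [|n IH]; intros Hn.
    - rewrite !sum_O; unfold y; simpl Nat.leb; cbv iota.
      rewrite Cmod_0, Cmult_0_r; split; [ring | reflexivity].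
    - destruct (IH ltac:(lia)) as [E1 E2].
      rewrite sum_n_R_S, sum_n_C_S, E1, E2; unfold y.
      replace (Nat.leb (S n) K) with true by (symmetry; apply Nat.leb_le; lia).
      rewrite Cmod_0, Cmult_0_r; split; [ring | apply Cplus_0_r]. }
  assert (Hhigh : forall p,
    (sum_n (fun k => Cmod (y k) ^ 2) (K + p) : R)
      = sum_n (fun k => Cmod (u k) ^ 2) (K + p) - sum_n (fun k => Cmod (u k) ^ 2) K
    /\ (sum_n (fun k => w k * y k)%C (K + p) : C)
      = ((sum_n (fun k => w k * u k)%C (K + p) : C) - (sum_n (fun k => w k * u k)%C K : C))%C).
  { induction p as [|p [E1 E2]].
    - rewrite Nat.add_0_r; destruct (Hlow K (le_n K)) as [E1 E2].
      rewrite E1, E2; split; [ring | symmetry; apply Cplus_opp_r].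
    - rewrite Nat.add_succ_r, !sum_n_R_S, !sum_n_C_S, E1, E2; unfold y.
      replace (Nat.leb (S (K + p)) K) with false by (symmetry; apply Nat.leb_gt; lia).
      split; ring. }
  apply (Clim_dist_le _ _ _ _ K (proj1 (is_series_Clim _ _) (dot_correct w u))); intros n Hn.
  replace n with (K + (n - K))%nat by lia.
  destruct (Hhigh (n - K)%nat) as [E1 E2]; rewrite <- E2; clear E2.
  apply Rsqr_incr_0_var; [| apply Rmult_le_pos; [apply ell2_norm_ge_0 | lra]].
  rewrite !Rsqr_pow2; eapply Rle_trans; [apply cauchy_schwarz_C |].
  rewrite Rpow_mult_distr; apply Rmult_le_compat;
    try (apply sum_n_R_ge_0; intros; apply pow2_ge_0); [apply ell2_partial_le |].
  rewrite E1.
  pose proof (sum_n_le_Series _ (K + (n - K)) (fun k => pow2_ge_0 (Cmod (u k))) (coef_summable u)).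
  lra.
Qed.

(** Bounded coordinatewise convergence is weak convergence in l^2: truncate the product by
    [dot_approx] and pass to the limit in finitely many terms. *)
Lemma dot_weak_limit (v : nat -> ell2) (a u : ell2) (M : R) :
  (forall m, ell2_norm (v m) <= M) -> (forall k, Clim (fun m => v m k) (a k)) ->
  Clim (fun m => dot (v m) u) (dot a u).
Proof.
  intros HM Hl e He.
  pose proof (Rle_trans _ _ _ (ell2_norm_ge_0 (v 0%nat)) (HM 0%nat)) as HM0.
  pose proof (ell2_norm_ge_0 a) as Ha0.
  set (d := e / (3 * (M + ell2_norm a + 1))).
  assert (Hd : 0 < d) by (apply Rdiv_lt_0_compat; lra).
  destruct (dot_approx u d Hd) as [K HK].
  destruct (Clim_sum_n (fun m k => v m k * u k)%C (fun k => a k * u k)%C K) with (e := e / 3)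
    as [N HN]; [intros k; apply Clim_scal_r, Hl | lra |].
  exists N; intros m Hm; specialize (HN m Hm).
  pose proof (HK (v m)) as H1; pose proof (HK a) as H2.
  set (p := (sum_n (fun k => v m k * u k)%C K : C)) in *.
  set (q := (sum_n (fun k => a k * u k)%C K : C)) in *.
  replace (dot (v m) u - dot a u)%C
    with ((dot (v m) u - p) + (p - q) + - (dot a u - q))%C by ring.
  eapply Rle_lt_trans; [apply Cmod_triangle |].
  eapply Rle_lt_trans; [apply Rplus_le_compat_r, Cmod_triangle |].
  rewrite Cmod_opp.
  assert (E : d * (M + ell2_norm a + 1) = e / 3) by (unfold d; field; lra).
  assert (ell2_norm (v m) * d <= M * d) by (apply Rmult_le_compat_r; [lra | apply HM]).
  assert (ell2_norm a * d <= d * (ell2_norm a + 1)) by nra.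
  assert (M * d + d * (ell2_norm a + 1) = e / 3) by lra.
  lra.
Qed.

(** Subsequences are encoded by m <= p m alone, a property preserved by composition and enough to
    carry limits over. *)
Lemma bolzano_weierstrass_R (u : nat -> R) (B : R) :
  (forall n, Rabs (u n) <= B) ->
  exists (p : nat -> nat) (l : R), (forall m, (m <= p m)%nat) /\
    forall e, 0 < e -> exists N, forall m, (N <= m)%nat -> Rabs (u (p m) - l) < e.
Proof.
  intros HB.
  destruct (Bolzano_Weierstrass u (fun x => - B <= x <= B) (compact_P3 (- B) B)) as [l Hl].
  { intros n; specialize (HB n); apply Rabs_le_between in HB; exact HB. }
  assert (H : forall m, exists p, (m <= p)%nat /\ Rabs (u p - l) < / INR (S m)).
  { intros m.
    assert (Hp : 0 < / INR (S m)) by (apply Rinv_0_lt_compat, lt_0_INR; lia).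
    destruct (Hl (disc l (mkposreal _ Hp)) m) as (p & Hp1 & Hp2).
    { exists (mkposreal _ Hp); intros x Hx; exact Hx. }
    exists p; split; auto. }
  exists (fun m => epsilon (inhabits 0%nat) (fun p => (m <= p)%nat /\ Rabs (u p - l) < / INR (S m))), l.
  assert (HE := fun m => epsilon_spec (inhabits 0%nat) _ (H m)).
  split; [intros m; apply (HE m) |].
  intros e He; destruct (archimed_cor1 e He) as (N & HN & HN0).
  exists N; intros m Hm; eapply Rlt_trans; [apply (HE m) |].
  eapply Rle_lt_trans; [| exact HN].
  apply Rinv_le_contravar; [apply lt_0_INR; lia | apply le_INR; lia].
Qed.

Lemma bolzano_weierstrass_C (u : nat -> C) (B : R) :
  (forall n, Cmod (u n) <= B) ->
  exists (p : nat -> nat) (l : C), (forall m, (m <= p m)%nat) /\ Clim (fun m => u (p m)) l.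
Proof.
  intros HB.
  destruct (bolzano_weierstrass_R (fun n => Re (u n)) B) as (p & x & Hp & Hx).
  { intros n; eapply Rle_trans; [apply re_le_Cmod | auto]. }
  destruct (bolzano_weierstrass_R (fun n => Im (u (p n))) B) as (q & y & Hq & Hy).
  { intros n; eapply Rle_trans; [| apply (HB (p n))].
    eapply Rle_trans; [apply Rmax_r | apply Rmax_Cmod]. }
  exists (fun m => p (q m)), (x, y); split.
  { intros m; specialize (Hq m); specialize (Hp (q m)); lia. }
  intros e He.
  destruct (Hx (e / 2)) as [N1 H1]; [lra |]; destruct (Hy (e / 2)) as [N2 H2]; [lra |].
  exists (Nat.max N1 N2); intros m Hm.
  specialize (H1 (q m) ltac:(specialize (Hq m); lia)); specialize (H2 m ltac:(lia)).
  set (w := u (p (q m))) in *.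
  replace (w - (x, y))%C with (RtoC (Re w - x) + Ci * RtoC (Im w - y))%C
    by (apply injective_projections; unfold Re, Im; simpl; ring).
  eapply Rle_lt_trans; [apply Cmod_triangle |].
  rewrite Cmod_mult, !Cmod_R.
  replace (Cmod Ci) with 1; [lra |].
  transitivity (sqrt 1); [symmetry; apply sqrt_1 | unfold Cmod, Ci; f_equal; simpl; ring].
Qed.

Lemma diagonal_extraction (u : nat -> nat -> C) (B : nat -> R) :
  (forall i m, Cmod (u i m) <= B i) ->
  exists p : nat -> nat, (forall m, (m <= p m)%nat) /\
    exists l : nat -> C, forall i, Clim (fun m => u i (p m)) (l i).
Proof.
  intros HB.
  assert (Hext : forall i (q : nat -> nat), exists p, (forall m, (m <= p m)%nat) /\
            exists l, Clim (fun m => u i (q (p m))) l).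
  { intros i q; destruct (bolzano_weierstrass_C (fun m => u i (q m)) (B i)) as (p & l & Hp & Hl).
    - intros n; apply HB.
    - exists p; split; auto; exists l; auto. }
  set (ext := fun i q => epsilon (inhabits (fun m : nat => m)) (fun p => (forall m, (m <= p m)%nat) /\
            exists l, Clim (fun m => u i (q (p m))) l)).
  assert (HE : forall i q, (forall m, (m <= ext i q m)%nat) /\
            exists l, Clim (fun m => u i (q (ext i q m))) l).
  { intros i q; exact (epsilon_spec (inhabits (fun m : nat => m)) _ (Hext i q)). }
  set (P := fix P (i : nat) : nat -> nat :=
        match i with
        | O => fun m => m
        | S j => fun m => P j (ext j (P j) m)
        end).
  (* Later extractions refine earlier ones, so from m = i + 1 on the diagonal P m m takes values of
     P (i + 1) at arguments at least m. *)
  assert (Hrefine : forall i k m, exists m', (m <= m')%nat /\ P (i + k)%nat m = P i m').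
  { intros i k; induction k as [|k IH]; intros m.
    - exists m; rewrite Nat.add_0_r; auto.
    - rewrite Nat.add_succ_r; simpl.
      destruct (IH (ext (i + k)%nat (P (i + k)%nat) m)) as (m' & Hm' & E).
      exists m'; split; auto.
      pose proof (proj1 (HE (i + k)%nat (P (i + k)%nat)) m); lia. }
  exists (fun m => P m m); split.
  - intros m; destruct (Hrefine 0%nat m m) as (m' & Hm' & E); simpl in E; lia.
  - set (l := fun i => epsilon (inhabits (RtoC 0)) (fun l => Clim (fun m => u i (P (S i) m)) l)).
    assert (Hl : forall i, Clim (fun m => u i (P (S i) m)) (l i)).
    { intros i; apply (epsilon_spec (inhabits (RtoC 0)) (fun l => Clim (fun m => u i (P (S i) m)) l)).
      apply (proj2 (HE i (P i))). }
    exists l; intros i e He; destruct (Hl i e He) as [N HN].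
    exists (Nat.max N (S i)); intros m Hm.
    destruct (Hrefine (S i) (m - S i)%nat m) as (m' & Hm' & E).
    replace (S i + (m - S i))%nat with m in E by lia.
    rewrite E; apply HN; lia.
Qed.

(** * Solutions in the disk algebra *)

Lemma closed_disk_Clim (u : nat -> C) (l : C) :
  (forall m, closed_disk (u m)) -> Clim u l -> closed_disk l.
Proof.
  intros H Hl; unfold closed_disk in *.
  replace l with (l - 0)%C by ring.
  apply (Clim_dist_le u l 0 1 0 Hl); intros n _.
  replace (u n - 0)%C with (u n) by ring; auto.
Qed.

Lemma disk_algebra_bounded {V : NormedModule C_AbsRing} (f : C -> V) :
  disk_algebra f -> exists M, forall z, disk z -> norm (f z) <= M.
Proof.
  intros Hf; apply disk_algebra_eps in Hf; destruct Hf as (_ & F & HF & EF).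
  apply NNPP; intros Hno.
  assert (H : forall m, exists z, closed_disk z /\ INR m < norm (F z)).
  { intros m; apply NNPP; intros Hm; apply Hno; exists (INR m); intros z Hz.
    apply Rnot_lt_le; intros Hlt; apply Hm; exists z; split; [apply disk_closed_disk, Hz |].
    rewrite EF; auto. }
  set (u := fun m => epsilon (inhabits (RtoC 0)) (fun z => closed_disk z /\ INR m < norm (F z))).
  assert (HE : forall m, closed_disk (u m) /\ INR m < norm (F (u m))).
  { intros m; exact (epsilon_spec (inhabits (RtoC 0)) _ (H m)). }
  destruct (bolzano_weierstrass_C u 1) as (p & l & Hp & Hl).
  { intros n; apply (HE n). }
  assert (Hlc : closed_disk l).
  { apply (closed_disk_Clim (fun m => u (p m))); auto; intros m; apply HE. }
  destruct (HF l Hlc 1 Rlt_0_1) as (d & Hd & H1).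
  destruct (Hl d Hd) as [N HN].
  destruct (INR_unbounded (norm (F l) + 1)) as [N' HN'].
  set (m := Nat.max N N').
  specialize (H1 (u (p m)) (proj1 (HE _)) (HN m (Nat.le_max_l _ _))).
  pose proof (proj2 (HE (p m))) as H2.
  pose proof (norm_le_minus (F (u (p m))) (F l)) as H3.
  assert (INR N' <= INR (p m)).
  { apply le_INR; specialize (Hp m); unfold m in *; lia. }
  lra.
Qed.

(** Uniform continuity of the extension F, by contradiction: bad pairs (r, z) with r tending to 1
    and z to l also have r z tending to l. This is where continuity up to the circle enters. *)
Lemma disk_algebra_dilation_uniform {V : NormedModule C_AbsRing} (f : C -> V) (e : R) :
  disk_algebra f -> 0 < e -> exists r0, 0 <= r0 < 1 /\ forall r, r0 < r < 1 ->
    forall z, disk z -> norm (minus (f (RtoC r * z)%C) (f z)) <= e.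
Proof.
  intros Hf He; apply disk_algebra_eps in Hf; destruct Hf as (_ & F & HF & EF).
  apply NNPP; intros Hno.
  assert (H : forall m, exists rz : R * C, (1 - / INR (S m) < fst rz < 1 /\ 0 <= fst rz) /\
    disk (snd rz) /\ e < norm (minus (F (RtoC (fst rz) * snd rz)%C) (F (snd rz)))).
  { intros m; apply NNPP; intros Hm; apply Hno; exists (1 - / INR (S m)).
    assert (Hi : 0 < / INR (S m)) by (apply Rinv_0_lt_compat, lt_0_INR; lia).
    assert (Hi1 : / INR (S m) <= 1).
    { rewrite <- Rinv_1; apply Rinv_le_contravar; [lra |].
      rewrite S_INR; pose proof (pos_INR m); lra. }
    split; [lra |].
    intros r Hr z Hz; apply Rnot_lt_le; intros Hlt; apply Hm; exists (r, z); cbn [fst snd].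
    split; [split; lra |]; split; [exact Hz |].
    rewrite !EF; auto; apply disk_dilation; [lra | apply disk_closed_disk, Hz]. }
  set (u := fun m => epsilon (inhabits (0, RtoC 0)) (fun rz : R * C =>
    (1 - / INR (S m) < fst rz < 1 /\ 0 <= fst rz) /\
    disk (snd rz) /\ e < norm (minus (F (RtoC (fst rz) * snd rz)%C) (F (snd rz))))).
  assert (HE := fun m => epsilon_spec (inhabits (0, RtoC 0)) _ (H m)).
  change (forall m, (1 - / INR (S m) < fst (u m) < 1 /\ 0 <= fst (u m)) /\
    disk (snd (u m)) /\ e < norm (minus (F (RtoC (fst (u m)) * snd (u m))%C) (F (snd (u m))))) in HE.
  destruct (bolzano_weierstrass_C (fun m => snd (u m)) 1) as (p & l & Hp & Hl).
  { intros n; left; apply (HE n). }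
  assert (Hlc : closed_disk l).
  { apply (closed_disk_Clim (fun m => snd (u (p m)))); auto; intros m; apply disk_closed_disk, HE. }
  destruct (HF l Hlc (e / 2)) as (d & Hd & H1); [lra |].
  (* Half of d is for |z - l| and half for 1 - r, so that r z is also within d of l. *)
  destruct (Hl (d / 2)) as [N HN]; [lra |].
  destruct (archimed_cor1 (d / 2)) as (N' & HN' & HN0); [lra |].
  set (m := Nat.max N N').
  specialize (HN m (Nat.le_max_l _ _)).
  destruct (HE (p m)) as ([[R1 R2] R0] & Hz & Hbad).
  set (r := fst (u (p m))) in *; set (z := snd (u (p m))) in *.
  assert (Hr : 1 - r < d / 2).
  { apply Rlt_trans with (2 := HN'); apply Rlt_le_trans with (/ INR (S (p m))); [lra |].
    apply Rinv_le_contravar; [apply lt_0_INR; lia |].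
    apply le_INR; specialize (Hp m); unfold m in *; lia. }
  assert (D1 : Cmod (z - l) < d) by lra.
  assert (D2 : Cmod (RtoC r * z - l) < d).
  { replace (RtoC r * z - l)%C with ((z - l) + - (RtoC (1 - r) * z))%C
      by (rewrite RtoC_minus; ring).
    eapply Rle_lt_trans; [apply Cmod_triangle |].
    rewrite Cmod_opp, Cmod_mult, Cmod_R, Rabs_pos_eq by lra.
    unfold disk in Hz; pose proof (Cmod_ge_0 z); nra. }
  assert (Hrz : closed_disk (RtoC r * z)%C).
  { apply disk_closed_disk, disk_dilation; [lra | apply disk_closed_disk, Hz]. }
  pose proof (H1 z (disk_closed_disk z Hz) D1) as B1.
  pose proof (H1 _ Hrz D2) as B2.
  pose proof (norm_minus_triangle (F (RtoC r * z)%C) (F l) (F z)) as T.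
  rewrite (norm_minus_sym (F l)) in T; lra.
Qed.

(** * Sup norms and [dnorm] *)

Lemma sup_norm_spec {V : NormedModule C_AbsRing} (f : C -> V) (M : R) :
  (forall z, disk z -> norm (f z) <= M) ->
  (forall z, disk z -> norm (f z) <= sup_norm f) /\ sup_norm f <= M.
Proof.
  intros HM; unfold sup_norm.
  set (E := fun r => exists z, disk z /\ r = norm (f z)).
  destruct (Lub_Rbar_correct E) as [H1 H2].
  assert (HE : forall z, disk z -> E (norm (f z))) by (intros z Hz; exists z; auto).
  assert (HMb : Rbar_le (Lub_Rbar E) M).
  { apply H2; intros r (z & Hz & ->); apply HM, Hz. }
  pose proof (H1 _ (HE 0 disk_0)) as H0.
  destruct (Lub_Rbar E) as [s | |]; simpl in *; try contradiction.
  split; auto; intros z Hz; apply (H1 _ (HE z Hz)).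
Qed.

Lemma sup_norm_ub {V : NormedModule C_AbsRing} (f : C -> V) (z : C) :
  bounded_on_disk f -> disk z -> norm (f z) <= sup_norm f.
Proof. intros [M HM] Hz; apply (sup_norm_spec f M HM), Hz. Qed.

Lemma sup_norm_le {V : NormedModule C_AbsRing} (f : C -> V) (M : R) :
  (forall z, disk z -> norm (f z) <= M) -> sup_norm f <= M.
Proof. intros HM; apply (sup_norm_spec f M HM). Qed.

(** For unbounded f the inequality is 0 <= 0, because [real] sends +oo to 0. *)
Lemma sup_norm_ge_0 {V : NormedModule C_AbsRing} (f : C -> V) : 0 <= sup_norm f.
Proof.
  unfold sup_norm; set (E := fun r => exists z, disk z /\ r = norm (f z)).
  destruct (Lub_Rbar_correct E) as [H1 _].
  assert (H0 : Rbar_le (norm (f 0)) (Lub_Rbar E)) by (apply H1; exists 0; split; auto using disk_0).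
  pose proof (norm_ge_0 (f 0)).
  destruct (Lub_Rbar E); simpl in *; lra.
Qed.

Lemma Inv_fact_pos j : 0 < / INR (fact j).
Proof. apply Rinv_0_lt_compat, lt_0_INR, lt_O_fact. Qed.

Lemma Inv_fact_le_1 j : / INR (fact j) <= 1.
Proof.
  rewrite <- Rinv_1; apply Rinv_le_contravar; [lra |].
  apply (le_INR 1), lt_O_fact.
Qed.

Lemma dnorm_ge_0 n {V : NormedModule C_AbsRing} (f : C -> V) : 0 <= dnorm n f.
Proof.
  apply cond_pos_sum; intros j; apply Rmult_le_pos; [left; apply Inv_fact_pos | apply sup_norm_ge_0].
Qed.

(** The weights 1/j! are at most 1, so each of the n + 1 terms costs at most e. *)
Lemma dnorm_le n {V : NormedModule C_AbsRing} (f g : C -> V) (e : R) : 0 <= e ->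
  (forall j, (j <= n)%nat -> sup_norm (nderiv j f) <= sup_norm (nderiv j g) + e) ->
  dnorm n f <= dnorm n g + INR (S n) * e.
Proof.
  intros He; unfold dnorm; induction n as [|n IH]; intros H.
  - simpl; specialize (H 0%nat (le_n _)).
    pose proof (Inv_fact_pos 0) as P1; pose proof (Inv_fact_le_1 0) as P2.
    simpl in P1, P2, H; nra.
  - rewrite !tech5, S_INR.
    assert (IH' := IH (fun j Hj => H j (Nat.le_le_succ_r _ _ Hj))).
    specialize (H (S n) (le_n _)).
    pose proof (Inv_fact_pos (S n)); pose proof (Inv_fact_le_1 (S n)).
    assert (/ INR (fact (S n)) * sup_norm (nderiv (S n) f)
            <= / INR (fact (S n)) * sup_norm (nderiv (S n) g) + e).
    { apply Rle_trans with (/ INR (fact (S n)) * (sup_norm (nderiv (S n) g) + e)).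
      - apply Rmult_le_compat_l; lra.
      - rewrite Rmult_plus_distr_l; nra. }
    lra.
Qed.

Lemma uniform_bound n {V : NormedModule C_AbsRing} (f : C -> V) :
  (forall j, (j <= n)%nat -> bounded_on_disk (nderiv j f)) ->
  exists M, forall j, (j <= n)%nat -> forall z, disk z -> norm (nderiv j f z) <= M.
Proof.
  induction n as [|n IH]; intros H.
  - destruct (H 0%nat (le_n _)) as [M HM]; exists M; intros j Hj.
    replace j with 0%nat by lia; exact HM.
  - destruct IH as [M HM]; [intros; apply H; lia |].
    destruct (H (S n) (le_n _)) as [M' HM'].
    exists (Rmax M M'); intros j Hj z Hz.
    destruct (Nat.eq_dec j (S n)) as [-> | Hne].
    + eapply Rle_trans; [apply HM', Hz | apply Rmax_r].
    + eapply Rle_trans; [apply HM; [lia | exact Hz] | apply Rmax_l].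
Qed.

(** * Dilations of functions in the two spaces *)

Lemma dA_dHinf n (V : NormedModule C_AbsRing) (f : C -> V) : dA n V f -> dHinf n V f.
Proof.
  intros [Ha H]; split; auto; intros j Hj.
  apply disk_algebra_bounded, H, Hj.
Qed.

Lemma dHinf_pser n (f : C -> ell2) : dHinf n ell2_NormedModule f ->
  exists A M, (forall i, ell2_norm (A i) <= M) /\ pser A f.
Proof.
  intros [Ha H]; destruct (H 0%nat ltac:(lia)) as [M HM].
  destruct (bounded_analytic_pser f M Ha HM) as (A & HA & Hp); exists A, M; auto.
Qed.

(** [dHinf] itself asks the derivatives of positive order only to be bounded. Boundedness of f gives
    a power series, hence analyticity at every order j. *)
Lemma dHinf_analytic n (f : C -> ell2) j : dHinf n ell2_NormedModule f ->
  analytic (nderiv (V := ell2_NormedModule) j f).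
Proof.
  intros H; destruct (dHinf_pser n f H) as (A & M & HA & Hp).
  destruct (pser_nderiv A f j (radius_ge_1_of_bounded A M HA) Hp) as [Hj Hr].
  apply (pser_deriv _ _ Hr Hj).
Qed.

Lemma nderiv_dilation_disk_algebra {V : NormedModule C_AbsRing} (f : C -> V) (r : R) (j : nat) :
  0 <= r < 1 -> (forall i, analytic (nderiv i f)) -> disk_algebra (nderiv j (dilation r f)).
Proof.
  intros Hr Ha; destruct (nderiv_dilation f r j Hr (fun i _ => Ha i)) as [E Han].
  apply disk_algebra_eps; split; [exact Han |].
  (* The extension is the formula itself: for |z| <= 1 the point r z is inside the open disk. *)
  exists (fun z => scal (RtoC r ^ j)%C (nderiv j f (RtoC r * z)%C)); split.
  - intros z Hz e He.
    destruct (Ha j (RtoC r * z)%C (disk_dilation r z Hr Hz)) as [l Hl].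
    destruct (is_derive_continuous_eps _ _ _
                (is_derive_dilation (nderiv j f) (RtoC r ^ j)%C r z l Hl) e He) as (d & Hd & H).
    exists d; split; auto.
  - intros z Hz; symmetry; apply E, Hz.
Qed.

Lemma nderiv_dilation_norm {V : NormedModule C_AbsRing} (f : C -> V) (r M : R) (j : nat) :
  0 <= r < 1 -> (forall i, analytic (nderiv i f)) ->
  (forall z, disk z -> norm (nderiv j f z) <= M) ->
  forall z, disk z -> norm (nderiv j (dilation r f) z) <= M.
Proof.
  intros Hr Ha HM z Hz; destruct (nderiv_dilation f r j Hr (fun i _ => Ha i)) as [E _].
  rewrite (E z Hz), norm_scal_C, Cmod_pow, Cmod_R, Rabs_pos_eq by lra.
  pose proof (HM _ (disk_dilation r z Hr (disk_closed_disk z Hz))) as H.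
  pose proof (norm_ge_0 (nderiv j f (RtoC r * z)%C)).
  assert (r ^ j <= 1) by (rewrite <- (pow1 j); apply pow_incr; lra).
  assert (0 <= r ^ j) by (apply pow_le; lra).
  nra.
Qed.

Lemma Cn_dilation n (f : C -> ell2) (r M : R) :
  dHinf n ell2_NormedModule f -> 0 <= r < 1 ->
  (forall j, (j <= n)%nat -> forall z, disk z -> norm (nderiv (V := ell2_NormedModule) j f z) <= M) ->
  Cn (V := ell2_NormedModule) n (dilation r f) M.
Proof.
  intros Hf Hr HM; pose proof (fun i => dHinf_analytic n f i Hf) as Ha.
  apply Cn_of_nderiv; intros j Hj; split.
  - apply nderiv_dilation_disk_algebra; auto.
  - apply nderiv_dilation_norm; auto.
Qed.

Lemma Cn_dA n {V : NormedModule C_AbsRing} (f : C -> V) M : Cn n f M -> dA n V f.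
Proof.
  intros H; split.
  - apply (Cn_nderiv n f M 0 H); lia.
  - intros j Hj; apply (Cn_nderiv n f M j H Hj).
Qed.

Lemma dHinf_dilation n (f : C -> ell2) (r : R) :
  dHinf n ell2_NormedModule f -> 0 <= r < 1 ->
  dA n ell2_NormedModule (dilation r f)
  /\ forall j, (j <= n)%nat -> sup_norm (nderiv (V := ell2_NormedModule) j (dilation r f))
                              <= sup_norm (nderiv (V := ell2_NormedModule) j f).
Proof.
  intros Hf Hr; destruct (uniform_bound n f (proj2 Hf)) as [M HM].
  split; [apply (Cn_dA n _ M), Cn_dilation; auto |].
  intros j Hj; apply sup_norm_le, nderiv_dilation_norm; auto.
  - intros i; apply (dHinf_analytic n), Hf.
  - intros z Hz; apply sup_norm_ub; auto; apply Hf, Hj.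
Qed.

Lemma dA_Cn n (V : NormedModule C_AbsRing) (f : C -> V) : dA n V f -> exists M, Cn n f M.
Proof.
  intros H; destruct (uniform_bound n f (proj2 (dA_dHinf n V f H))) as [M HM].
  exists M; apply Cn_of_nderiv; intros j Hj; split; [apply H, Hj | apply HM, Hj].
Qed.

Lemma nderiv_ext {V : NormedModule C_AbsRing} (f g : C -> V) j :
  (forall i, (i <= j)%nat -> analytic (nderiv i f)) -> (forall z, disk z -> f z = g z) ->
  forall z, disk z -> nderiv j f z = nderiv j g z.
Proof.
  intros Ha E; induction j as [|j IH]; [exact E |].
  intros z Hz; apply (deriv_ext (nderiv j f) (nderiv j g)); auto.
Qed.

Lemma nderiv_plus {V : NormedModule C_AbsRing} (f g : C -> V) j :
  (forall i, (i <= j)%nat -> analytic (nderiv i f)) ->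
  (forall i, (i <= j)%nat -> analytic (nderiv i g)) ->
  forall z, disk z -> nderiv j (fun z => plus (f z) (g z)) z = plus (nderiv j f z) (nderiv j g z).
Proof.
  intros Hf Hg; induction j as [|j IH]; [reflexivity |].
  assert (IH' := IH (fun i Hi => Hf i (Nat.le_le_succ_r _ _ Hi))
                    (fun i Hi => Hg i (Nat.le_le_succ_r _ _ Hi))).
  intros z Hz; apply deriv_eq.
  apply (is_derive_ext_disk (fun z => plus (nderiv j f z) (nderiv j g z))); auto.
  - intros w Hw; symmetry; apply IH', Hw.
  - apply (is_derive_plus (K := C_AbsRing) (nderiv j f) (nderiv j g)); apply deriv_correct;
      [apply Hf | apply Hg]; auto.
Qed.

Lemma minus_opp_opp {G : AbelianGroup} (b d : G) : minus (opp b) (opp d) = opp (minus b d).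
Proof. symmetry; apply (opp_plus b (opp d)). Qed.

Lemma norm_minus_minus {V : NormedModule C_AbsRing} (a b c d : V) :
  norm (minus (minus a b) (minus c d)) <= norm (minus a c) + norm (minus b d).
Proof.
  eapply Rle_trans; [apply (norm_minus_plus a (opp b) c (opp d)) |].
  apply Rplus_le_compat_l.
  rewrite (minus_opp_opp b d : minus (opp b) (opp d) = opp (minus b d)).
  right; apply (norm_opp (minus b d)).
Qed.

Lemma disk_algebra_minus {V : NormedModule C_AbsRing} (u v : C -> V) :
  disk_algebra u -> disk_algebra v -> disk_algebra (fun z => minus (u z) (v z)).
Proof.
  intros Hu Hv; apply disk_algebra_eps in Hu; apply disk_algebra_eps in Hv.
  destruct Hu as (Hua & F & HF & EF), Hv as (Hva & G & HG & EG).
  apply disk_algebra_eps; split.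
  - intros z Hz; destruct (Hua z Hz) as [l Hl], (Hva z Hz) as [k Hk].
    exists (minus l k); apply (is_derive_minus (K := C_AbsRing) u v z l k Hl Hk).
  - exists (fun z => minus (F z) (G z)); split.
    + intros z Hz e He.
      destruct (HF z Hz (e / 2)) as (d1 & Hd1 & H1); [lra |].
      destruct (HG z Hz (e / 2)) as (d2 & Hd2 & H2); [lra |].
      exists (Rmin d1 d2); split; [apply Rmin_glb_lt; auto |]; intros w Hw Hwz.
      specialize (H1 w Hw (Rlt_le_trans _ _ _ Hwz (Rmin_l _ _))).
      specialize (H2 w Hw (Rlt_le_trans _ _ _ Hwz (Rmin_r _ _))).
      eapply Rle_lt_trans; [apply norm_minus_minus | lra].
    + intros z Hz; rewrite EF, EG by exact Hz; reflexivity.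
Qed.

Lemma nderiv_minus {V : NormedModule C_AbsRing} (f g : C -> V) j :
  (forall i, (i <= j)%nat -> analytic (nderiv i f)) ->
  (forall i, (i <= j)%nat -> analytic (nderiv i g)) ->
  forall z, disk z -> nderiv j (fun z => minus (f z) (g z)) z = minus (nderiv j f z) (nderiv j g z).
Proof.
  intros Hf Hg; induction j as [|j IH]; [reflexivity |].
  assert (IH' := IH (fun i Hi => Hf i (Nat.le_le_succ_r _ _ Hi))
                    (fun i Hi => Hg i (Nat.le_le_succ_r _ _ Hi))).
  intros z Hz; apply deriv_eq.
  apply (is_derive_ext_disk (fun z => minus (nderiv j f z) (nderiv j g z))); auto.
  - intros w Hw; symmetry; apply IH', Hw.
  - apply (is_derive_minus (K := C_AbsRing) (nderiv j f) (nderiv j g)); apply deriv_correct;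
      [apply Hf | apply Hg]; auto.
Qed.

Lemma norm_minus_scal {V : NormedModule C_AbsRing} (c : C) (x : V) :
  norm (minus (scal c x) x) = Cmod (c - 1) * norm x.
Proof.
  rewrite <- norm_scal_C; apply (f_equal norm).
  etransitivity; [| symmetry; apply (scal_minus_distr_r c (RtoC 1) x)].
  apply (f_equal (minus (scal c x))); symmetry; apply (scal_one x).
Qed.

Lemma common_threshold n (P : nat -> R -> Prop) :
  (forall j, (j <= n)%nat -> exists r0, 0 <= r0 < 1 /\ forall r, r0 < r < 1 -> P j r) ->
  exists r0, 0 <= r0 < 1 /\ forall r, r0 < r < 1 -> forall j, (j <= n)%nat -> P j r.
Proof.
  induction n as [|n IH]; intros H.
  - destruct (H 0%nat (le_n _)) as (r0 & H0 & H1); exists r0; split; auto.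
    intros r Hr j Hj; replace j with 0%nat by lia; auto.
  - destruct IH as (r1 & H1 & H1'); [intros; apply H; lia |].
    destruct (H (S n) (le_n _)) as (r2 & H2 & H2').
    exists (Rmax r1 r2); split.
    { split; [eapply Rle_trans; [apply H1 | apply Rmax_l] | apply Rmax_lub_lt; lra]. }
    intros r [Hr Hr1] j Hj.
    pose proof (Rmax_l r1 r2); pose proof (Rmax_r r1 r2).
    destruct (Nat.eq_dec j (S n)) as [-> | Hne].
    + apply H2'; lra.
    + apply H1'; [lra | lia].
Qed.

Lemma Cn_dilation_minus n (f : C -> ell2) (e : R) :
  dA n ell2_NormedModule f -> 0 < e -> exists r0, 0 <= r0 < 1 /\ forall r, r0 < r < 1 ->
    Cn (V := ell2_NormedModule) n (fun z => minus (dilation r f z) (f z)) e.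
Proof.
  intros Hf He; pose proof (dA_dHinf n _ f Hf) as HfH.
  pose proof (fun i => dHinf_analytic n f i HfH) as Ha.
  destruct (uniform_bound n f (proj2 HfH)) as [M HM].
  assert (HM0 : 0 <= M).
  { eapply Rle_trans; [apply (norm_ge_0 (nderiv (V := ell2_NormedModule) 0 f 0)) |].
    apply HM; [lia | apply disk_0]. }
  destruct (common_threshold n (fun j r => forall z, disk z ->
    norm (minus (nderiv (V := ell2_NormedModule) j (dilation r f) z) (nderiv j f z)) <= e))
    as (r0 & Hr0 & H).
  - intros j Hj.
    destruct (disk_algebra_dilation_uniform (nderiv (V := ell2_NormedModule) j f) (e / 2))
      as (r1 & Hr1 & H1); [apply Hf, Hj | lra |].
    pose proof (pos_INR j) as Hj0.
    assert (HjM : 0 <= INR j * M) by (apply Rmult_le_pos; auto).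
    (* The j-th derivative of f_r also carries the factor r^j. By Bernoulli 1 - r^j <= j (1 - r), so
       1 - r < d leaves e/2 for this factor and e/2 for the displacement. *)
    set (d := e / (2 * (INR j * M + 1))).
    assert (Hd : 0 < d) by (apply Rdiv_lt_0_compat; lra).
    assert (HdM : d * (INR j * M + 1) = e / 2) by (unfold d; field; lra).
    exists (Rmax r1 (1 - d)); split.
    { split; [eapply Rle_trans; [apply Hr1 | apply Rmax_l] | apply Rmax_lub_lt; lra]. }
    intros r [Hr Hr'] z Hz.
    pose proof (Rmax_l r1 (1 - d)); pose proof (Rmax_r r1 (1 - d)).
    destruct (nderiv_dilation f r j ltac:(lra) (fun i _ => Ha i)) as [E _].
    rewrite (E z Hz : nderiv (V := ell2_NormedModule) j (dilation r f) z = _).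
    set (D := nderiv (V := ell2_NormedModule) j f) in *.
    eapply Rle_trans; [apply (norm_minus_triangle _ (D (RtoC r * z)%C)) |].
    apply Rle_trans with (Cmod (RtoC r ^ j - 1) * norm (D (RtoC r * z)%C)
                          + norm (minus (D (RtoC r * z)%C) (D z))).
    { apply Rplus_le_compat_r; right; apply (norm_minus_scal (V := ell2_NormedModule)). }
    specialize (H1 r ltac:(lra) z Hz).
    assert (HD : norm (D (RtoC r * z)%C) <= M).
    { apply HM; auto; apply disk_dilation; [lra | apply disk_closed_disk, Hz]. }
    assert (Hc : Cmod (RtoC r ^ j - 1) <= INR j * (1 - r)).
    { rewrite <- RtoC_pow, <- RtoC_minus, Cmod_R.
      pose proof (bernoulli (1 - r) j ltac:(lra)) as B.
      replace (1 - (1 - r)) with r in B by ring.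
      assert (r ^ j <= 1) by (rewrite <- (pow1 j); apply pow_incr; lra).
      rewrite Rabs_minus_sym, Rabs_pos_eq; lra. }
    assert (Cmod (RtoC r ^ j - 1) * norm (D (RtoC r * z)%C) <= INR j * (1 - r) * M).
    { apply Rmult_le_compat; auto using Cmod_ge_0, norm_ge_0. }
    assert (INR j * (1 - r) * M <= d * (INR j * M + 1)).
    { replace (INR j * (1 - r) * M) with ((1 - r) * (INR j * M)) by ring.
      apply Rmult_le_compat; lra. }
    lra.
  - exists r0; split; auto; intros r Hr.
    apply Cn_of_nderiv; intros j Hj.
    assert (E : forall z, disk z ->
      nderiv (V := ell2_NormedModule) j (fun z => minus (dilation r f z) (f z)) z
      = minus (nderiv j (dilation r f) z) (nderiv j f z)).
    { apply (nderiv_minus (V := ell2_NormedModule) (dilation r f) f); intros i _; [| apply Ha].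
      apply (nderiv_dilation_disk_algebra f r i); auto; lra. }
    split.
    + apply (disk_algebra_ext (fun z => minus (nderiv (V := ell2_NormedModule) j (dilation r f) z)
                                              (nderiv j f z))).
      * intros z Hz; symmetry; apply E, Hz.
      * apply disk_algebra_minus; [| apply Hf, Hj].
        apply nderiv_dilation_disk_algebra; auto; lra.
    + intros z Hz; rewrite (E z Hz); apply H; auto.
Qed.

(** * Correcting a dilated solution *)

Lemma bezout_dot (g f : C -> ell2) :
  bezout g f <-> forall z, disk z -> dot (g z) (f z) = 1.
Proof.
  split; intros H z Hz.
  - apply dot_unique, H, Hz.
  - rewrite <- (H z Hz); apply dot_correct.
Qed.

(* With g_r(z) = g(rz) and h = g_r . f, the corrected solution is g_r / h; here
   1 - h = g_r . (f_r - f) because g_r . f_r = 1, so that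
   g_r / h = g_r + (1 - h) g_r / h is a small perturbation of g_r. *)
Lemma disk_algebra_solution n (f g : C -> ell2) (e : R) :
  dA n ell2_NormedModule f -> dHinf n ell2_NormedModule g -> bezout g f -> 0 < e ->
  exists g', dA n ell2_NormedModule g' /\ bezout g' f
             /\ dnorm n (V := ell2_NormedModule) g' <= dnorm n (V := ell2_NormedModule) g + e.
Proof.
  intros Hf Hg Hgf He.
  destruct (dA_Cn n _ f Hf) as [Mf HMf].
  destruct (uniform_bound n g (proj2 Hg)) as [Mg HMg].
  pose proof (Cn_ge_0 _ _ _ HMf) as HMf0.
  assert (HMg0 : 0 <= Mg).
  { eapply Rle_trans; [apply (norm_ge_0 (nderiv (V := ell2_NormedModule) 0 g 0)) |].
    apply HMg; [lia | apply disk_0]. }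
  assert (H2n : 1 <= 2 ^ n) by (apply pow_R1_Rle; lra).
  assert (HMgf : 0 <= 2 ^ n * (Mg * Mf)).
  { apply Rmult_le_pos; [lra | apply Rmult_le_pos; auto]. }
  (* K is obtained before r is chosen: it bounds 1/h for every h with the given bound, so eta, and
     then r, may depend on it. *)
  destruct (Cn_inv n _ HMgf) as [K HK].
  (* The correction is (1 - h) g_r / h; the three products in it each contribute 2^n, and its
     derivatives are bounded by eta L. [Rabs] is used since nothing is known about the sign of K. *)
  set (L := 2 ^ n * (2 ^ n * Mg * (2 ^ n * (Rabs K * Mg)))).
  assert (HL : 0 <= L).
  { unfold L; pose proof (Rabs_pos K); repeat apply Rmult_le_pos; lra. }
  pose proof (lt_0_INR (S n) (Nat.lt_0_succ n)) as Hn.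
  (* The first bound gives |1 - h| <= 1/2, hence |h| >= 1/2; the second makes the total cost (n + 1)
     eta L at most e. *)
  set (eta := Rmin (/ (2 * (Mg + 1))) (e / (INR (S n) * (L + 1)))).
  assert (Heta : 0 < eta).
  { apply Rmin_glb_lt; [apply Rinv_0_lt_compat; lra |].
    apply Rdiv_lt_0_compat; [lra | apply Rmult_lt_0_compat; lra]. }
  destruct (Cn_dilation_minus n f eta Hf Heta) as (r0 & Hr0 & Hr).
  set (r := (r0 + 1) / 2); specialize (Hr r ltac:(unfold r; lra)).
  assert (Hr1 : 0 <= r < 1) by (unfold r; lra).
  set (gr := dilation r g).
  assert (Hgr : Cn (V := ell2_NormedModule) n gr Mg) by (apply Cn_dilation; auto).
  set (h := fun z => dot (gr z) (f z)).
  set (d := fun z => dot (gr z) (minus (dilation r f z) (f z))).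
  assert (Hh : Cn (V := C_NormedModule) n h (2 ^ n * (Mg * Mf))).
  { apply (Cn_bil dot n gr f Mg Mf bounded_bilinear_dot Hgr HMf). }
  assert (Hd : Cn (V := C_NormedModule) n d (2 ^ n * (Mg * eta))).
  { exact (Cn_bil dot n gr _ Mg eta bounded_bilinear_dot Hgr Hr). }
  assert (Hhd : forall z, disk z -> h z = (1 - d z)%C).
  { intros z Hz; unfold h, d.
    assert (E1 : dot (gr z) (dilation r f z) = 1).
    { apply (proj1 (bezout_dot g f) Hgf (RtoC r * z)%C).
      apply disk_dilation; auto using disk_closed_disk. }
    rewrite (bil_minus_r dot bounded_bilinear_dot (gr z) (dilation r f z) (f z)
      : dot (gr z) (minus (dilation r f z) (f z))
        = (dot (gr z) (dilation r f z) - dot (gr z) (f z))%C).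
    rewrite E1; ring. }
  assert (Hlow : forall z, disk z -> / 2 <= Cmod (h z)).
  { intros z Hz.
    assert (Hdz : Cmod (d z) <= / 2).
    { apply Rle_trans with (Mg * eta).
      - eapply Rle_trans; [apply dot_le |].
        apply Rmult_le_compat; try apply ell2_norm_ge_0.
        + apply (Cn_bound _ _ _ Hgr z Hz).
        + apply (Cn_bound _ _ _ Hr z Hz).
      - assert (H1 : eta <= / (2 * (Mg + 1))) by apply Rmin_l.
        apply Rle_trans with ((Mg + 1) * / (2 * (Mg + 1))).
        + apply Rmult_le_compat; lra.
        + right; field; lra. }
    rewrite (Hhd z Hz).
    pose proof (Cmod_triangle (1 - d z) (d z)) as T.
    replace (1 - d z + d z)%C with (RtoC 1) in T by ring; rewrite Cmod_1 in T; lra. }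
  pose proof (HK h Hh Hlow) as Hk.
  apply (Cn_mono _ _ _ _ (Rle_abs K)) in Hk.
  set (g' := fun z => ell2_scal (/ h z)%C (gr z)).
  assert (Hg' : Cn (V := ell2_NormedModule) n g' (2 ^ n * (Rabs K * Mg))).
  { exact (Cn_bil _ n (fun z => / h z)%C gr _ _ (bounded_bilinear_scal ell2_NormedModule) Hk Hgr). }
  assert (Hp : Cn (V := ell2_NormedModule) n (fun z => ell2_scal (d z) (g' z)) (eta * L)).
  { replace (eta * L) with (2 ^ n * ((2 ^ n * (Mg * eta)) * (2 ^ n * (Rabs K * Mg))))
      by (unfold L; ring).
    exact (Cn_bil _ n d g' _ _ (bounded_bilinear_scal ell2_NormedModule) Hd Hg'). }
  assert (Edec : forall z, disk z -> ell2_plus (gr z) (ell2_scal (d z) (g' z)) = g' z).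
  { intros z Hz; unfold g'; pose proof (neq_0_of_half _ (Hlow z Hz)) as Hz0.
    assert (Ed : d z = (1 - h z)%C) by (rewrite (Hhd z Hz); ring).
    rewrite Ed; apply ell2_ext; intros k; simpl.
    change ((gr z k + (1 - h z) * (/ h z * gr z k))%C = (/ h z * gr z k)%C); field; exact Hz0. }
  exists g'; split; [apply (Cn_dA n _ _ Hg') |]; split.
  - apply bezout_dot; intros z Hz; unfold g'.
    rewrite (bil_scal_l dot bounded_bilinear_dot (/ h z)%C (gr z) (f z)
      : dot (ell2_scal (/ h z)%C (gr z)) (f z) = (/ h z * dot (gr z) (f z))%C).
    apply Cinv_l, neq_0_of_half, Hlow, Hz.
  - assert (HetaL : 0 <= eta * L) by (apply Rmult_le_pos; lra).
    eapply Rle_trans; [apply (dnorm_le n g' g (eta * L) HetaL) |].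
    + intros j Hj; apply sup_norm_le; intros z Hz.
      assert (An1 : forall i, (i <= j)%nat -> analytic (nderiv (V := ell2_NormedModule) i gr)).
      { intros i Hi; apply (Cn_nderiv n gr Mg i Hgr); lia. }
      assert (An2 : forall i, (i <= j)%nat ->
                analytic (nderiv (V := ell2_NormedModule) i (fun z => ell2_scal (d z) (g' z)))).
      { intros i Hi; apply (Cn_nderiv n _ _ i Hp); lia. }
      assert (An3 : forall i, (i <= j)%nat -> analytic (nderiv (V := ell2_NormedModule) i g')).
      { intros i Hi; apply (Cn_nderiv n _ _ i Hg'); lia. }
      rewrite (nderiv_ext (V := ell2_NormedModule) g'
                 (fun z => ell2_plus (gr z) (ell2_scal (d z) (g' z))) j An3
                 (fun w Hw => eq_sym (Edec w Hw)) z Hz).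
      pose proof (nderiv_plus (V := ell2_NormedModule) gr (fun z => ell2_scal (d z) (g' z)) j An1 An2 z Hz) as E.
      eapply Rle_trans; [right; apply (f_equal norm); exact E |].
      eapply Rle_trans; [apply norm_triangle |].
      apply Rplus_le_compat.
      * apply (nderiv_dilation_norm (V := ell2_NormedModule) g r _ j Hr1); auto.
        -- intros i; apply (dHinf_analytic n), Hg.
        -- intros w Hw; apply sup_norm_ub; auto; apply Hg, Hj.
      * apply (Cn_nderiv n _ _ j Hp); auto.
    + apply Rplus_le_compat_l.
      assert (H1 : eta <= e / (INR (S n) * (L + 1))) by apply Rmin_r.
      apply Rle_trans with (INR (S n) * (e / (INR (S n) * (L + 1)) * (L + 1))).
      * apply Rmult_le_compat_l; [lra |]; apply Rmult_le_compat; lra.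
      * right; field; lra.
Qed.

(** * Normal families of solutions *)

Lemma Clim_RtoC (x : nat -> R) (l : C) :
  Clim (fun m => RtoC (x m)) l -> is_lim_seq x (Re l).
Proof.
  intros H; apply is_lim_seq_spec; intros e; destruct (H e (cond_pos e)) as [N HN].
  exists N; intros m Hm; eapply Rle_lt_trans; [| apply (HN m Hm)].
  eapply Rle_trans; [| apply re_le_Cmod]; right; f_equal.
Qed.

(** The right-hand side is the coefficient sequence of the j-th derivative of M / (1 - x), a
    majorant common to all the solutions. *)
Lemma iter_coef_shift_le (A : nat -> ell2) (M : R) j i : 0 <= M ->
  (forall i, ell2_norm (A i) <= M) ->
  ell2_norm (Nat.iter j coef_shift A i) <= Nat.iter j PS_derive (fun _ => M) i.
Proof.
  intros HM HA; revert i; induction j as [|j IH]; intros i; [apply HA |].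
  change (ell2_norm (coef_shift (Nat.iter j coef_shift A) i)
          <= PS_derive (Nat.iter j PS_derive (fun _ => M)) i).
  rewrite ell2_norm_coef_shift; unfold PS_derive.
  apply Rmult_le_compat_l; [apply pos_INR | apply IH].
Qed.

Lemma CV_radius_iter_const (M : R) j :
  Rbar_le 1 (CV_radius (Nat.iter j PS_derive (fun _ => M))).
Proof.
  induction j as [|j IH].
  - apply (CV_radius_bounded (fun _ => M)).
    exists (Rabs M); intros n; rewrite pow1, Rmult_1_r; apply Rle_refl.
  - change (Nat.iter (S j) PS_derive (fun _ => M))
      with (PS_derive (Nat.iter j PS_derive (fun _ => M))).
    rewrite CV_radius_derive; exact IH.
Qed.

Lemma Clim_iter_coef_shift (A : nat -> nat -> ell2) (A' : nat -> ell2) j i k :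
  (forall i k, Clim (fun m => A m i k) (A' i k)) ->
  Clim (fun m => Nat.iter j coef_shift (A m) i k) (Nat.iter j coef_shift A' i k).
Proof.
  intros H; revert i; induction j as [|j IH]; intros i; [apply H |].
  change (Clim (fun m => RtoC (INR (S i)) * Nat.iter j coef_shift (A m) (S i) k)%C
               (RtoC (INR (S i)) * Nat.iter j coef_shift A' (S i) k)%C).
  rewrite Cmult_comm; intros e He.
  destruct (Clim_scal_r _ _ (RtoC (INR (S i))) (IH (S i)) e He) as [N HN].
  exists N; intros m Hm; rewrite Cmult_comm; apply HN, Hm.
Qed.

(** Convergence of Taylor coefficients gives convergence of all derivatives, coordinate by
    coordinate, by dominated convergence against the majorant above. *)
Lemma nderiv_pser_Clim (A : nat -> nat -> ell2) (A' : nat -> ell2) (g : nat -> C -> ell2)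
    (g' : C -> ell2) (M : R) j z k :
  (forall m i, ell2_norm (A m i) <= M) -> (forall i, ell2_norm (A' i) <= M) ->
  (forall i k, Clim (fun m => A m i k) (A' i k)) ->
  (forall m, pser (A m) (g m)) -> pser A' g' -> disk z ->
  Clim (fun m => coef (nderiv (V := ell2_NormedModule) j (g m) z) k)
       (coef (nderiv (V := ell2_NormedModule) j g' z) k).
Proof.
  intros HA HA' Hl Hg Hg' Hz.
  assert (HM : 0 <= M) by (eapply Rle_trans; [apply ell2_norm_ge_0 | apply (HA' 0%nat)]).
  assert (Hb0 : forall i, 0 <= Nat.iter j PS_derive (fun _ => M) i).
  { intros i; eapply Rle_trans; [apply ell2_norm_ge_0 | apply (iter_coef_shift_le A' M j i HM HA')]. }
  assert (Hterm : forall B : nat -> ell2, (forall i, ell2_norm (B i) <= M) -> forall i,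
    Cmod (Nat.iter j coef_shift B i k * z ^ i) <= Nat.iter j PS_derive (fun _ => M) i * Cmod z ^ i).
  { intros B HB i; rewrite Cmod_mult, Cmod_pow.
    apply Rmult_le_compat_r; [apply pow_le, Cmod_ge_0 |].
    eapply Rle_trans; [apply ell2_coef_le | apply iter_coef_shift_le; auto]. }
  apply (Clim_series (fun m i => Nat.iter j coef_shift (A m) i k * z ^ i)%C
           (fun i => Nat.iter j coef_shift A' i k * z ^ i)%C
           (fun i => Nat.iter j PS_derive (fun _ => M) i * Cmod z ^ i)).
  - intros m i; apply Hterm, HA.
  - intros i; apply Hterm, HA'.
  - apply radius_ge_1_ex_series; auto using CV_radius_iter_const.
    split; [apply Cmod_ge_0 | exact Hz].
  - intros i; apply Clim_scal_r, Clim_iter_coef_shift, Hl.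
  - intros m; apply pser_nderiv; auto; apply (radius_ge_1_of_bounded _ M), HA.
  - apply pser_nderiv; auto; apply (radius_ge_1_of_bounded _ M), HA'.
Qed.

Lemma sup_norm_le_dnorm n {V : NormedModule C_AbsRing} (f : C -> V) j : (j <= n)%nat ->
  sup_norm (nderiv j f) <= INR (fact j) * dnorm n f.
Proof.
  intros Hj.
  assert (H : / INR (fact j) * sup_norm (nderiv j f) <= dnorm n f).
  { unfold dnorm; induction n as [|n IH].
    - replace j with 0%nat by lia; simpl; lra.
    - rewrite tech5.
      pose proof (Rmult_le_pos _ _ (Rlt_le _ _ (Inv_fact_pos (S n))) (sup_norm_ge_0 (nderiv (S n) f))).
      destruct (Nat.eq_dec j (S n)) as [-> | Hne].
      + pose proof (dnorm_ge_0 n f) as H0; unfold dnorm in H0; lra.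
      + specialize (IH ltac:(lia)); lra. }
  apply (Rmult_le_compat_l (INR (fact j))) in H; [| apply pos_INR].
  rewrite <- Rmult_assoc, Rinv_r, Rmult_1_l in H by (apply INR_fact_neq_0); exact H.
Qed.

(** Replacing w_m by its norm limit u changes the product by at most M |w_m - u|; after that only
    the weakly convergent factor varies. *)
Lemma dot_strong_limit (v : nat -> ell2) (w : nat -> ell2) (a u : ell2) (M : R) (c : C) :
  (forall m, ell2_norm (v m) <= M) -> (forall k, Clim (fun m => v m k) (a k)) ->
  (forall e, 0 < e -> exists N, forall m, (N <= m)%nat -> ell2_norm (minus (w m) u) < e) ->
  (forall m, dot (v m) (w m) = c) -> dot a u = c.
Proof.
  intros HM Hl Hw Hc; apply Ceq_of_le_eps; intros e He.
  pose proof (Rle_trans _ _ _ (ell2_norm_ge_0 (v 0%nat)) (HM 0%nat)) as HM0.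
  destruct (dot_weak_limit v a u M HM Hl (e / 2)) as [N1 H1]; [lra |].
  destruct (Hw (e / (2 * (M + 1)))) as [N2 H2]; [apply Rdiv_lt_0_compat; lra |].
  set (m := Nat.max N1 N2).
  specialize (H1 m (Nat.le_max_l _ _)); specialize (H2 m (Nat.le_max_r _ _)).
  rewrite <- (Hc m).
  replace (dot a u - dot (v m) (w m))%C
    with (- (dot (v m) u - dot a u) + - (dot (v m) (w m) - dot (v m) u))%C by ring.
  eapply Rle_trans; [apply Cmod_triangle |]; rewrite !Cmod_opp.
  assert (H3 : Cmod (dot (v m) (w m) - dot (v m) u) <= e / 2).
  { rewrite <- (bil_minus_r dot bounded_bilinear_dot (v m) (w m) u
      : dot (v m) (minus (w m) u) = (dot (v m) (w m) - dot (v m) u)%C).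
    eapply Rle_trans; [apply dot_le |].
    apply Rle_trans with ((M + 1) * (e / (2 * (M + 1)))).
    - apply Rmult_le_compat; auto using ell2_norm_ge_0; specialize (HM m); lra.
    - right; field; lra. }
  lra.
Qed.

(* Solutions of the dilated problems form a normal family: the Taylor
   coefficients, and the sup norms entering [dnorm], converge along a diagonal
   sequence. *)
Lemma dHinf_solution n (f : C -> ell2) (c : R) :
  dHinf n ell2_NormedModule f ->
  (forall r e, 0 <= r < 1 -> 0 < e -> exists g, dA n ell2_NormedModule g
     /\ bezout g (dilation r f) /\ dnorm n (V := ell2_NormedModule) g <= c + e) ->
  exists g, dHinf n ell2_NormedModule g /\ bezout g f
            /\ dnorm n (V := ell2_NormedModule) g <= c.
Proof.
  intros Hf Hsol.
  assert (Hinv : forall m, 0 < / INR (S m) <= 1).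
  { intros m; split; [apply Rinv_0_lt_compat, lt_0_INR; lia |].
    rewrite <- Rinv_1; apply Rinv_le_contravar; [lra | apply (le_INR 1); lia]. }
  set (r := fun m => 1 - / INR (S m)).
  set (G := fun m => epsilon (inhabits (fun _ : C => ell2_zero)) (fun g => dA n ell2_NormedModule g
     /\ bezout g (dilation (r m) f) /\ dnorm n (V := ell2_NormedModule) g <= c + / INR (S m))).
  assert (HG : forall m, dA n ell2_NormedModule (G m) /\ bezout (G m) (dilation (r m) f)
                         /\ dnorm n (V := ell2_NormedModule) (G m) <= c + / INR (S m)).
  { intros m; unfold G; apply epsilon_spec, Hsol; unfold r; specialize (Hinv m); lra. }
  clearbody G.
  set (s := fun j m => sup_norm (nderiv (V := ell2_NormedModule) j (G m))).
  assert (Hs : forall j m, (j <= n)%nat -> 0 <= s j m <= INR (fact j) * (c + 1)).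
  { intros j m Hj; split; [apply sup_norm_ge_0 |].
    eapply Rle_trans; [apply (sup_norm_le_dnorm n _ j Hj) |].
    apply Rmult_le_compat_l; [apply pos_INR |].
    pose proof (proj2 (proj2 (HG m))); specialize (Hinv m); lra. }
  (* As 0! = 1, the sup norm of each [G m] is at most its [dnorm], hence at most c + 1. *)
  set (M := c + 1).
  assert (HM0 : 0 <= M).
  { destruct (Hs 0%nat 0%nat (Nat.le_0_l n)) as [H1 H2]; simpl in H2; unfold M; lra. }
  assert (HGb : forall m j z, (j <= n)%nat -> disk z ->
            ell2_norm (nderiv (V := ell2_NormedModule) j (G m) z) <= s j m).
  { intros m j z Hj Hz; apply (sup_norm_ub (V := ell2_NormedModule) (nderiv j (G m))); auto.
    apply (dA_dHinf n _ (G m) (proj1 (HG m))), Hj. }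
  assert (HGM : forall m z, disk z -> ell2_norm (G m z) <= M).
  { intros m z Hz; eapply Rle_trans; [apply (HGb m 0%nat z); [lia | exact Hz] |].
    destruct (Hs 0%nat m (Nat.le_0_l n)) as [H1 H2]; simpl in H2; unfold M; lra. }
  set (A := fun m => epsilon (inhabits (fun _ : nat => ell2_zero))
              (fun A => (forall i, ell2_norm (A i) <= M) /\ pser A (G m))).
  assert (HA : forall m, (forall i, ell2_norm (A m i) <= M) /\ pser (A m) (G m)).
  { intros m.
    exact (epsilon_spec (inhabits (fun _ : nat => ell2_zero)) _
             (bounded_analytic_pser (G m) M (proj1 (proj1 (HG m))) (HGM m))). }
  clearbody A.
  (* All scalars that must converge are packed into one family: index (0, j) carries the sup norm of
     the j-th derivative, set to 0 for j > n where no bound is available, and (i + 1, k) the k-th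
     coordinate of the i-th Taylor coefficient. *)
  set (u := fun idx m => match Cantor.of_nat idx with
                         | (O, j) => if Nat.leb j n then RtoC (s j m) else RtoC 0
                         | (S i, k) => A m i k
                         end).
  set (B := fun idx => match Cantor.of_nat idx with
                       | (O, j) => INR (fact j) * (c + 1)
                       | (S i, k) => M
                       end).
  assert (HuB : forall idx m, Cmod (u idx m) <= B idx).
  { intros idx m; unfold u, B; destruct (Cantor.of_nat idx) as [[|i] k].
    - destruct (Nat.leb k n) eqn:E.
      + apply Nat.leb_le in E; rewrite Cmod_R, Rabs_pos_eq; apply Hs, E.
      + rewrite Cmod_0; apply Rmult_le_pos; [apply pos_INR | exact HM0].
    - eapply Rle_trans; [apply ell2_coef_le | apply HA]. }
  destruct (diagonal_extraction u B HuB) as (p & Hp & l & Hl).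
  assert (HlA : forall i k, Clim (fun m => A (p m) i k) (l (Cantor.to_nat (S i, k)))).
  { intros i k; pose proof (Hl (Cantor.to_nat (S i, k))) as H.
    unfold u in H; rewrite Cantor.cancel_of_to in H; exact H. }
  assert (Hls : forall j, (j <= n)%nat ->
            is_lim_seq (fun m => s j (p m)) (Re (l (Cantor.to_nat (0%nat, j))))).
  { intros j Hj; apply Clim_RtoC; pose proof (Hl (Cantor.to_nat (0%nat, j))) as H.
    unfold u in H; rewrite Cantor.cancel_of_to in H.
    apply Nat.leb_le in Hj; rewrite Hj in H; exact H. }
  set (S' := fun j => Re (l (Cantor.to_nat (0%nat, j)))).
  change (forall j, (j <= n)%nat -> is_lim_seq (fun m => s j (p m)) (S' j)) in Hls.
  clearbody S'.
  (* The extraction yields scalar limits only; Fatou assembles them into l^2 vectors with the same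
     bound M. *)
  assert (HA'ex : forall i, exists v : ell2,
            (forall k, v k = l (Cantor.to_nat (S i, k))) /\ ell2_norm v <= M).
  { intros i; apply (ell2_fatou (fun m => A (p m) i)); auto.
    intros e He; exists 0%nat; intros m _; pose proof (proj1 (HA (p m)) i); lra. }
  set (A' := fun i => epsilon (inhabits ell2_zero)
            (fun v => (forall k, coef v k = l (Cantor.to_nat (S i, k))) /\ ell2_norm v <= M)).
  assert (HA' : forall i, (forall k, A' i k = l (Cantor.to_nat (S i, k))) /\ ell2_norm (A' i) <= M).
  { intros i; exact (epsilon_spec (inhabits ell2_zero) _ (HA'ex i)). }
  destruct (pser_exists A') as [g Hg].
  { apply (radius_ge_1_of_bounded A' M); intros i; apply HA'. }
  assert (Hlim : forall j z k, disk z ->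
    Clim (fun m => coef (nderiv (V := ell2_NormedModule) j (G (p m)) z) k)
         (coef (nderiv (V := ell2_NormedModule) j g z) k)).
  { intros j z k Hz.
    apply (nderiv_pser_Clim (fun m => A (p m)) A' (fun m => G (p m)) g M); auto.
    - intros m i; apply HA.
    - intros i; apply HA'.
    - intros i k'; rewrite (proj1 (HA' i)); apply HlA.
    - intros m; apply HA. }
  assert (HS0 : forall j, (j <= n)%nat -> 0 <= S' j).
  { intros j Hj.
    apply (is_lim_seq_le (fun _ => 0) (fun m => s j (p m)) 0 (S' j)); auto using is_lim_seq_const.
    intros m; apply Hs, Hj. }
  (* Weak lower semicontinuity at each point, with the limit of the sup norms as bound. *)
  assert (Hgb : forall j, (j <= n)%nat -> forall z, disk z ->
            norm (nderiv (V := ell2_NormedModule) j g z) <= S' j).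
  { intros j Hj z Hz.
    destruct (ell2_fatou (fun m => nderiv (V := ell2_NormedModule) j (G (p m)) z)
                (fun k => coef (nderiv (V := ell2_NormedModule) j g z) k) (S' j)) as (v & Hv & Hvn).
    - apply HS0, Hj.
    - intros e He; pose proof (proj2 (is_lim_seq_spec _ _) (Hls j Hj)) as H.
      destruct (H (mkposreal e He)) as [N HN]; exists N; intros m Hm.
      specialize (HN m Hm); change (Rabs (s j (p m) - S' j) < e) in HN; apply Rabs_def2 in HN.
      eapply Rle_trans; [apply HGb; auto |]; lra.
    - intros k; apply Hlim, Hz.
    - replace (nderiv (V := ell2_NormedModule) j g z) with v; [exact Hvn |].
      apply ell2_ext; exact Hv. }
  exists g; split; [| split].
  - split.
    + apply (pser_deriv A' g); auto; apply (radius_ge_1_of_bounded A' M); intros i; apply HA'.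
    + intros j Hj; exists (S' j); apply Hgb, Hj.
  - apply bezout_dot; intros z Hz.
    apply (dot_strong_limit (fun m => G (p m) z) (fun m => f (RtoC (r (p m)) * z)%C) (g z) (f z) M).
    + intros m; apply HGM, Hz.
    + intros k; apply (Hlim 0%nat z k Hz).
    + intros e He; destruct (proj1 Hf z Hz) as [l' Hl'].
      destruct (is_derive_continuous_eps (V := ell2_NormedModule) f z l' Hl' e He) as (d & Hd & Hc).
      destruct (archimed_cor1 d Hd) as (N & HN & HN0).
      exists N; intros m Hm; apply Hc.
      replace (RtoC (r (p m)) * z - z)%C with (- (RtoC (/ INR (S (p m))) * z))%C
        by (unfold r; rewrite RtoC_minus; ring).
      pose proof (Hinv (p m)).
      rewrite Cmod_opp, Cmod_mult, Cmod_R, Rabs_pos_eq by lra.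
      assert (/ INR (S (p m)) <= / INR N).
      { apply Rinv_le_contravar; [apply lt_0_INR; lia |].
        apply le_INR; specialize (Hp m); lia. }
      unfold disk in Hz; pose proof (Cmod_ge_0 z); nra.
    + intros m; exact (proj1 (bezout_dot _ _) (proj1 (proj2 (HG (p m)))) z Hz).
  (* The weighted sum of the limits S' is the limit of [dnorm n (G (p m))], and these are at most c
     + 1/(m + 1). *)
  - assert (Hle : dnorm n (V := ell2_NormedModule) g
                  <= sum_f_R0 (fun j => / INR (fact j) * S' j) n).
    { apply sum_Rle; intros j Hj; apply Rmult_le_compat_l; [left; apply Inv_fact_pos |].
      apply sup_norm_le, Hgb, Hj. }
    apply Rle_trans with (1 := Hle); apply Rle_of_le_eps; intros e He.
    assert (Hlims : forall q, (q <= n)%nat ->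
      is_lim_seq (fun m => sum_f_R0 (fun j => / INR (fact j) * s j (p m)) q)
                 (sum_f_R0 (fun j => / INR (fact j) * S' j) q)).
    { assert (Ht : forall j, (j <= n)%nat ->
        is_lim_seq (fun m => / INR (fact j) * s j (p m)) (/ INR (fact j) * S' j)).
      { intros j Hj; apply (is_lim_seq_scal_l (fun m => s j (p m)) (/ INR (fact j)) (S' j)), Hls, Hj. }
      induction q as [|q IH]; intros Hq; [apply Ht, Hq |].
      simpl; apply is_lim_seq_plus'; [apply IH; lia | apply (Ht (S q)), Hq]. }
    destruct (archimed_cor1 e He) as (N & HN & HN0).
    apply (is_lim_seq_le_loc (fun m => sum_f_R0 (fun j => / INR (fact j) * s j (p m)) n)
             (fun _ => c + e) (sum_f_R0 (fun j => / INR (fact j) * S' j) n) (c + e));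
      auto using is_lim_seq_const.
    exists N; intros m Hm.
    eapply Rle_trans; [apply (HG (p m)) |]; apply Rplus_le_compat_l.
    apply Rle_trans with (/ INR N); [| lra].
    apply Rinv_le_contravar; [apply lt_0_INR; lia |].
    apply le_INR; specialize (Hp m); lia.
Qed.

(** * Comparison of the infima and of the two constants *)

Lemma solution_norm_le n (A : forall V : NormedModule C_AbsRing, (C -> V) -> Prop)
    (f g : C -> ell2) :
  A ell2_NormedModule g -> bezout g f ->
  Rbar_le (solution_norm n A f) (dnorm n (V := ell2_NormedModule) g).
Proof.
  intros Hg Hb; unfold solution_norm.
  match goal with |- Rbar_le (Glb_Rbar ?E) _ => destruct (Glb_Rbar_correct E) as [H _] end.
  apply H; exists g; auto.
Qed.

Lemma solution_norm_ge_0 n A (f : C -> ell2) : Rbar_le 0 (solution_norm n A f).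
Proof.
  unfold solution_norm.
  match goal with |- Rbar_le _ (Glb_Rbar ?E) => destruct (Glb_Rbar_correct E) as [_ H] end.
  apply H; intros x (g & _ & _ & ->); apply (dnorm_ge_0 n (V := ell2_NormedModule) g).
Qed.

(** If every solution had norm above c + e, then c + e would be a lower bound; this includes the
    case of no solution, where the infimum is +oo and exceeds c. *)
Lemma solution_norm_approx n A (f : C -> ell2) (c e : R) :
  Rbar_le (solution_norm n A f) c -> 0 < e ->
  exists g, A ell2_NormedModule g /\ bezout g f /\ dnorm n (V := ell2_NormedModule) g <= c + e.
Proof.
  intros Hc He; apply NNPP; intros Hno; unfold solution_norm in Hc.
  match type of Hc with Rbar_le (Glb_Rbar ?E) _ => destruct (Glb_Rbar_correct E) as [_ H] end.
  assert (Hl : Rbar_le (c + e) c).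
  { eapply Rbar_le_trans; [| exact Hc].
    apply H; intros x (g & Hg & Hb & ->).
    apply Rnot_lt_le; intros Hlt; apply Hno; exists g; repeat split; auto; left; exact Hlt. }
  simpl in Hl; lra.
Qed.

Lemma solution_norm_dA_le n (f : C -> ell2) : dA n ell2_NormedModule f ->
  Rbar_le (solution_norm n (dA n) f) (solution_norm n (dHinf n) f).
Proof.
  intros Hf; unfold solution_norm at 2.
  match goal with |- Rbar_le _ (Glb_Rbar ?E) => destruct (Glb_Rbar_correct E) as [_ H] end.
  apply H; intros x (g & Hg & Hb & ->).
  assert (He : forall e, 0 < e ->
    Rbar_le (solution_norm n (dA n) f) (dnorm n (V := ell2_NormedModule) g + e)).
  { intros e He; destruct (disk_algebra_solution n f g e Hf Hg Hb He) as (g' & Hg' & Hb' & Hle).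
    eapply Rbar_le_trans; [apply (solution_norm_le n (dA n) f g' Hg' Hb') | exact Hle]. }
  destruct (solution_norm n (dA n) f) as [s | |].
  - apply Rle_of_le_eps; exact He.
  - destruct (He 1 Rlt_0_1).
  - exact I.
Qed.

Lemma corona_data_dilation n delta (f : C -> ell2) r :
  corona_data n (dHinf n) delta f -> 0 <= r < 1 -> corona_data n (dA n) delta (dilation r f).
Proof.
  intros (Hf & Hn & Hd) Hr; destruct (dHinf_dilation n f r Hf Hr) as [H1 H2].
  split; [exact H1 |]; split.
  - eapply Rle_trans; [| exact Hn].
    replace (dnorm n (V := ell2_NormedModule) f)
      with (dnorm n (V := ell2_NormedModule) f + INR (S n) * 0) by ring.
    apply (dnorm_le n (V := ell2_NormedModule) (dilation r f) f 0); [lra |].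
    intros j Hj; rewrite Rplus_0_r; apply H2, Hj.
  - intros z Hz; apply Hd, disk_dilation; auto using disk_closed_disk.
Qed.

Theorem mainTheorem3 (n : nat) (delta : R) (hdelta : 0 < delta) :
  bezout_constant n (dA n) delta
  = bezout_constant n (dHinf n) delta.
Proof.
  set (EA := fun c => exists f, corona_data n (dA n) delta f /\ c = solution_norm n (dA n) f).
  set (EH := fun c => exists f, corona_data n (dHinf n) delta f /\ c = solution_norm n (dHinf n) f).
  change (Rbar_lub EA = Rbar_lub EH).
  destruct (proj2_sig (Rbar_ex_lub EA)) as [UA LA].
  destruct (proj2_sig (Rbar_ex_lub EH)) as [UH LH].
  change (proj1_sig (Rbar_ex_lub EA)) with (Rbar_lub EA) in *.
  change (proj1_sig (Rbar_ex_lub EH)) with (Rbar_lub EH) in *.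
  apply Rbar_le_antisym.
  - apply LA; intros c (f & Hf & ->).
    apply Rbar_le_trans with (1 := solution_norm_dA_le n f (proj1 Hf)).
    apply UH; exists f; split; auto.
    destruct Hf as (H1 & H2 & H3); split; auto; apply dA_dHinf, H1.
  - apply LH; intros x (f & Hf & ->).
    assert (Hr : forall r, 0 <= r < 1 ->
              Rbar_le (solution_norm n (dA n) (dilation r f)) (Rbar_lub EA)).
    { intros r Hr; apply UA; exists (dilation r f); split; auto.
      apply corona_data_dilation; auto. }
    destruct (Rbar_lub EA) as [c | |].
    (* The same c bounds the infima of all dilations, each of which is approached up to any e; the
       limit attains c itself. *)
    + destruct (dHinf_solution n f c (proj1 Hf)) as (g & Hg & Hb & Hn).
      { intros r e Hr1 He; apply solution_norm_approx; auto. }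
      apply Rbar_le_trans with (1 := solution_norm_le n (dHinf n) f g Hg Hb); exact Hn.
    + destruct (solution_norm n (dHinf n) f); exact I.
    (* The supremum cannot be -oo: the dilation of f with r = 0 is admissible and its infimum is
       nonnegative. *)
    + pose proof (solution_norm_ge_0 n (dA n) (dilation 0 f)) as H0.
      specialize (Hr 0 ltac:(lra)).
      destruct (solution_norm n (dA n) (dilation 0 f)); simpl in *; contradiction.
Qed.
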